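(* Let $W_1,\dots,W_n$ be i.i.d. copies of $W$, which includes $Y$ and $X$; let $\gamma_0(x)=\mathrm{E}[Y\mid X=x]$, $\theta_0=\mathrm{E}[m(W,\gamma_0)]$, and let $\alpha_0$ be the Riesz representer of $\gamma\mapsto\mathrm{E}[m(W,\gamma)]$. Let $\hat\theta$ and $\hat V$ be the cross-fitted estimators given in the context, built from learners $\hat\gamma_\ell,\hat\alpha_\ell$, $\ell=1,\dots,L$. Suppose: (1) for some $M>0$, $\mathrm{E}[m(W,\alpha)^2]\le M\|\alpha\|^2$ for all $\alpha$ with $\mathrm{E}[\alpha(X)^2]<\infty$; (2) $\alpha_0(X)$ and $\sigma_0^2(X)=\mathrm{E}[(Y-\gamma_0(X))^2\mid X]$ are bounded and $\mathrm{E}[m(W,\gamma_0)^2]<\infty$; (3) for each $\ell$: (i) $\|\hat\gamma_\ell-\gamma_0\|\overset{p}{\to}0$ and $\|\hat\alpha_\ell-\alpha_0\|\overset{p}{\to}0$; (ii) $\sqrt n\,\|\hat\gamma_\ell-\gamma_0\|\,\|\hat\alpha_\ell-\alpha_0\|\overset{p}{\to}0$; (iii) $\hat\alpha_\ell(X)$ is bounded. Then $$\sqrt n(\hat\theta-\theta_0)\overset{d}{\to}N(0,V)\quad\text{and}\quad \hat V\overset{p}{\to}V,$$ where $V=\mathrm{E}[\{m(W,\gamma_0)-\theta_0+\alpha_0(X)(Y-\gamma_0(X))\}^2]$.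
   Context: $m(w,\gamma)$ is a real-valued functional of a data observation $w$ and a possible regression function $\gamma$ of $x$; $\gamma\mapsto m(w,\gamma)$ is linear and there is a constant $c>0$ with $|\mathrm{E}[m(W,\gamma)]|^2\le c\,\mathrm{E}[\gamma(X)^2]$ for all $\gamma$ with $\mathrm{E}[\gamma(X)^2]<\infty$. $\mathrm{E}[\gamma_0(X)^2]<\infty$. The Riesz representer $\alpha_0$ is the function with $\mathrm{E}[\alpha_0(X)^2]<\infty$ and $\mathrm{E}[m(W,\gamma)]=\mathrm{E}[\alpha_0(X)\gamma(X)]$ for all square-integrable $\gamma$. $\|a\|=\sqrt{\mathrm{E}[a(W)^2]}$; for a data-dependent function the expectation is over a fresh draw of $W$ with the function held fixed. Boundedness of $\hat\alpha_\ell(X)$ means by a constant not depending on $n$. Cross-fitting: the indices $\{1,\dots,n\}$ are partitioned into $L$ (fixed) disjoint subsets $I_1,\dots,I_L$ of about equal size. For each $\ell$, $\hat\gamma_\ell$ (a learner of $\gamma_0$) and $\hat\alpha_\ell$ (a learner of $\alpha_0$) are computed using only observations not in $I_\ell$; any such learners are allowed. The estimators are $$\hat\theta=\frac1n\sum_{\ell=1}^L\sum_{i\in I_\ell}\{m(W_i,\hat\gamma_\ell)+\hat\alpha_\ell(X_i)(Y_i-\hat\gamma_\ell(X_i))\},$$ $$\hat V=\frac1n\sum_{\ell=1}^L\sum_{i\in I_\ell}\{m(W_i,\hat\gamma_\ell)+\hat\alpha_\ell(X_i)(Y_i-\hat\gamma_\ell(X_i))-\hat\theta\}^2.$$ *)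

(* Defs.v *)
From HB Require Import structures.
From mathcomp Require Import all_boot all_order all_algebra finmap.
From mathcomp Require Import all_classical all_reals all_analysis.

Set Implicit Arguments.
Unset Strict Implicit.
Unset Printing Implicit Defensive.

Import Order.TTheory GRing.Theory Num.Theory.
Import numFieldNormedType.Exports.

Local Open Scope classical_set_scope.
Local Open Scope ring_scope.

Section probability_notions.
Context {dO d : measure_display} {Omega : measurableType dO}
  {T : measurableType d} {R : realType} (P : probability Omega R).

Definition mutually_independent (Z : nat -> Omega -> T) : Prop :=
  forall (J : {fset nat}) (A : nat -> set T),
    (forall i, measurable (A i)) ->
    P (\bigcap_(i in [set` J]) Z i @^-1` A i) =
    (\prod_(i <- enum_fset J) P (Z i @^-1` A i))%E.

Definition iid_copies (W : {RV P >-> T}) (Ws : nat -> {RV P >-> T}) : Prop :=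
  mutually_independent (fun i => Ws i : Omega -> T) /\
  (forall i (A : set T), measurable A ->
     distribution P (Ws i) A = distribution P W A).

(* [g x] is a version of [E[Z | X = x]]. *)
Definition cond_expectation (X : Omega -> T) (Z : Omega -> R) (g : T -> R)
    : Prop :=
  [/\ measurable_fun setT g,
      P.-integrable setT (EFin \o Z),
      P.-integrable setT (EFin \o (g \o X)) &
      forall A : set T, measurable A ->
        (\int[P]_(omega in X @^-1` A) (Z omega)%:E =
         \int[P]_(omega in X @^-1` A) (g (X omega))%:E)%E].

Definition sq_integrable (X : Omega -> T) (g : T -> R) : Prop :=
  measurable_fun setT g /\
  ('E_P[fun omega => (g (X omega) ^+ 2)%R] < +oo)%E.

Definition ae_bounded_by (X : Omega -> T) (g : T -> R) (C : R) : Prop :=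
  {ae P, forall omega, `|g (X omega)| <= C}.

(* Extended-real valued: a data-dependent [a] may fail to be square integrable
   for some values of the data. *)
Definition l2norm (W : Omega -> T) (a : T -> R) : \bar R :=
  sqrte 'E_P[fun omega => (a (W omega) ^+ 2)%R]%E.

End probability_notions.

Section stochastic_convergence.
Context {dO : measure_display} {Omega : measurableType dO} {R : realType}
  (P : probability Omega R).

Definition cvg_in_prob (Z : nat -> Omega -> \bar R) (c : R) : Prop :=
  forall eps : R, 0 < eps ->
    P [set omega | (eps%:E < `|Z n omega - c%:E|)%E] @[n --> \oo] --> 0%E.

Definition cvg_in_dist (Z : nat -> Omega -> R)
    (mu : probability (measurableTypeR R) R) : Prop :=
  let F (t : R) : \bar R := mu [set s : R | s <= t] in
  forall t : R, {for t, continuous F} ->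
    P [set omega | Z n omega <= t] @[n --> \oo] --> F t.

End stochastic_convergence.

(* The normal law with mean [mean] and variance [v].  For [v = 0] it is the
   point mass at [mean], whereas [normal_prob mean 0] is uniform on [0, 1]. *)
Definition gaussian {R : realType} (mean v : R) :
    probability (measurableTypeR R) R :=
  if v == 0
  then (dirac (mean : measurableTypeR R) : probability (measurableTypeR R) R)
  else (normal_prob mean (Num.sqrt v) : probability (measurableTypeR R) R).

Section functional.
Context {dO dw dx : measure_display} {Omega : measurableType dO}
  {Wt : measurableType dw} {Xt : measurableType dx} {R : realType}
  (P : probability Omega R) (W : Omega -> Wt)
  (xc : Wt -> Xt) (yc : Wt -> R) (m : Wt -> (Xt -> R) -> R).

Let sqint := sq_integrable P (xc \o W).

Definition linear_functional : Prop :=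
  (forall g, sqint g -> measurable_fun setT (fun w => m w g)) /\
  (forall w (a b : R) g h, sqint g -> sqint h ->
     m w (fun x => a * g x + b * h x) = a * m w g + b * m w h).

Definition mean_sq_continuous : Prop :=
  exists2 c : R, 0 < c & forall g, sqint g ->
    (`|'E_P[fun omega => m (W omega) g]| ^+ 2 <=
     c%:E * 'E_P[fun omega => (g (xc (W omega)) ^+ 2)%R])%E.

Definition riesz_representer (a0 : Xt -> R) : Prop :=
  sqint a0 /\
  forall g, sqint g ->
    'E_P[fun omega => m (W omega) g]%E =
    'E_P[fun omega => (a0 (xc (W omega)) * g (xc (W omega)))%R]%E.

Definition theta0 (g0 : Xt -> R) : R :=
  fine 'E_P[fun omega => m (W omega) g0]%E.

Definition debiased_score (g a : Xt -> R) (w : Wt) : R :=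
  m w g + a (xc w) * (yc w - g (xc w)).

Definition asymptotic_variance (g0 a0 : Xt -> R) : R :=
  fine 'E_P[fun omega => ((m (W omega) g0 - theta0 g0 +
    a0 (xc (W omega)) * (yc (W omega) - g0 (xc (W omega)))) ^+ 2)%R]%E.

End functional.

Section cross_fitting.
Context {dw dx : measure_display}
  {Wt : measurableType dw} {Xt : measurableType dx} {R : realType}.

(* "About equal size" is read asymptotically: every fold has a limiting share
   [1 / L] of the sample. *)
Definition fold_partition {L : nat} (I : forall n, 'I_L -> {set 'I_n})
    : Prop :=
  (forall n (i : 'I_n), exists! l, i \in I n l) /\
  (forall l, (#|I n l|%:R / n%:R : R) @[n --> \oo] --> (L%:R^-1 : R)).

(* A learner maps the sample to a function of [x]; that it is computed without
   the observations in [I] means that changing those does not affect it. *)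
Definition learner_off {n : nat} (I : {set 'I_n})
    (g : n.-tuple Wt -> Xt -> R) : Prop :=
  measurable_fun setT (fun p : n.-tuple Wt * Xt => g p.1 p.2) /\
  forall s t : n.-tuple Wt,
    (forall i, i \notin I -> tnth s i = tnth t i) -> g s = g t.

Context (xc : Wt -> Xt) (yc : Wt -> R) (m : Wt -> (Xt -> R) -> R).

Definition theta_hat {L n : nat} (I : 'I_L -> {set 'I_n})
    (gh ah : 'I_L -> n.-tuple Wt -> Xt -> R) (s : n.-tuple Wt) : R :=
  n%:R^-1 * \sum_(l < L) \sum_(i in I l)
    debiased_score xc yc m (gh l s) (ah l s) (tnth s i).

Definition V_hat {L n : nat} (I : 'I_L -> {set 'I_n})
    (gh ah : 'I_L -> n.-tuple Wt -> Xt -> R) (s : n.-tuple Wt) : R :=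
  n%:R^-1 * \sum_(l < L) \sum_(i in I l)
    (debiased_score xc yc m (gh l s) (ah l s) (tnth s i) -
     theta_hat I gh ah s) ^+ 2.

End cross_fitting.

Definition sample {Omega Wt : Type} (Ws : nat -> Omega -> Wt) (n : nat)
  (omega : Omega) : n.-tuple Wt := [tuple Ws i omega | i < n].

(* Main.v *)
Require Import Defs.
From HB Require Import structures.
From mathcomp Require Import all_boot all_order all_algebra finmap.
From mathcomp Require Import all_classical all_reals all_analysis.
From mathcomp Require Import measurable_realfun.
From mathcomp Require Import ring lra.

Set Implicit Arguments.
Unset Strict Implicit.
Unset Printing Implicit Defensive.

Import Order.TTheory GRing.Theory Num.Theory.
Import numFieldNormedType.Exports.

Local Open Scope classical_set_scope.
Local Open Scope ring_scope.

(* Write the score at the estimated nuisance functions as the influence function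
   psi plus an error delta_l.  For a bounded alpha-hat,
     E[delta_l^2] <= const (|gamma-hat - gamma0|^2 + |alpha-hat - alpha0|^2),
   and, by the Riesz and conditional mean identities,
     E[delta_l] = - E[(gamma-hat - gamma0) (alpha-hat - alpha0)].
   The learners do not depend on the observations of their fold.  So, given the
   rest of the sample, the delta_l are i.i.d. there: their centred sum divided by
   sqrt n is small in second moment, and the rate condition makes
   sqrt n E[delta_l] small.  Hence sqrt n (thetahat - theta0) is the normalized
   sum of psi up to a vanishing remainder, and the mean of delta_l^2 vanishes,
   which reduces Vhat to the sample variance of psi.

   The central limit theorem for psi is proved by Lindeberg's replacement with
   the test functions x |-> Phi((a - x) / sqrt v).  These solve the heat
   equation, so that adding an independent N(0, s) amounts to replacing v by
   v + s and no Gaussian sample has to be constructed. *)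

(** * Resampling one observation *)

(** No conditional expectation given the other observations is formed. Independence enters through
    one identity: the sample has the same law as the sample whose coordinate [j] is replaced by a
    fresh draw, living on the second factor of [P \x P]. For a function determined off the fold,
    integrating over that draw is conditioning. The identity rests on Tonelli, so it is applied to
    nonnegative integrands only: squares, nonnegative summands, or [Phi]-type test functions. The
    obstacle is that the learners behave well only with high probability: for some samples the norms
    are infinite or [alphahat] is unbounded. The moment bounds are therefore proved for the error
    times the indicator of an event of good samples. That event is itself determined by the
    observations outside the fold, so the product can still be resampled inside it. The test
    functions are smoothed indicators of half-lines, so they give distribution functions directly.
    The room left by the smoothing also absorbs the remainder of the score, and the limit theorem
    and its perturbation become one argument. *)

Definition resample {T : Type} {n : nat} (s : n.-tuple T) (j : 'I_n) (w : T) :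
  n.-tuple T := [tuple if i == j then w else tnth s i | i < n].

Definition rectangle {T : Type} {n : nat} (A : 'I_n -> set T) :
  set (n.-tuple T) := [set s | forall i, A i (tnth s i)].

Lemma tnth_resample {T : Type} {n : nat} (s : n.-tuple T) (j i : 'I_n) (w : T) :
  tnth (resample s j w) i = if i == j then w else tnth s i.
Proof. by rewrite tnth_mktuple. Qed.

Lemma tnth_sample {Omega T : Type} (Ws : nat -> Omega -> T) (n : nat) omega
  (i : 'I_n) : tnth (sample Ws n omega) i = Ws i omega.
Proof. by rewrite tnth_mktuple. Qed.

Section rectangles.
Context {d : measure_display} {T : measurableType d} {n : nat}.

Lemma measurable_rectangle (A : 'I_n -> set T) :
  (forall i, measurable (A i)) -> measurable (rectangle A).
Proof.
move=> mA; rewrite /rectangle.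
have -> : [set s | forall i, A i (tnth s i)] =
    \bigcap_(i in [set: 'I_n]) ((@tnth n T) ^~ i @^-1` A i).
  by apply/seteqP; split=> s /= h i; [move=> _; exact: h|exact: h].
apply: fin_bigcap_measurable => // i _.
by rewrite -[X in measurable X]setTI; exact: measurable_tnth.
Qed.

Lemma measurable_tuple_rectangles :
  (@measurable _ (n.-tuple T)) =
  <<s [set B | exists2 A, forall i, measurable (A i) & B = @rectangle T n A] >>.
Proof.
apply/seteqP; split; last first.
  apply: smallest_sub; first exact: sigma_algebra_measurable.
  by move=> _ [A mA ->]; exact: measurable_rectangle.
apply: smallest_sub; first exact: smallest_sigma_algebra.
move=> B; rewrite -bigcup_seq => -[i _ [C mC <-]].
apply: sub_sigma_algebra; rewrite setTI.
exists (fun k => if k == i then C else setT); first by move=> k; case: ifP.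
apply/seteqP; split=> s /=.
  by move=> Cs k; case: eqP => // ->.
by move=> /(_ i); rewrite eqxx.
Qed.

Lemma tuple_measure_unique {R : realType} (m1 m2 : probability (n.-tuple T) R) :
  (forall A, (forall i, measurable (A i)) ->
    m1 (rectangle A) = m2 (rectangle A)) ->
  forall B, measurable B -> m1 B = m2 B.
Proof.
move=> m12 B mB.
apply: (measure_unique _ (fun _ => setT) measurable_tuple_rectangles) => //.
- move=> _ _ [A mA ->] [A' mA' ->]; exists (fun i => A i `&` A' i).
    by move=> i; exact: measurableI.
  by apply/seteqP; split=> [s [h h'] i|s h]; split => // i; case: (h i).
- move=> _; exists (fun _ => setT) => //.
  by apply/seteqP; split.
- by rewrite bigcup_const //; exists 0%N.
- by move=> _ [A mA ->]; exact: m12.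
- by move=> k; apply: (le_lt_trans (probability_le1 _ _)); rewrite ?ltry.
Qed.

Lemma measurable_resample (j : 'I_n) :
  measurable_fun setT (fun p : n.-tuple T * T => resample p.1 j p.2).
Proof.
apply/measurable_fun_tnthP => i; rewrite /comp.
under eq_fun do rewrite tnth_resample.
case: (i == j); first exact: measurable_snd.
by apply: (measurableT_comp (measurable_tnth i)); exact: measurable_fst.
Qed.

End rectangles.

Section iid_sample.
Context {dO d : measure_display} {Omega : measurableType dO}
  {T : measurableType d} {R : realType} (P : probability Omega R)
  (W : {RV P >-> T}) (Ws : nat -> {RV P >-> T}).
Hypothesis iid : iid_copies W Ws.

Let data n := sample (fun i => Ws i : Omega -> T) n.

Lemma measurable_sample n : measurable_fun setT (data n).
Proof.
apply/measurable_fun_tnthP => i.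
rewrite (_ : _ \o _ = Ws i); first exact: measurable_funPT.
by apply/funext => omega /=; rewrite tnth_sample.
Qed.

HB.instance Definition _ n := isMeasurableFun.Build _ _ _ _ (data n)
  (@measurable_sample n).

Lemma sample_rectangle n (A : 'I_n -> set T) :
  (forall i, measurable (A i)) ->
  P (data n @^-1` rectangle A) = (\prod_(i < n) P (W @^-1` A i))%E.
Proof.
move=> mA; have [ind same] := iid.
(* Independence is stated for families indexed by all natural numbers; indices outside the sample
   are padded with the full space. *)
pose A' k := if insub k is Some i then A i else setT.
have mA' k : measurable (A' k) by rewrite /A'; case: insubP.
have A'E (i : 'I_n) : A' i = A i by rewrite /A' valK.
pose J := [fset k in iota 0 n]%fset.
have -> : data n @^-1` rectangle A = \bigcap_(i in [set` J]) Ws i @^-1` A' i.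
  apply/seteqP; split=> omega /=.
    move=> h k /=; rewrite !inE mem_iota /= add0n => kn.
    by have := h (Ordinal kn); rewrite tnth_sample -A'E.
  move=> h i; rewrite tnth_sample -A'E; apply: h.
  by rewrite /= !inE mem_iota /= add0n.
rewrite ind // (perm_big (iota 0 n)); last first.
  by apply: uniq_perm; rewrite ?fset_uniq ?iota_uniq // => x; rewrite !inE.
rewrite -[iota 0 n](_ : index_iota 0 n = _); last by rewrite /index_iota subn0.
rewrite big_mkord; apply: eq_bigr => i _.
by rewrite A'E; exact: same.
Qed.

Let fresh n (j : 'I_n) (p : Omega * Omega) := resample (data n p.1) j (W p.2).

Let measurable_fresh n (j : 'I_n) : measurable_fun setT (fresh j).
Proof.
apply: (measurableT_comp (f := fun p : n.-tuple T * T => resample p.1 j p.2)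
  (g := fun p : Omega * Omega => (data n p.1, W p.2))).
  exact: measurable_resample.
apply: measurable_fun_pair.
  by apply: measurableT_comp => //; exact: measurable_sample.
by apply: measurableT_comp => //; exact: measurable_funPT.
Qed.

HB.instance Definition _ n (j : 'I_n) := isMeasurableFun.Build _ _ _ _ (fresh j)
  (@measurable_fresh n j).

(** Both laws give a rectangle the product of its marginal probabilities, and rectangles form a
    generating class stable under intersection. The new observation sits on the second factor of
    [P \x P], where it is independent of the whole sample by construction. *)
Lemma sample_resample_law n (j : 'I_n) (B : set (n.-tuple T)) : measurable B ->
  P (data n @^-1` B) =
  (P \x P)%E [set p | B (resample (data n p.1) j (W p.2))].
Proof.
move: B; apply: (tuple_measure_unique
  (m1 := distribution P (data n))
  (m2 := distribution (P \x P)%E (fresh j))) => A mA.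
change (P (data n @^-1` rectangle A) =
  (P \x P)%E (fresh j @^-1` rectangle A)).
rewrite sample_rectangle // (bigD1 j) //=.
have -> : fresh j @^-1` rectangle A =
    (data n @^-1` rectangle (fun i => if i == j then setT else A i)) `*`
    (W @^-1` A j).
  apply/seteqP; split=> -[w w'] /=; rewrite /fresh /=.
    move=> h; split=> [i|].
      by have := h i; rewrite tnth_resample; case: eqP.
    by have := h j; rewrite tnth_resample eqxx.
  move=> [h hj] i; rewrite tnth_resample; case: eqP => [->//|ij].
  by have := h i; case: eqP.
rewrite product_measure1E; last 2 first.
- rewrite -[X in measurable X]setTI; apply: measurable_sample => //.
  by apply: measurable_rectangle => i; case: ifP.
- exact: measurable_funPTI.
rewrite muleC; congr (_ * _)%E; apply/esym.
apply: eq_trans (sample_rectangle _) _; first by move=> i; case: ifP.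
rewrite (bigD1 j) //= eqxx preimage_setT probability_setT mul1e.
by apply: eq_bigr => i /negbTE ->.
Qed.

(** The form in which independence is used from here on. The inner integral is the conditional
    expectation of [H] given the observations other than [j]. *)
Lemma ge0_integral_resample n (j : 'I_n) (H : n.-tuple T -> \bar R) :
  measurable_fun [set: n.-tuple T] H -> (forall s, 0 <= H s)%E ->
  (\int[P]_w H (data n w) =
   \int[P]_w \int[P]_w' H (resample (data n w) j (W w')))%E.
Proof.
move=> mH H0.
transitivity (\int[distribution P (data n)]_s H s)%E.
  by rewrite ge0_integral_distribution.
transitivity (\int[distribution (P \x P)%E (fresh j)]_s H s)%E.
  by apply: eq_measure_integral => B mB _; exact: sample_resample_law.
rewrite ge0_integral_distribution // fubini_tonelli1 //; last first.
  by move=> x; exact: H0.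
exact: measurableT_comp.
Qed.

End iid_sample.

(** * Integrable and square-integrable functions on a probability space *)

Section L2.
Context {d : measure_display} {T : measurableType d} {R : realType}
  (P : probability T R).
Implicit Types f g : T -> R.

Definition L1 f := P.-integrable setT (EFin \o f).

Definition L2 f :=
  measurable_fun setT f /\ (\int[P]_x (f x ^+ 2)%:E < +oo)%E.

Lemma L1_measurable f : L1 f -> measurable_fun setT f.
Proof. by move=> /measurable_int /measurable_EFinP. Qed.

Lemma L1_le f g : measurable_fun setT f -> (forall x, `|f x| <= `|g x|) ->
  L1 g -> L1 f.
Proof.
move=> mf fg; apply: le_integrable => //; first exact/measurable_EFinP.
by move=> x _; rewrite /= lee_fin.
Qed.

Lemma ge0_L1 f : measurable_fun setT f -> (forall x, 0 <= f x) ->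
  (\int[P]_x (f x)%:E < +oo)%E -> L1 f.
Proof.
move=> mf f0 foo; apply/integrableP; split; first exact/measurable_EFinP.
by under eq_integral do rewrite /= ger0_norm//.
Qed.

Lemma L1D f g : L1 f -> L1 g -> L1 (fun x => f x + g x).
Proof. by move=> h h'; apply: eq_integrable (integrableD _ h h'). Qed.

Lemma L1Z f a : L1 f -> L1 (fun x => a * f x).
Proof. by move=> h; apply: eq_integrable (integrableZl _ a h). Qed.

Lemma L1B f g : L1 f -> L1 g -> L1 (fun x => f x - g x).
Proof.
move=> h h'; have := L1D h (L1Z (-1) h').
by congr L1; apply/funext => x; rewrite mulN1r.
Qed.

Lemma L1_cst a : L1 (fun=> a).
Proof. exact: finite_measure_integrable_cst. Qed.

Lemma L1_bounded f a : measurable_fun setT f -> (forall x, `|f x| <= a) -> L1 f.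
Proof.
move=> mf fa; apply: L1_le (L1_cst a) => // x.
exact: le_trans (fa x) (ler_norm _).
Qed.

Lemma L1_abs f : L1 f -> L1 (fun x => `|f x|).
Proof.
move=> h; apply: (L1_le _ _ h) => [|x]; last by rewrite normr_id.
by apply: measurableT_comp => //; exact: (L1_measurable h).
Qed.

Lemma L1_EFin f : L1 f -> (\int[P]_x (f x)%:E)%E = (\int[P]_x f x)%:E.
Proof. by move=> h; rewrite fineK //; exact: integrable_fin_num. Qed.

Lemma Rintegral_le_cst f a : L1 f -> (forall x, f x <= a) -> \int[P]_x f x <= a.
Proof.
move=> h fa; have := le_Rintegral measurableT h (L1_cst a) (fun x _ => fa x).
by rewrite Rintegral_cst //= probability_setT mulr1.
Qed.

Lemma Rintegral_prob_cst a : \int[P]_x a = a.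
Proof. by rewrite Rintegral_cst //= probability_setT mulr1. Qed.

Lemma L2_L1_sqr f : L2 f -> L1 (fun x => f x ^+ 2).
Proof.
move=> [mf fi]; apply: ge0_L1 => // [|x]; last exact: sqr_ge0.
exact: measurable_funX.
Qed.

Lemma L2_L1M f g : L2 f -> L2 g -> L1 (fun x => f x * g x).
Proof.
move=> hf hg; have [mf _] := hf; have [mg _] := hg.
apply: L1_le (L1D (L2_L1_sqr hf) (L2_L1_sqr hg)).
  exact: measurable_funM.
move=> x; rewrite [leRHS]ger0_norm ?addr_ge0 ?sqr_ge0 //.
rewrite ler_norml; apply/andP; split; nra.
Qed.

Lemma L2_cst a : L2 (fun=> a).
Proof.
by split => //; rewrite integral_cst //= probability_setT mule1 ltry.
Qed.

Lemma L2_L1 f : L2 f -> L1 f.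
Proof.
move=> hf; have := L2_L1M hf (L2_cst 1).
by congr L1; apply/funext => x; rewrite mulr1.
Qed.

Lemma L1_sqr_L2 f : measurable_fun setT f -> L1 (fun x => f x ^+ 2) -> L2 f.
Proof. by move=> mf h; split => //; exact: (integrable_lty _ h). Qed.

Lemma L2_le f g : measurable_fun setT f -> (forall x, `|f x| <= `|g x|) ->
  L2 g -> L2 f.
Proof.
move=> mf fg [mg gi]; split => //; apply: le_lt_trans gi.
apply: ge0_le_integral => //.
- by move=> x _; rewrite lee_fin sqr_ge0.
- by apply/measurable_EFinP; exact: measurable_funX.
- by apply/measurable_EFinP; exact: measurable_funX.
- by move=> x _; rewrite lee_fin -[leLHS]real_normK ?num_real //
    -[leRHS]real_normK ?num_real // lerXn2r ?nnegrE.
Qed.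

Lemma L2D f g : L2 f -> L2 g -> L2 (fun x => f x + g x).
Proof.
move=> hf hg; have [mf _] := hf; have [mg _] := hg.
apply: L1_sqr_L2; first exact: measurable_funD.
have := L1D (L2_L1_sqr hf) (L1D (L1Z 2 (L2_L1M hf hg)) (L2_L1_sqr hg)).
by congr L1; apply/funext => x; ring.
Qed.

Lemma L2Z f a : L2 f -> L2 (fun x => a * f x).
Proof.
move=> hf; have [mf _] := hf.
apply: L1_sqr_L2; first exact: measurable_funM.
have := L1Z (a ^+ 2) (L2_L1_sqr hf).
by congr L1; apply/funext => x; ring.
Qed.

Lemma L2B f g : L2 f -> L2 g -> L2 (fun x => f x - g x).
Proof.
move=> hf hg; have := L2D hf (L2Z (-1) hg).
by congr L2; apply/funext => x; rewrite mulN1r.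
Qed.

Lemma Rintegral_sqrD f a : L2 f ->
  \int[P]_x (f x + a) ^+ 2 =
  \int[P]_x (f x ^+ 2) + 2 * a * \int[P]_x f x + a ^+ 2.
Proof.
move=> hf.
transitivity (\int[P]_x (f x ^+ 2 + (2 * a * f x + a ^+ 2))).
  by apply: eq_Rintegral => x _; ring.
rewrite RintegralD //; last 2 first.
- exact: L2_L1_sqr.
- by apply: L1D (L1_cst _); apply: L1Z; exact: L2_L1.
rewrite RintegralD //; last 2 first.
- by apply: L1Z; exact: L2_L1.
- exact: L1_cst.
by rewrite RintegralZl ?Rintegral_prob_cst ?addrA //; exact: L2_L1.
Qed.

Lemma Cauchy_Schwarz f g : L2 f -> L2 g ->
  (\int[P]_x (f x * g x)) ^+ 2 <=
  (\int[P]_x (f x ^+ 2)) * (\int[P]_x (g x ^+ 2)).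
Proof.
move=> hf hg.
set a := \int[P]_x (f x * g x); set b := \int[P]_x (f x ^+ 2).
set c := \int[P]_x (g x ^+ 2).
have b0 : 0 <= b by apply: Rintegral_ge0 => x _; exact: sqr_ge0.
have key (s t : R) : 0 <= s ^+ 2 * b + 2 * s * t * a + t ^+ 2 * c.
  have : 0 <= \int[P]_x ((s * f x + t * g x) ^+ 2).
    by apply: Rintegral_ge0 => x _; exact: sqr_ge0.
  have -> : \int[P]_x ((s * f x + t * g x) ^+ 2) =
      \int[P]_x (s ^+ 2 * f x ^+ 2 +
        ((2 * s * t) * (f x * g x) + t ^+ 2 * g x ^+ 2)).
    by apply: eq_Rintegral => x _; ring.
  rewrite RintegralD //; last 2 first.
  - by apply: L1Z; exact: L2_L1_sqr.
  - by apply: L1D; apply: L1Z; [exact: L2_L1M|exact: L2_L1_sqr].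
  rewrite RintegralD //; last 2 first.
  - by apply: L1Z; exact: L2_L1M.
  - by apply: L1Z; exact: L2_L1_sqr.
  rewrite !RintegralZl //; last 3 first.
  - exact: L2_L1_sqr.
  - exact: L2_L1M.
  - exact: L2_L1_sqr.
  by rewrite -/a -/b -/c addrA.
(* If [b = 0] and [a] is nonzero, the form at [t = 1] is affine in [s], and the [s] chosen below
   makes it equal to [-1]. Otherwise [s = - a] and [t = b] give [b (b c - a ^ 2)]. *)
have [b_eq0|b_neq0] := eqVneq b 0.
  have [->|a0] := eqVneq a 0; first by rewrite expr0n /= b_eq0 mul0r.
  have := key (- (c + 1) / (2 * a)) 1; rewrite b_eq0.
  have -> : 2 * (- (c + 1) / (2 * a)) * 1 * a = - (c + 1) by field.
  by rewrite mulr0 add0r expr1n mul1r opprD -addrA addrCA addNr addr0 ler0N1.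
have := key (- a) b.
have -> : (- a) ^+ 2 * b + 2 * - a * b * a + b ^+ 2 * c = b * (b * c - a ^+ 2).
  by ring.
by rewrite pmulr_rge0 ?subr_ge0 // lt_def b_neq0.
Qed.

Lemma markov_ge0 f (a : R) : measurable_fun setT f -> (forall x, 0 <= f x) ->
  0 < a -> (P [set x | (a <= f x)%R] <= a^-1%:E * \int[P]_x (f x)%:E)%E.
Proof.
move=> mf f0 a0.
rewrite lee_pdivlMl //.
have mEf : measurable_fun setT (EFin \o f) by exact/measurable_EFinP.
have := le_integral_abse P measurableT mEf a0.
rewrite setTI; under eq_integral do rewrite /= ger0_norm //.
suff -> : [set x | (a%:E <= `|(EFin \o f) x|)%E] = [set x | a <= f x] by [].
by apply/seteqP; split=> x; rewrite /= lee_fin ger0_norm.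
Qed.

End L2.

(** * Moments of sums over a fold *)

Section conditional_variance.
Context {dO d : measure_display} {Omega : measurableType dO}
  {T : measurableType d} {R : realType} (P : probability Omega R)
  (W : {RV P >-> T}) (Ws : nat -> {RV P >-> T}).
Hypothesis iid : iid_copies W Ws.
Let data n := sample (fun i => Ws i : Omega -> T) n.

(** The codomain is arbitrary because this is applied to functions, to real numbers and to events on
    samples. *)
Definition off_fold {n : nat} {A : Type} (J : {set 'I_n})
    (r : n.-tuple T -> A) : Prop :=
  forall s t : n.-tuple T, (forall i, i \notin J -> tnth s i = tnth t i) ->
    r s = r t.

Lemma off_fold_resample {n : nat} {A : Type} (J : {set 'I_n})
    (r : n.-tuple T -> A) j (s : n.-tuple T) w :
  off_fold J r -> j \in J -> r (resample s j w) = r s.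
Proof.
move=> hr jJ; apply: hr => i iJ; rewrite tnth_resample.
by case: eqP iJ => // ->; rewrite jJ.
Qed.

Lemma measurable_plug {n : nat} (r : n.-tuple T -> T -> R) (i : 'I_n) :
  measurable_fun setT (fun p : n.-tuple T * T => r p.1 p.2) ->
  measurable_fun [set: n.-tuple T] (fun s => r s (tnth s i)).
Proof.
move=> mr; apply: (measurableT_comp (g := fun s => (s, tnth s i)) mr).
by apply: measurable_fun_pair => //; exact: measurable_tnth.
Qed.

Lemma measurable_section {n : nat} (r : n.-tuple T -> T -> R) s :
  measurable_fun setT (fun p : n.-tuple T * T => r p.1 p.2) ->
  measurable_fun setT (fun w => r s (W w)).
Proof.
move=> mr; apply: (measurableT_comp (g := fun w => (s, W w)) mr).
by apply: measurable_fun_pair => //; exact: measurable_funPT.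
Qed.

(* Conditionally on the observations outside the fold, the summands are
   independent and centred, so resampling one observation at a time kills the
   cross terms. *)
Lemma fold_sum_second_moment {n : nat} (J : {set 'I_n})
    (r : n.-tuple T -> T -> R) (c : R) :
  measurable_fun setT (fun p : n.-tuple T * T => r p.1 p.2) ->
  off_fold J r ->
  (forall s, \int[P]_w r s (W w) = 0) ->
  (forall s, (\int[P]_w (r s (W w) ^+ 2)%:E <= c%:E)%E) ->
  (\int[P]_w ((\sum_(i in J) r (data n w) (tnth (data n w) i)) ^+ 2)%:E <=
   (#|J|%:R * c)%:E)%E.
Proof.
move=> mr hr r0 r2.
pose S q (s : n.-tuple T) := \sum_(i <- q) r s (tnth s i).
have mS q : measurable_fun [set: n.-tuple T] (S q).
  by apply: measurable_sum => i; exact: measurable_plug.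
rewrite cardE.
under eq_integral do rewrite -big_enum /= -/(S _ _).
have : uniq (enum J) by exact: enum_uniq.
have : {subset enum J <= J} by move=> i; rewrite mem_enum.
(* The induction is on the list of indices summed, with [r] fixed: membership in [J] keeps [r]
   unchanged when [j] is resampled, and uniqueness keeps the terms of [q] unchanged. *)
elim: (enum J) => [_ _|j q IH sub /= /andP[jq uq]].
  rewrite mul0r (_ : (fun w => _) = fun=> 0%E) ?integral0 //.
  by apply/funext => w; rewrite /S big_nil expr0n.
have jJ : j \in J by apply: sub; rewrite inE eqxx.
have subq : {subset q <= J} by move=> i iq; apply: sub; rewrite inE iq orbT.
have {}IH := IH subq uq.
rewrite (ge0_integral_resample iid j (H := fun s => ((S (j :: q) s) ^+ 2)%:E))//;
  last 2 first.
- by apply/measurable_EFinP; exact: measurable_funX.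
- by move=> s; rewrite lee_fin sqr_ge0.
apply: (@le_trans _ _ (\int[P]_w (c%:E + (S q (data n w) ^+ 2)%:E))%E).
  apply: ge0_le_integral => //.
  - by move=> w _; apply: integral_ge0 => w' _; rewrite lee_fin sqr_ge0.
  - apply: (measurable_fun_fubini_tonelli_F (m2 := P) (fun p : Omega * Omega =>
      (S (j :: q) (resample (data n p.1) j (W p.2)) ^+ 2)%:E)); last first.
      by move=> p; rewrite lee_fin sqr_ge0.
    apply/measurable_EFinP; apply: measurable_funX.
    apply: (measurableT_comp (f := S (j :: q))) => //.
    apply: (measurableT_comp (f := fun p : n.-tuple T * T =>
      resample p.1 j p.2) (g := fun p : Omega * Omega => (data n p.1, W p.2))).
      exact: measurable_resample.
    apply: measurable_fun_pair.
      by apply: measurableT_comp => //; exact: measurable_sample.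
    by apply: measurableT_comp => //; exact: measurable_funPT.
  - apply: emeasurable_funD => //; apply/measurable_EFinP; apply: measurable_funX.
    by apply: measurableT_comp => //; exact: measurable_sample.
  move=> w _; set s := data n w.
  have hL2 : L2 P (fun w' => r s (W w')).
    split; first exact: measurable_section.
    exact: le_lt_trans (r2 s) (ltry _).
  under eq_integral => w' _.
    rewrite /S big_cons (off_fold_resample _ _ hr jJ) tnth_resample eqxx.
    rewrite (_ : \sum_(i <- q) _ = S q s); last first.
      rewrite /S big_seq [RHS]big_seq; apply: eq_bigr => i iq.
      rewrite tnth_resample; case: eqP => // ij.
      by rewrite -ij iq in jq.
    over.
  rewrite L1_EFin; last by apply: L2_L1_sqr; apply: L2D => //; exact: L2_cst.
  rewrite -EFinD lee_fin Rintegral_sqrD // r0 mulr0 addr0 lerD2r.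
  by rewrite -lee_fin -L1_EFin //; exact: L2_L1_sqr.
rewrite ge0_integralD //; last 3 first.
- move=> w _; apply: le_trans (r2 (data n w)).
  by apply: integral_ge0 => w' _; rewrite lee_fin sqr_ge0.
- by move=> w _; rewrite lee_fin sqr_ge0.
- apply/measurable_EFinP; apply: measurable_funX.
  by apply: measurableT_comp => //; exact: measurable_sample.
rewrite integral_cst //= probability_setT mule1.
have -> : ((size q).+1%:R * c)%:E = (c%:E + ((size q)%:R * c)%:E)%E.
  by rewrite -EFinD -natr1 mulrDl mul1r addrC.
exact: leeD2l.
Qed.

(** Nonnegativity takes the place of centring: each term is resampled separately and no cross terms
    arise. This serves averages of squares, whose own squares need not be integrable. *)
Lemma fold_sum_first_moment {n : nat} (J : {set 'I_n})
    (r : n.-tuple T -> T -> R) (c : R) :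
  measurable_fun setT (fun p : n.-tuple T * T => r p.1 p.2) ->
  off_fold J r ->
  (forall s w, 0 <= r s w) ->
  (forall s, (\int[P]_w (r s (W w))%:E <= c%:E)%E) ->
  (\int[P]_w (\sum_(i in J) r (data n w) (tnth (data n w) i))%:E <=
   (#|J|%:R * c)%:E)%E.
Proof.
move=> mr hr r0 rc.
under eq_integral do rewrite -sumEFin -big_enum /=.
rewrite ge0_integral_sum //; last 2 first.
- move=> i; apply/measurable_EFinP.
  apply: (measurableT_comp (measurable_plug i mr)); exact: measurable_sample.
- by move=> i w _; rewrite lee_fin.
apply: (@le_trans _ _ (\sum_(i <- enum J) c%:E)%E); last first.
  by rewrite sumEFin big_enum /= sumr_const mulr_natl.
rewrite !big_enum /=; apply: lee_sum => i iJ.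
rewrite (ge0_integral_resample iid i (H := fun s => (r s (tnth s i))%:E))//;
  last 2 first.
- by apply/measurable_EFinP; exact: measurable_plug.
- by move=> s; rewrite lee_fin.
apply: (@le_trans _ _ (\int[P]_w c%:E)%E); last first.
  by rewrite integral_cst //= probability_setT mule1.
apply: ge0_le_integral => //.
- by move=> w _; apply: integral_ge0 => w' _; rewrite lee_fin.
- apply: (measurable_fun_fubini_tonelli_F (m2 := P) (fun p : Omega * Omega =>
    (r (resample (data n p.1) i (W p.2))
      (tnth (resample (data n p.1) i (W p.2)) i))%:E)); last first.
    by move=> p; rewrite lee_fin.
  apply/measurable_EFinP.
  apply: (measurableT_comp (measurable_plug i mr)).
  apply: (measurableT_comp (f := fun p : n.-tuple T * T =>
    resample p.1 i p.2) (g := fun p : Omega * Omega => (data n p.1, W p.2))).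
    exact: measurable_resample.
  apply: measurable_fun_pair.
    by apply: measurableT_comp => //; exact: measurable_sample.
  by apply: measurableT_comp => //; exact: measurable_funPT.
- move=> w _.
  under eq_integral do rewrite (off_fold_resample _ _ hr iJ) tnth_resample eqxx.
  exact: rc.
Qed.

End conditional_variance.

(** * The normal distribution function and the heat flow *)

Section second_order_expansions.
Context {R : realType}.
Implicit Types f g : R -> R.

Lemma is_derive1_continuous f df (x : R) : is_derive x 1 f df ->
  {for x, continuous f}.
Proof.
by move=> [h _]; apply/differentiable_continuous; rewrite -derivable1_diffP.
Qed.

Lemma mean_value f df (a b : R) :
  (forall x, Num.min a b <= x <= Num.max a b -> is_derive x 1 f (df x)) ->
  exists2 c, Num.min a b <= c <= Num.max a b & f b - f a = df c * (b - a).
Proof.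
move=> h.
have main (u v : R) : u <= v -> (forall x : R, u <= x <= v -> is_derive x 1 f (df x)) ->
    exists2 c, u <= c <= v & f v - f u = df c * (v - u).
  move=> uv huv.
  have [||c] := @MVT_segment R f df u v uv.
  - by move=> x; rewrite in_itv /= => /andP[ux xv]; apply: huv; rewrite !ltW.
  - apply: continuous_in_subspaceT => x; rewrite inE /= in_itv /= => xuv.
    exact: is_derive1_continuous (huv x xuv).
  - by rewrite in_itv /= => cuv e; exists c.
have [ab|/ltW ba] := leP a b.
  by rewrite (min_idPl ab) (max_idPr ab) in h *; exact: main.
rewrite (min_idPr ba) (max_idPl ba) in h *.
have [c hc e] := main b a ba h; exists c => //.
by rewrite -opprB e -mulrN opprB.
Qed.

(** Two applications of the mean value theorem, hence [C] and not [C / 2]. The endpoints are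
    unordered because increments of both signs occur. *)
Lemma taylor1 f df ddf (C a b : R) :
  (forall x, Num.min a b <= x <= Num.max a b -> is_derive x 1 f (df x)) ->
  (forall x, Num.min a b <= x <= Num.max a b -> is_derive x 1 df (ddf x)) ->
  (forall x, Num.min a b <= x <= Num.max a b -> `|ddf x| <= C) ->
  `|f b - f a - df a * (b - a)| <= C * (b - a) ^+ 2.
Proof.
move=> h1 h2 hC.
have [c hc ->] := mean_value h1.
have hcs x : Num.min a c <= x <= Num.max a c ->
    Num.min a b <= x <= Num.max a b.
  move=> /andP[lx xu]; apply/andP; split.
    apply: le_trans lx; rewrite le_min ge_min lexx /=; by case/andP: hc.
  apply: (le_trans xu); rewrite ge_max le_max lexx /=; by case/andP: hc.
have [e he dE] := @mean_value df ddf a c (fun x hx => h2 x (hcs x hx)).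
rewrite -mulrBl dE normrM normrM.
rewrite -[(b - a) ^+ 2]real_normK ?num_real // expr2 mulrA ler_wpM2r //.
apply: ler_pM => //; first exact/hC/hcs.
case/andP: hc; have [ab|/ltW ba] := leP a b => lc cu.
  by rewrite !ger0_norm ?subr_ge0 // lerD2r.
by rewrite !ler0_norm ?subr_le0 // lerN2 lerD2r.
Qed.

End second_order_expansions.

Section standard_normal_cdf.
Context {R : realType}.
Notation mu := (@lebesgue_measure R).
Notation phi := (@normal_pdf R 0 1).
Implicit Types x z : R.

Lemma phiE z : phi z = normal_peak 1 * expR (- (z ^+ 2 / 2)).
Proof.
by rewrite normal_pdfE ?oner_neq0 // /normal_fun subr0 expr1n mulNr.
Qed.

Lemma is_derive_phi z : is_derive z 1 phi (- (z * phi z)).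
Proof.
have -> : phi = (fun z => normal_peak 1 * expR (- (z ^+ 2 / 2))).
  by apply/funext => y; rewrite phiE.
pose g := fun z : R => - (z ^+ 2 / 2).
have dg : is_derive z 1 g (- z).
  have -> : g = (-1 / 2) \*: (@id R ^+ 2).
    apply/funext => y; rewrite /g -[(_ \*: _) y]/(-1 / 2 * (y * y)) expr2; lra.
  apply: is_derive_eq; rewrite /GRing.scale /= expr1 mulr1; lra.
have := is_deriveZ (normal_peak 1) (is_derive1_comp (is_derive_expR (g z)) dg).
move=> h; apply: is_derive_eq h _.
by rewrite /GRing.scale /= /g; ring.
Qed.

Definition Phi x := \int[mu]_(t in `]-oo, x]) phi t.

Lemma is_derive_Phi x : is_derive x 1 Phi (phi x).
Proof.
have [] := @continuous_FTC1 R phi (BInfty _ true) x (x + 1).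
- by rewrite ltrDl.
- by apply: (integrableS measurableT) => //; exact: integrable_normal_pdf.
- by rewrite ltNyr.
- by apply: continuous_normal_pdf; rewrite oner_neq0.
by move=> h1 h2; split; [exact: h1|rewrite -derive1E; exact: h2].
Qed.

(* [exp (z^2 / 2) >= (1 + z^2 / 4)^2] dominates every cubic. *)
Lemma phi_decay : exists2 K : R, 0 < K &
  forall z, `|phi z| * (1 + `|z| ^+ 3) <= K.
Proof.
exists (64 * normal_peak 1); first by rewrite mulr_gt0 // normal_peak_gt0 // oner_neq0.
move=> z; rewrite phiE ger0_norm; last first.
  by rewrite mulr_ge0 ?expR_ge0 // normal_peak_ge0.
rewrite -mulrA [64 * _]mulrC.
apply: ler_wpM2l; first exact: normal_peak_ge0.
rewrite expRN mulrC ler_pdivrMr ?expR_gt0 //.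
have e1 : 1 + z ^+ 2 / 4 <= expR (z ^+ 2 / 4) by exact: expR_ge1Dx.
have -> : z ^+ 2 / 2 = z ^+ 2 / 4 + z ^+ 2 / 4 by lra.
rewrite expRD.
have z2 : z ^+ 2 = `|z| ^+ 2 by rewrite real_normK ?num_real.
have zz : 0 <= `|z| by [].
rewrite z2 in e1 *; set y := `|z| in zz e1 *; set E := expR _ in e1 *.
apply: (@le_trans _ _ (64 * ((1 + y ^+ 2 / 4) * (1 + y ^+ 2 / 4)))).
  have : 0 <= (y ^+ 2 - y) ^+ 2 by exact: sqr_ge0.
  have : 0 <= y ^+ 2 by exact: sqr_ge0.
  have : 0 <= y ^+ 4 by exact: exprn_ge0.
  nra.
apply: ler_wpM2l => //; apply: ler_pM => //.
all: by rewrite addr_ge0 // divr_ge0 // exprn_ge0.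
Qed.

End standard_normal_cdf.

Section heat_kernel.
Context {R : realType}.
Notation phi := (@normal_pdf R 0 1).
Implicit Types x y z v h a b : R.

Lemma is_derive_zphi z : is_derive z 1 (fun y => - (y * phi y))
  ((z ^+ 2 - 1) * phi z).
Proof.
have := is_deriveN (is_deriveM (is_derive_id z 1) (is_derive_phi z)).
by move=> h; apply: is_derive_eq h _; rewrite /GRing.scale /=; ring.
Qed.

(** The minimum is what makes a finite variance enough for the limit theorem: the cubic remainder is
    small for small increments, and the quadratic one stays integrable when the third moment is
    infinite. *)
Lemma Phi_taylor : exists2 C : R, 0 < C & forall z k,
  `|Phi (z + k) - Phi z - phi z * k + z * phi z * k ^+ 2 / 2| <=
  C * Num.min (k ^+ 2) (`|k| ^+ 3).
Proof.
have [K K0 hK] := @phi_decay R.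
have b1 z : `|- (z * phi z)| <= 2 * K.
  rewrite normrN normrM; have := hK z.
  have : 0 <= `|phi z| by []. have : 0 <= `|z| by [].
  set y := `|z|; set p := `|phi z| => y0 p0.
  (* Since [(1 - y) ^ 2 (1 + y) = 1 - y - y ^ 2 + y ^ 3], the lower powers satisfy
     [y + y ^ 2 <= 1 + y ^ 3] and are covered by the cubic decay of [phi]. *)
  have : 0 <= p * ((1 - y) ^+ 2 * (1 + y)).
    by rewrite mulr_ge0 // mulr_ge0 ?sqr_ge0 // addr_ge0.
  have : 0 <= p * y ^+ 3 by rewrite mulr_ge0 // exprn_ge0.
  have : 0 <= p * (1 - y) ^+ 2 by rewrite mulr_ge0 // sqr_ge0.
  by nra.
have b2 z : `|(z ^+ 2 - 1) * phi z| <= 2 * K.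
  rewrite normrM; have := hK z.
  have z2 : `|z ^+ 2 - 1| <= `|z| ^+ 2 + 1.
    apply: le_trans (ler_normB _ _) _; rewrite normr1 normrX //.
  have : `|z ^+ 2 - 1| * `|phi z| <= (`|z| ^+ 2 + 1) * `|phi z|.
    by rewrite ler_wpM2r.
  have : 0 <= `|phi z| by []. have : 0 <= `|z| by [].
  set y := `|z|; set p := `|phi z| => y0 p0.
  have : 0 <= p * ((1 - y) ^+ 2 * (1 + y)).
    by rewrite mulr_ge0 // mulr_ge0 ?sqr_ge0 // addr_ge0.
  have : 0 <= p * y ^+ 3 by rewrite mulr_ge0 // exprn_ge0.
  have : 0 <= p * (1 - y) ^+ 2 by rewrite mulr_ge0 // sqr_ge0.
  have : 0 <= p * y by rewrite mulr_ge0.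
  by nra.
exists (4 * K); first by rewrite mulr_gt0.
move=> z k.
have k2 : `|Phi (z + k) - Phi z - phi z * k| <= 2 * K * k ^+ 2.
  have := @taylor1 R (@Phi R) phi (fun y => - (y * phi y)) (2 * K) z (z + k).
  rewrite [z + k]addrC addrK; apply=> x _; [exact: is_derive_Phi|
    exact: is_derive_phi|exact: b1].
rewrite minr_pMr; last by rewrite mulr_ge0 // ltW.
rewrite le_min; apply/andP; split.
  have := b1 z; rewrite normrN => b1z.
  have : `|z * phi z * k ^+ 2 / 2| <= K * k ^+ 2.
    rewrite -mulrA normrM [ `|k ^+ 2 / 2|]ger0_norm; last first.
      by rewrite divr_ge0 // sqr_ge0.
    have : 0 <= k ^+ 2 by exact: sqr_ge0.
    set q := k ^+ 2; set p := `|_ * _| in b1z *; nra.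
  move: k2; set A := _ - phi z * k; set B := _ / 2; set q := k ^+ 2 => hA hB.
  apply: le_trans (ler_normD _ _) _.
  have : 0 <= q by exact: sqr_ge0.
  nra.
(* Up to the constant [Phi z], this is the quadratic Taylor remainder of [Phi] at [z], as a function
   of the endpoint. Its derivative [dH] is the first-order remainder of [phi], to which [taylor1]
   applies; the mean value theorem supplies the third factor [k]. *)
pose H t := Phi t - phi z * (t - z) + z * phi z * (t - z) ^+ 2 / 2.
pose dH t := phi t - phi z - - (z * phi z) * (t - z).
have dHP (t : R) : is_derive t 1 H (dH t).
  have hid : is_derive t 1 (fun t : R => t - z) 1.
    have := is_deriveB (is_derive_id t 1) (is_derive_cst z t 1).
    by move=> h; apply: is_derive_eq h _; rewrite subr0.
  have := is_deriveD (is_deriveB (is_derive_Phi t) (is_deriveZ (phi z) hid))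
    (is_deriveZ (z * phi z / 2) (is_deriveM hid hid)).
  rewrite (_ : _ + _ = H); last first.
    apply/funext => y; rewrite /H.
    transitivity (Phi y - phi z * (y - z) + z * phi z / 2 * ((y - z) * (y - z))).
      by [].
    by ring.
  by move=> h; apply: is_derive_eq h _; rewrite /dH /GRing.scale /=; field.
have [c hc] := @mean_value R H dH z (z + k) (fun x _ => dHP x).
rewrite [z + k]addrC addrK {1}/H {1}/H addrK subrr.
rewrite mulr0 expr0n /= mulr0 mul0r subr0 addr0 => E.
have -> : Phi (k + z) - Phi z - phi z * k + z * phi z * k ^+ 2 / 2 = dH c * k.
  by rewrite -E; ring.
have ck : `|c - z| <= `|k|.
  move: hc; have [zk|zk] := leP z (z + k); move=> /andP[h1 h2].
    have k0 : 0 <= k by move: zk; rewrite lerDl.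
    by rewrite !ger0_norm ?subr_ge0 // lerBlDl.
  have k0 : k <= 0 by move: zk; rewrite gtrDl => /ltW.
  by rewrite !ler0_norm ?subr_le0 // lerN2 lerBrDl.
have dHc : `|dH c| <= 2 * K * (c - z) ^+ 2.
  have := @taylor1 R phi (fun y => - (y * phi y))
    (fun y => (y ^+ 2 - 1) * phi y) (2 * K) z c.
  by apply=> x _; [exact: is_derive_phi|exact: is_derive_zphi|exact: b2].
rewrite normrM exprSr mulrA ler_wpM2r //.
apply: (le_trans dHc); rewrite -[(c - z) ^+ 2]real_normK ?num_real //.
have : `|c - z| ^+ 2 <= `|k| ^+ 2 by rewrite lerXn2r ?nnegrE.
have : 0 <= `|k| ^+ 2 by rewrite exprn_ge0.
by set p := `|c - z| ^+ 2; set q := `|k| ^+ 2; nra.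
Qed.

(** For [v > 0], the probability that [x + N(0, v)] is at most [a]: the indicator of [x <= a],
    smoothed with variance [v]. *)
Definition heat a x v := Phi ((a - x) / Num.sqrt v).

Lemma is_derive_scaled b v : 0 < v ->
  is_derive v 1 (fun v => b / Num.sqrt v) (- (b / Num.sqrt v) / (2 * v)).
Proof.
move=> v0; have s0 : Num.sqrt v != 0 by rewrite gt_eqF // sqrtr_gt0.
have := is_deriveZ b (is_deriveV s0 (is_derive1_sqrt v0)).
move=> h; apply: is_derive_eq h _.
have v2 : v = Num.sqrt v ^+ 2 by rewrite sqr_sqrtr // ltW.
rewrite /GRing.scale /=; move: s0 v2; set s := Num.sqrt v => s0 v2.
by rewrite v2; field.
Qed.

(** With [z = b / sqrt v], the second derivative in [v] is [(3 z / 4 - z ^ 3 / 4) phi(z) / v ^ 2].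
    Its [z ^ 3] is the reason for the cubic weight in [phi_decay], which makes the bound uniform in
    [b]. *)
Lemma heat_taylor_time : exists2 C : R, 0 < C & forall b v h, 0 < v -> 0 <= h ->
  `|Phi (b / Num.sqrt (v + h)) - Phi (b / Num.sqrt v) +
    b / Num.sqrt v * phi (b / Num.sqrt v) / (2 * v) * h| <= C * (h / v) ^+ 2.
Proof.
have [K K0 hK] := @phi_decay R.
exists (2 * K); first by rewrite mulr_gt0.
move=> b v h v0 h0.
pose z := fun u : R => b / Num.sqrt u.
pose F1 u := - (z u * phi (z u)) / (2 * u).
pose F2 u := (3 / 4 * z u - z u ^+ 3 / 4) * phi (z u) / u ^+ 2.
have mm x : Num.min v (v + h) <= x <= Num.max v (v + h) -> v <= x.
  by rewrite (min_idPl _) ?lerDl // => /andP[].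
have dF x : 0 < x -> is_derive x 1 (fun u => Phi (z u)) (F1 x).
  move=> x0; have := is_derive1_comp (is_derive_Phi (z x)) (is_derive_scaled b x0).
  by move=> D; apply: is_derive_eq D _; rewrite /F1 /z; ring.
have dF1 x : 0 < x -> is_derive x 1 F1 (F2 x).
  move=> x0.
  have xn : x != 0 by rewrite gt_eqF.
  have D1 := is_derive1_comp (is_derive_zphi (z x)) (is_derive_scaled b x0).
  have D2 := is_deriveV xn (is_derive_id x 1).
  have D := is_deriveZ (1 / 2) (is_deriveM D1 D2).
  rewrite (_ : _ \*: _ = F1) in D; last first.
    apply/funext => y; rewrite /F1.
    transitivity (1 / 2 * (- (z y * phi (z y)) * y^-1)) => //.
    by rewrite invfM; ring.
  apply: is_derive_eq D _; rewrite /F2 /GRing.scale /= -/(z x).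
  by field.
have := @taylor1 R (fun u => Phi (z u)) F1 F2 (2 * K / v ^+ 2) v (v + h).
rewrite [v + h]addrC addrK => T.
have -> : b / Num.sqrt v * phi (b / Num.sqrt v) / (2 * v) * h = - (F1 v * h).
  by rewrite /F1 /z; ring.
have -> : 2 * K * (h / v) ^+ 2 = 2 * K / v ^+ 2 * h ^+ 2.
  by rewrite expr_div_n; ring.
rewrite [h + v]addrC in T *; apply: T => x /mm vx.
- by apply: dF; exact: lt_le_trans vx.
- by apply: dF1; exact: lt_le_trans vx.
have x0 : 0 < x by exact: lt_le_trans vx.
rewrite /F2 normrM [ `|(x ^+ 2)^-1|]ger0_norm ?invr_ge0 ?sqr_ge0 //.
apply: ler_pM => //; [by rewrite invr_ge0 sqr_ge0| |]; last first.
  by rewrite lef_pV2 ?posrE ?exprn_gt0 // lerXn2r ?nnegrE // ltW.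
rewrite normrM; have := hK (z x).
have z2 : `|3 / 4 * z x - z x ^+ 3 / 4| <= 3 / 4 * `|z x| + `|z x| ^+ 3 / 4.
  apply: le_trans (ler_normB _ _) _.
  rewrite [ `|3 / 4 * _|]normrM [ `|_ ^+ 3 / 4|]normrM normrX.
  by rewrite [ `|3 / 4|]ger0_norm // [ `|4^-1|]ger0_norm.
have : `|3 / 4 * z x - z x ^+ 3 / 4| * `|phi (z x)| <=
    (3 / 4 * `|z x| + `|z x| ^+ 3 / 4) * `|phi (z x)|.
  by rewrite ler_wpM2r.
have : 0 <= `|phi (z x)| by []. have : 0 <= `|z x| by [].
set y := `|z x|; set p := `|phi _| => y0 p0.
have : 0 <= p * ((1 - y) ^+ 2 * (1 + y)).
  by rewrite mulr_ge0 // mulr_ge0 ?sqr_ge0 // addr_ge0.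
have : 0 <= p * y ^+ 3 by rewrite mulr_ge0 // exprn_ge0.
have : 0 <= p * (1 - y) ^+ 2 by rewrite mulr_ge0 // sqr_ge0.
by nra.
Qed.

End heat_kernel.

Section standard_normal_cdf_limits.
Context {R : realType}.
Notation phi := (@normal_pdf R 0 1).
Implicit Types x t : R.

Lemma set_le_itv t : [set s : R | s <= t] = `]-oo, t]%classic.
Proof. by apply/seteqP; split=> x; rewrite /= in_itv. Qed.

Lemma normal_cdfE (sigma t : R) : (@normal_prob R 0 sigma) `]-oo, t]%classic =
  (\int[@lebesgue_measure R]_(x in `]-oo, t]) normal_pdf 0 sigma x)%:E.
Proof.
rewrite /normal_prob fineK //; apply: integrable_fin_num => //.
by apply: (integrableS measurableT) => //; exact: integrable_normal_pdf.
Qed.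

Lemma Phi_ge0 x : 0 <= Phi x.
Proof. by rewrite -lee_fin -normal_cdfE. Qed.

Lemma Phi_le1 x : Phi x <= 1.
Proof. by rewrite -lee_fin -normal_cdfE probability_le1. Qed.

Lemma Phi_norm_le1 x : `|Phi x| <= 1.
Proof. by rewrite ger0_norm ?Phi_ge0 ?Phi_le1. Qed.

Lemma Phi_homo : {homo (@Phi R) : x y / x <= y}.
Proof.
move=> x y xy; rewrite -lee_fin -!normal_cdfE.
by apply: le_measure; rewrite ?inE //; apply: subset_itvl; rewrite bnd_simp.
Qed.

Lemma continuous_Phi : continuous (@Phi R).
Proof. by move=> x; exact: is_derive1_continuous (is_derive_Phi x). Qed.

Lemma measurable_Phi : measurable_fun setT (@Phi R).
Proof. exact: continuous_measurable_fun continuous_Phi. Qed.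

End standard_normal_cdf_limits.

Section cdf_limits.
Context {R : realType}.
Let idTR : measurableTypeR R -> R := idfun.
#[local] HB.instance Definition _ :=
  @isMeasurableFun.Build _ _ _ _ idTR (@measurable_id _ _ setT).

Lemma cvg_cdf_pinfty (mu : probability (measurableTypeR R) R) :
  mu `]-oo, t]%classic @[t --> +oo] --> 1%E.
Proof. exact: (@cvg_cdfy1 _ _ _ mu (idTR : {RV mu >-> R})). Qed.

Lemma cvg_cdf_ninfty (mu : probability (measurableTypeR R) R) :
  mu `]-oo, t]%classic @[t --> -oo] --> 0%E.
Proof. exact: (@cvg_cdfNy0 _ _ _ mu (idTR : {RV mu >-> R})). Qed.

Lemma cvg_Phi_pinfty : @Phi R t @[t --> +oo] --> (1 : R).
Proof.
have := cvg_cdf_pinfty (@normal_prob R 0 1).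
rewrite (_ : (fun t => _) = (fun t => (Phi t)%:E)); first by move/fine_cvg.
by apply/funext => t; exact: normal_cdfE.
Qed.

Lemma cvg_Phi_ninfty : @Phi R t @[t --> -oo] --> (0 : R).
Proof.
have := cvg_cdf_ninfty (@normal_prob R 0 1).
rewrite (_ : (fun t => _) = (fun t => (Phi t)%:E)); first by move/fine_cvg.
by apply/funext => t; exact: normal_cdfE.
Qed.

(** Both sides have the density of [N(0, sigma ^ 2)] as derivative and vanish at minus infinity;
    this takes the place of a change of variables under the integral. *)
Lemma normal_cdf_Phi (sigma t : R) : 0 < sigma ->
  (@normal_prob R 0 sigma) `]-oo, t]%classic = (Phi (t / sigma))%:E.
Proof.
move=> s0; rewrite normal_cdfE; congr EFin.
have sn0 : sigma != 0 by rewrite gt_eqF.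
pose F u := \int[@lebesgue_measure R]_(x in `]-oo, u]) normal_pdf 0 sigma x.
pose G u := Phi (u / sigma).
have dF (x : R) : is_derive x 1 F (normal_pdf 0 sigma x).
  have [] := @continuous_FTC1 R (normal_pdf 0 sigma) (BInfty _ true) x (x + 1).
  - by rewrite ltrDl.
  - by apply: (integrableS measurableT) => //; exact: integrable_normal_pdf.
  - by rewrite ltNyr.
  - by apply: continuous_normal_pdf.
  by move=> h1 h2; split; [exact: h1|rewrite -derive1E; exact: h2].
have dG (x : R) : is_derive x 1 G (normal_pdf 0 sigma x).
  have hid : is_derive x 1 (fun u : R => u / sigma) sigma^-1.
    rewrite (_ : (fun _ => _) = sigma^-1 \*: @id R); last first.
      by apply/funext => u; rewrite mulrC.
    by apply: is_derive_eq; rewrite /GRing.scale /= mulr1.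
  have := @is_derive1_comp R (@Phi R) (fun u => u / sigma) x _ _
    (is_derive_Phi (x / sigma)) hid.
  move=> h; apply: is_derive_eq h _.
  rewrite phiE normal_pdfE // /normal_fun /normal_peak subr0 expr1n mul1r.
  have -> : sigma ^+ 2 * pi *+ 2 = sigma ^+ 2 * (pi *+ 2).
    by rewrite -mulrnAr.
  rewrite sqrtrM ?sqr_ge0 // sqrtr_sqr ger0_norm ?(ltW s0) // invfM.
  rewrite mulrC mulrA; congr (_ * expR _).
  by rewrite -[sigma ^+ 2 *+ 2]mulr_natr; field.
have FG u : F u - G u = F 0 - G 0.
  apply: (is_derive_0_is_cst (f := fun u => F u - G u)) => x.
  by have := is_deriveB (dF x) (dG x); rewrite subrr.
suff : F 0 - G 0 = 0 by move=> e; apply/eqP; rewrite -subr_eq0 FG e.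
have F0 : F u @[u --> -oo] --> (0 : R).
  have := cvg_cdf_ninfty (@normal_prob R 0 sigma).
  rewrite (_ : (fun t => _) = (fun t => (F t)%:E)); first by move/fine_cvg.
  by apply/funext => u; exact: normal_cdfE.
have G0 : G u @[u --> -oo] --> (0 : R).
  apply: cvg_comp cvg_Phi_ninfty; apply: (gt0_cvgMlNy _ cvg_id).
  by rewrite invr_gt0.
have FG0 : (F - G) x @[x --> -oo] --> (0 - 0 : R).
  by apply: (@cvgB _ R^o); [exact: F0|exact: G0].
rewrite (_ : F - G = cst (F 0 - G 0)) ?subr0 in FG0.
  by apply: (cvg_unique (@Rhausdorff R) _ FG0); exact: cvg_cst.
by apply/funext => u; exact: FG.
Qed.

End cdf_limits.

Section lindeberg_step.
Context {dO : measure_display} {Omega : measurableType dO} {R : realType}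
  (P : probability Omega R).
Notation phi := (@normal_pdf R 0 1).
Implicit Types (f : Omega -> R) (a x v : R).

Lemma heat_norm_le1 a x v : `|heat a x v| <= 1.
Proof. exact: Phi_norm_le1. Qed.

Lemma measurable_heat f a v : measurable_fun setT f ->
  measurable_fun setT (fun w => heat a (f w) v).
Proof.
move=> mf; apply: measurableT_comp; first exact: measurable_Phi.
by apply: measurable_funM => //; exact: measurable_funB.
Qed.

Lemma L2_L1_min f : L2 P f -> L1 P (fun w => Num.min (f w ^+ 2) (`|f w| ^+ 3)).
Proof.
move=> hf; have [mf _] := hf.
apply: (L1_le _ _ (L2_L1_sqr hf)).
  apply: measurable_minr; first exact: measurable_funX.
  by apply: measurable_funX; exact: measurableT_comp.
move=> w; rewrite [leLHS]ger0_norm; last by rewrite le_min sqr_ge0 exprn_ge0.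
by rewrite [leRHS]ger0_norm ?sqr_ge0 // ge_min lexx.
Qed.

(* One Lindeberg replacement step, with the Gaussian summand replaced by the
   heat flow: [heat] solves [2 d/dv = d^2/dx^2]. *)
Lemma heat_step (v0 : R) : 0 < v0 -> exists2 C : R, 0 < C &
  forall a x v f, v0 <= v -> L2 P f -> \int[P]_w f w = 0 ->
  `|\int[P]_w heat a (x + f w) v - heat a x (v + \int[P]_w (f w ^+ 2))| <=
  C * (\int[P]_w Num.min (f w ^+ 2) (`|f w| ^+ 3) +
       (\int[P]_w (f w ^+ 2)) ^+ 2).
Proof.
move=> v00; have [C1 C10 hC1] := @Phi_taylor R.
have [C2 C20 hC2] := @heat_taylor_time R.
pose s0 := (Num.sqrt v0)^-1.
have s00 : 0 < s0 by rewrite invr_gt0 sqrtr_gt0.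
pose D := s0 ^+ 2 + s0 ^+ 3.
have D0 : 0 < D by rewrite addr_gt0 ?exprn_gt0.
pose C := C1 * D + C2 / v0 ^+ 2.
have C0' : 0 < C2 / v0 ^+ 2 by rewrite divr_gt0 // exprn_gt0.
have C1D : 0 < C1 * D by rewrite mulr_gt0.
exists C; first by rewrite addr_gt0.
move=> a x v f vv hf f0; have [mf _] := hf.
have vpos : 0 < v by exact: lt_le_trans vv.
set h := \int[P]_w (f w ^+ 2).
set M := \int[P]_w Num.min _ _.
have h0 : 0 <= h by apply: Rintegral_ge0 => w _; exact: sqr_ge0.
have M0 : 0 <= M.
  by apply: Rintegral_ge0 => w _; rewrite le_min sqr_ge0 exprn_ge0.
pose z := (a - x) / Num.sqrt v.
pose s := (Num.sqrt v)^-1.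
have spos : 0 < s by rewrite invr_gt0 sqrtr_gt0.
have ss0 : s <= s0.
  by rewrite lef_pV2 ?posrE ?sqrtr_gt0 // ler_wsqrtr.
have s2 : s ^+ 2 = v^-1 by rewrite exprVn sqr_sqrtr // ltW.
pose r w := heat a (x + f w) v - Phi z - phi z * (- (s * f w)) +
  z * phi z * (- (s * f w)) ^+ 2 / 2.
have rle w : `|r w| <= C1 * D * Num.min (f w ^+ 2) (`|f w| ^+ 3).
  have -> : r w = Phi (z + (- (s * f w))) - Phi z - phi z * (- (s * f w)) +
      z * phi z * (- (s * f w)) ^+ 2 / 2.
    rewrite /r /heat (_ : (a - (x + f w)) / _ = z + (- (s * f w))) //.
    by rewrite /z -/s; ring.
  apply: (le_trans (hC1 _ _)); rewrite -mulrA ler_pM2l //.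
  rewrite normrN normrM (gtr0_norm spos) sqrrN !exprMn.
  have k2 : s ^+ 2 * f w ^+ 2 <= D * f w ^+ 2.
    apply: ler_wpM2r; first exact: sqr_ge0.
    apply: (@le_trans _ _ (s0 ^+ 2)).
      by rewrite lerXn2r ?nnegrE ?(ltW spos) ?(ltW s00).
    by rewrite lerDl exprn_ge0 // ltW.
  have k3 : s ^+ 3 * `|f w| ^+ 3 <= D * `|f w| ^+ 3.
    apply: ler_wpM2r; first exact: exprn_ge0.
    apply: (@le_trans _ _ (s0 ^+ 3)).
      by rewrite lerXn2r ?nnegrE ?(ltW spos) ?(ltW s00).
    by rewrite lerDr exprn_ge0 // ltW.
  rewrite minr_pMr ?(ltW D0) // le_min.
  by apply/andP; split; rewrite ge_min ?k2 ?k3 ?orbT.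
have mh : measurable_fun setT (fun w => heat a (x + f w) v).
  by apply: measurable_heat; exact: measurable_funD.
have ih : L1 P (fun w => heat a (x + f w) v).
  by apply: (@L1_bounded _ _ _ _ _ 1) => // w; exact: heat_norm_le1.
have if1 : L1 P f by exact: L2_L1.
have if2 : L1 P (fun w => f w ^+ 2) by exact: L2_L1_sqr.
have rE w : r w = heat a (x + f w) v +
    ((- Phi z) + ((phi z * s) * f w + (z * phi z * s ^+ 2 / 2) * f w ^+ 2)).
  by rewrite /r; ring.
have i3 : L1 P (fun w => (phi z * s) * f w +
    (z * phi z * s ^+ 2 / 2) * f w ^+ 2) by apply: L1D; exact: L1Z.
have i2 := L1D (L1_cst P (- Phi z)) i3.
have Ir : \int[P]_w r w = \int[P]_w heat a (x + f w) v - Phi z +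
    z * phi z * s ^+ 2 / 2 * h.
  under eq_Rintegral do rewrite rE.
  rewrite RintegralD // RintegralD //; last exact: L1_cst.
  rewrite RintegralD //; [|exact: L1Z|exact: L1Z].
  by rewrite Rintegral_prob_cst !RintegralZl // f0 mulr0 add0r addrA.
have ir : L1 P r by rewrite (funext rE); exact: L1D.
have Ile : `|\int[P]_w r w| <= C1 * D * M.
  apply: le_trans (le_normr_Rintegral measurableT ir) _.
  rewrite -RintegralZl //; last exact: L2_L1_min.
  apply: le_Rintegral => //; first exact: L1_abs.
  by apply: L1Z; exact: L2_L1_min.
have Tle := hC2 (a - x) v h vpos h0.
rewrite -/z in Tle.
(* Here the heat equation acts: since [s ^+ 2 = v^-1], the second-order term in space is the
   first-order term in time, and the linear term is gone because [f] is centred. Only the two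
   remainders survive. *)
have -> : \int[P]_w heat a (x + f w) v - heat a x (v + h) =
    \int[P]_w r w - (Phi ((a - x) / Num.sqrt (v + h)) - Phi z +
      z * phi z / (2 * v) * h).
  by rewrite Ir /heat s2 invfM; ring.
apply: le_trans (ler_normB _ _) _.
have hv : C2 * (h / v) ^+ 2 <= C2 / v0 ^+ 2 * h ^+ 2.
  rewrite expr_div_n -mulrA [h ^+ 2 / _]mulrC ler_pM2l //.
  apply: ler_wpM2r; first exact: sqr_ge0.
  by rewrite lef_pV2 ?posrE ?exprn_gt0 // lerXn2r ?nnegrE // ltW.
apply: le_trans (lerD Ile (le_trans Tle hv)) _.
have : 0 <= h ^+ 2 by exact: sqr_ge0.
rewrite /C; set A := C1 * D in C1D *; set B := C2 / v0 ^+ 2 in C0' *.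
by set q := h ^+ 2 => q0; nra.
Qed.

End lindeberg_step.

(** * Lindeberg replacement *)

Lemma cvg_invr_sqrtn {R : realType} :
  (Num.sqrt n%:R)^-1 @[n --> \oo] --> (0 : R).
Proof.
apply/gtr0_cvgV0.
  by near=> n; rewrite sqrtr_gt0 ltr0n; near: n; exact: nbhs_infty_gt.
apply/cvgryPge => A; near=> n.
apply: le_trans (ler_norm A) _; rewrite -sqrtr_sqr ler_wsqrtr //.
by near: n; exact: nbhs_infty_ger.
Unshelve. all: by end_near.
Qed.

Section smooth_clt.
Context {dO d : measure_display} {Omega : measurableType dO}
  {T : measurableType d} {R : realType} (P : probability Omega R)
  (W : {RV P >-> T}) (Ws : nat -> {RV P >-> T}).
Hypothesis iid : iid_copies W Ws.
Let data n := sample (fun i => Ws i : Omega -> T) n.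
Variable psi : T -> R.
Hypothesis mpsi : measurable_fun setT psi.
Hypothesis psi2 : L2 P (fun w => psi (W w)).
Hypothesis psi0 : \int[P]_w psi (W w) = 0.
Let V := \int[P]_w (psi (W w) ^+ 2).

Definition partial_sum {n : nat} (s : n.-tuple T) (k : nat) : R :=
  \sum_(i < n | (i < k)%N) psi (tnth s i).

Lemma partial_sum0 n (s : n.-tuple T) : partial_sum s 0 = 0.
Proof. by rewrite /partial_sum big_pred0. Qed.

Lemma partial_sum_full n (s : n.-tuple T) :
  partial_sum s n = \sum_(i < n) psi (tnth s i).
Proof. by apply: eq_bigl => i; rewrite ltn_ord. Qed.

Lemma partial_sumS n (s : n.-tuple T) (j : 'I_n) :
  partial_sum s j.+1 = partial_sum s j + psi (tnth s j).
Proof.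
rewrite /partial_sum (bigD1 j) //= addrC; congr (_ + _).
by apply: eq_bigl => i; rewrite ltnS andbC -val_eqE ltn_neqAle.
Qed.

Lemma partial_sum_resample n (s : n.-tuple T) (j : 'I_n) w :
  partial_sum (resample s j w) j.+1 = partial_sum s j + psi w.
Proof.
rewrite partial_sumS tnth_resample eqxx; congr (_ + _).
apply: eq_bigr => i ij; rewrite tnth_resample; case: eqP => // e.
by rewrite e ltnn in ij.
Qed.

Lemma measurable_partial_sum n k :
  measurable_fun [set: n.-tuple T] (fun s => partial_sum s k).
Proof.
rewrite /partial_sum; under eq_fun do rewrite big_mkcond /=.
apply: measurable_sum => i; case: (i < k)%N => //.
by apply: (measurableT_comp mpsi); exact: measurable_tnth.
Qed.

(** This is [n] times the integral of [Num.min (f ^ 2) (|f| ^ 3)] for the normalized summand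
    [f = psi / sqrt n], that is, up to a constant, the total spatial error of the [n]
    replacements. *)
Let M n := \int[P]_w Num.min (psi (W w) ^+ 2)
  (`|psi (W w)| ^+ 3 / Num.sqrt n%:R).

Lemma lindeberg_bound (v0 : R) : 0 < v0 -> exists2 C : R, 0 < C &
  forall a n, (0 < n)%N ->
  `|\int[P]_w heat a (partial_sum (data n w) n / Num.sqrt n%:R) v0 -
    heat a 0 (v0 + V)| <= C * (M n + V ^+ 2 / n%:R).
Proof.
move=> v00; have [C C0 hC] := @heat_step _ _ _ P v0 v00.
exists C => // a n n0.
have nR : 0 < n%:R :> R by rewrite ltr0n.
have nRn : n%:R != 0 :> R by rewrite gt_eqF.
pose sn : R := Num.sqrt n%:R.
have sn0 : 0 < sn by rewrite sqrtr_gt0.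
have sn2 : sn ^+ 2 = n%:R by rewrite sqr_sqrtr // ltW.
have V0 : 0 <= V by apply: Rintegral_ge0 => w _; exact: sqr_ge0.
(* After [k] steps the first [k] observations have entered the sum, and the other [n - k] are
   represented by their total variance; [A k] below interpolates between the two sides of the claim.
   The floor [v0] keeps the kernel smooth even at [k = n]. *)
pose v k := v0 + (n - k)%:R * (V / n%:R).
have vv k : v0 <= v k.
  by rewrite lerDl mulr_ge0 // divr_ge0 // ltW.
pose f w := psi (W w) / sn.
have hf : L2 P f.
  have := L2Z sn^-1 psi2; congr L2; apply/funext => w; exact: mulrC.
have f0 : \int[P]_w f w = 0.
  by rewrite RintegralZr ?psi0 ?mul0r //; exact: L2_L1 psi2.
have f2 : \int[P]_w (f w ^+ 2) = V / n%:R.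
  under eq_Rintegral do rewrite expr_div_n sn2.
  by rewrite RintegralZr //; exact: L2_L1_sqr psi2.
have fmin : \int[P]_w Num.min (f w ^+ 2) (`|f w| ^+ 3) = M n / n%:R.
  have fE w : Num.min (f w ^+ 2) (`|f w| ^+ 3) =
      Num.min (psi (W w) ^+ 2) (`|psi (W w)| ^+ 3 / sn) / n%:R.
    rewrite minr_pMl ?invr_ge0 ?(ltW nR) //; congr Num.min.
      by rewrite expr_div_n sn2.
    rewrite /f normrM normfV (gtr0_norm sn0) expr_div_n -sn2.
    by field; rewrite gt_eqF.
  under eq_Rintegral do rewrite fE.
  rewrite RintegralZr //.
  apply: (L1_le _ _ (L2_L1_sqr psi2)).
    have [mW _] := psi2.
    apply: measurable_minr; first exact: measurable_funX.
    apply: measurable_funM => //; apply: measurable_funX.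
    exact: measurableT_comp.
  move=> w; rewrite [leLHS]ger0_norm; last first.
    by rewrite le_min sqr_ge0 divr_ge0 ?exprn_ge0 // ltW.
  by rewrite [leRHS]ger0_norm ?sqr_ge0 // ge_min lexx.
pose e := C * (M n / n%:R + (V / n%:R) ^+ 2).
pose A k := \int[P]_w heat a (partial_sum (data n w) k / sn) (v k).
have mdata k : measurable_fun setT (fun w => partial_sum (data n w) k / sn).
  apply: measurable_funM => //.
  by apply: (measurableT_comp (measurable_partial_sum k)); exact: measurable_sample.
have iA k u : L1 P (fun w => heat a (partial_sum (data n w) k / sn) u).
  apply: (@L1_bounded _ _ _ _ _ 1); first exact: measurable_heat.
  by move=> w; exact: heat_norm_le1.
have step k : (k < n)%N -> `|A k.+1 - A k| <= e.
  move=> kn; pose j := Ordinal kn.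
  (* Resampling observation [k] separates it from the partial sum, so that [heat_step] applies at
     each fixed value of that sum. *)
  pose J w := \int[P]_w' heat a (partial_sum (data n w) k / sn + f w') (v k.+1).
  pose H s := (heat a (@partial_sum n s k.+1 / sn) (v k.+1))%:E.
  have mf : measurable_fun setT f by have [] := hf.
  have iJ w : L1 P (fun w' =>
      heat a (partial_sum (data n w) k / sn + f w') (v k.+1)).
    apply: (@L1_bounded _ _ _ _ _ 1); last by move=> w'; exact: heat_norm_le1.
    by apply: measurable_heat; exact: measurable_funD.
  have JE w : (\int[P]_w' H (resample (data n w) j (W w')) = (J w)%:E)%E.
    rewrite -(L1_EFin (iJ w)); apply: eq_integral => w' _.
    by rewrite /H (partial_sum_resample (data n w) j) /f mulrDl.
  have mH : measurable_fun [set: n.-tuple T] H.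
    apply/measurable_EFinP; apply: measurable_heat.
    by apply: measurable_funM => //; exact: measurable_partial_sum.
  have H0 s : (0 <= H s)%E by rewrite lee_fin Phi_ge0.
  have mJ : measurable_fun setT J.
    apply/measurable_EFinP; rewrite (_ : EFin \o J = fun w =>
      (\int[P]_w' H (resample (data n w) j (W w')))%E); last first.
      by apply/funext => w; rewrite JE.
    apply: (measurable_fun_fubini_tonelli_F (m2 := P) (fun p : Omega * Omega =>
      H (resample (data n p.1) j (W p.2)))) => //.
    apply: (measurableT_comp mH).
    apply: (measurableT_comp (f := fun p : n.-tuple T * T =>
      resample p.1 j p.2) (g := fun p : Omega * Omega => (data n p.1, W p.2))).
      exact: measurable_resample.
    apply: measurable_fun_pair.
      by apply: measurableT_comp => //; exact: measurable_sample.
    by apply: measurableT_comp => //; exact: measurable_funPT.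
  have J1 w : `|J w| <= 1.
    rewrite ger0_norm; last by apply: Rintegral_ge0 => w' _; exact: Phi_ge0.
    by apply: Rintegral_le_cst => // w'; exact: Phi_le1.
  have LJ : L1 P J by exact: (L1_bounded P mJ J1).
  have AS : A k.+1 = \int[P]_w J w.
    apply/EFin_inj; rewrite /A -!L1_EFin //.
    rewrite (ge0_integral_resample iid j mH H0).
    by apply: eq_integral => w _; rewrite JE.
  have vk : v k = v k.+1 + V / n%:R.
    by rewrite /v -{1}(subnSK kn) -natr1 mulrDl mul1r addrA.
  rewrite AS /A -RintegralB //; last exact: iA.
  apply: le_trans (le_normr_Rintegral measurableT _) _; first exact: L1B.
  apply: Rintegral_le_cst; first by apply: L1_abs; exact: L1B.
  move=> w; have := hC a (partial_sum (data n w) k / sn) (v k.+1) f (vv _) hf f0.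
  by rewrite f2 fmin vk.
have tele k : (k <= n)%N -> `|A k - A 0%N| <= k%:R * e.
  elim: k => [_|k IH kn]; first by rewrite subrr normr0 mul0r.
  rewrite -[A k.+1](subrK (A k)) -addrA -natr1 mulrDl mul1r addrC.
  apply: le_trans (ler_normD _ _) _.
  exact: (lerD (IH (ltnW kn)) (step k kn)).
have := tele n (leqnn n).
have -> : A 0%N = heat a 0 (v0 + V).
  rewrite /A /v; under eq_Rintegral do rewrite partial_sum0 mul0r subn0.
  by rewrite Rintegral_prob_cst mulrCA divff // mulr1.
have -> : A n = \int[P]_w heat a (partial_sum (data n w) n / sn) v0.
  by rewrite /A /v subnn mul0r addr0.
move=> h; apply: le_trans h _; rewrite le_eqVlt /e; apply/orP; left.
by apply/eqP; field.
Qed.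

(** Dominated convergence under [psi ^ 2]: pointwise, the cubic branch is of order [1 / sqrt n].
    This is where a second moment suffices without a Lyapunov condition. *)
Lemma lindeberg_truncation : M n @[n --> \oo] --> (0 : R).
Proof.
have [mW _] := psi2.
pose F n w := (Num.min (psi (W w) ^+ 2)
  (`|psi (W w)| ^+ 3 / Num.sqrt n%:R))%:E.
have F0 n w : 0 <= Num.min (psi (W w) ^+ 2)
    (`|psi (W w)| ^+ 3 / Num.sqrt (n%:R : R)).
  by rewrite le_min sqr_ge0 divr_ge0 ?exprn_ge0 ?sqrtr_ge0.
have mF n : measurable_fun setT (F n).
  apply/measurable_EFinP.
  apply: measurable_minr; first exact: measurable_funX.
  apply: measurable_funM => //; apply: measurable_funX.
  exact: measurableT_comp.
have := @dominated_cvg _ _ _ P setT measurableT F (cst 0%E)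
  (fun w => (psi (W w) ^+ 2)%:E) mF.
rewrite integral0 => H.
apply: fine_cvg; apply: H.
- move=> w _; rewrite /F; apply/fine_cvgP; split; first exact: nearW.
  apply: (@squeeze_cvgr _ _ _ _ (fun=> 0)
    (fun n => `|psi (W w)| ^+ 3 / Num.sqrt n%:R)).
  + by apply: nearW => n; rewrite F0 /= ge_min lexx orbT.
  + exact: cvg_cst.
  rewrite -[X in _ --> X](mulr0 (`|psi (W w)| ^+ 3)).
  apply: cvgM; first exact: cvg_cst.
  exact: cvg_invr_sqrtn.
- by [].
- exact: L2_L1_sqr psi2.
- by move=> n w _; rewrite gee0_abs ?lee_fin // ge_min lexx.
Qed.

Lemma smooth_clt (v0 : R) a : 0 < v0 ->
  \int[P]_w heat a ((\sum_(i < n) psi (tnth (data n w) i)) / Num.sqrt n%:R) v0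
    @[n --> \oo] --> heat a 0 (v0 + V).
Proof.
move=> v00; have [C C0 hC] := lindeberg_bound v00.
apply/cvgrPdist_le => e e0.
have : C * (M n + V ^+ 2 / n%:R) @[n --> \oo] --> (0 : R).
  rewrite -[X in _ --> X](mulr0 C) -[X in _ --> C * X](addr0 0).
  apply: cvgM; first exact: cvg_cst.
  apply: cvgD; first exact: lindeberg_truncation.
  rewrite -[X in _ --> X](mulr0 (V ^+ 2)).
  apply: cvgM; first exact: cvg_cst.
  apply/gtr0_cvgV0; last exact: cvgr_idn.
  by near=> n; rewrite ltr0n; near: n; exact: nbhs_infty_gt.
move=> /cvgrPdist_le /(_ e e0) He.
near=> n; rewrite distrC.
under eq_Rintegral do rewrite -partial_sum_full.
apply: le_trans (hC a n _) _; first by near: n; exact: nbhs_infty_gt.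
apply: le_trans (ler_norm _) _.
by rewrite -normrN -sub0r; near: n.
Unshelve. all: by end_near.
Qed.

End smooth_clt.

(** * Stochastic convergence *)

Section vanishing.
Context {dO : measure_display} {Omega : measurableType dO} {R : realType}
  (P : probability Omega R).

(* Convergence to 0 in outer probability: no measurability of [Z n] needed. *)
Definition vanishing (Z : nat -> Omega -> R) : Prop :=
  forall e : R, 0 < e -> \forall n \near \oo, exists A : set Omega,
    [/\ measurable A, (P A <= e%:E)%E & forall w, ~ A w -> `|Z n w| <= e].

Lemma vanishing0 : vanishing (fun _ _ => 0).
Proof.
move=> e e0; apply: nearW => n; exists set0; split => //.
  by rewrite measure0 lee_fin ltW.
by move=> w _; rewrite normr0 ltW.
Qed.

Lemma vanishingD (Z1 Z2 : nat -> Omega -> R) : vanishing Z1 -> vanishing Z2 ->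
  vanishing (fun n w => Z1 n w + Z2 n w).
Proof.
move=> h1 h2 e e0.
have e2 : 0 < e / 2 by rewrite divr_gt0.
near=> n.
have [A [mA PA hA]] : exists A : set Omega, [/\ measurable A,
    (P A <= (e / 2)%:E)%E & forall w, ~ A w -> `|Z1 n w| <= e / 2].
  by near: n; exact: h1.
have [B [mB PB hB]] : exists A : set Omega, [/\ measurable A,
    (P A <= (e / 2)%:E)%E & forall w, ~ A w -> `|Z2 n w| <= e / 2].
  by near: n; exact: h2.
exists (A `|` B); split; first exact: measurableU.
  apply: le_trans (measureU2 _ mA mB) _.
  by rewrite [e]splitr EFinD; exact: leeD.
move=> w /not_orP[nA nB]; rewrite [e]splitr.
by apply: le_trans (ler_normD _ _) _; apply: lerD; [exact: hA|exact: hB].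
Unshelve. all: by end_near.
Qed.

Lemma vanishing_sum (L : nat) (Z : 'I_L -> nat -> Omega -> R) :
  (forall l, vanishing (Z l)) -> vanishing (fun n w => \sum_(l < L) Z l n w).
Proof.
elim: L Z => [|L IH] Z h.
  rewrite (_ : (fun n w => _) = fun _ _ => 0); first exact: vanishing0.
  by apply/funext => n; apply/funext => w; rewrite big_ord0.
rewrite (_ : (fun n w => _) = fun n w =>
    \sum_(l < L) Z (widen_ord (leqnSn L) l) n w + Z ord_max n w).
  apply: vanishingD => //; apply: IH => l; exact: h.
by apply/funext => n; apply/funext => w; rewrite big_ord_recr.
Qed.

Lemma vanishing_le (Z Z' : nat -> Omega -> R) : vanishing Z' ->
  (forall n w, `|Z n w| <= `|Z' n w|) -> vanishing Z.
Proof.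
move=> h le e e0; apply: filterS (h e e0) => n [A [mA PA hA]].
by exists A; split => // w nA; apply: le_trans (le n w) (hA w nA).
Qed.

Lemma vanishing_sqr (Z : nat -> Omega -> R) :
  vanishing (fun n w => Z n w ^+ 2) -> vanishing Z.
Proof.
move=> h e e0.
have m0 : 0 < Num.min e (e ^+ 2) by rewrite lt_min e0 exprn_gt0.
apply: filterS (h _ m0) => n [A [mA PA hA]]; exists A; split => //.
  by apply: le_trans PA _; rewrite lee_fin ge_min lexx.
move=> w nA; have := hA w nA.
rewrite ger0_norm ?sqr_ge0 // le_min => /andP[_].
by rewrite -[Z n w ^+ 2]real_normK ?num_real // ler_pXn2r ?nnegrE // ltW.
Qed.

Lemma ge0_vanishing (Z : nat -> Omega -> R) (c : nat -> R) :
  (forall n, measurable_fun setT (Z n)) -> (forall n w, 0 <= Z n w) ->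
  (forall n, (\int[P]_w (Z n w)%:E <= (c n)%:E)%E) ->
  c n @[n --> \oo] --> (0 : R) -> vanishing Z.
Proof.
move=> mZ Z0 hc c0 e e0.
have e2 : 0 < e ^+ 2 by rewrite exprn_gt0.
move/cvgrPdist_le : c0 => /(_ _ e2) c0.
near=> n; exists [set w | e <= Z n w]; split.
- rewrite -[X in measurable X]setTI.
  rewrite (_ : [set w | _] = Z n @^-1` `[e, +oo[%classic); first exact: mZ.
  by apply/seteqP; split=> w; rewrite /= in_itv /= andbT.
- apply: le_trans (markov_ge0 P (mZ n) (Z0 n) e0) _.
  apply: (@le_trans _ _ (e^-1%:E * (e ^+ 2)%:E)%E).
    apply: lee_wpmul2l; first by rewrite lee_fin invr_ge0 ltW.
    apply: le_trans (hc n) _; rewrite lee_fin.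
    apply: le_trans (ler_norm _) _; rewrite -normrN -sub0r.
    by near: n.
  by rewrite -EFinM lee_fin expr2 mulKf // gt_eqF.
- move=> w /negP; rewrite -ltNge => lt.
  by rewrite ger0_norm // ltW.
Unshelve. all: by end_near.
Qed.

Lemma vanishing_cvg_in_prob (Z : nat -> Omega -> R) (c : R) :
  (forall n, measurable_fun setT (Z n)) ->
  vanishing (fun n w => Z n w - c) ->
  cvg_in_prob P (fun n w => (Z n w)%:E) c.
Proof.
move=> mZ h eps eps0.
have mS n : measurable [set w | (eps%:E < `|(Z n w)%:E - c%:E|)%E].
  rewrite (_ : [set w | _] =
    (fun w => `|Z n w - c|) @^-1` `]eps, +oo[%classic); last first.
    by apply/seteqP; split=> w; rewrite /= in_itv /= andbT ?lte_fin.
  rewrite -[X in measurable X]setTI.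
  apply: (measurableT_comp (@normr_measurable R setT)) => //.
  exact: measurable_funB.
apply/fine_cvgP; split.
  by apply: nearW => n; exact: fin_num_measure.
apply/cvgrPdist_le => e e0.
have m0 : 0 < Num.min e eps by rewrite lt_min e0.
apply: filterS (h _ m0) => n [A [mA PA hA]].
change (`|0 - fine (P [set w | (eps%:E < `|(Z n w)%:E - c%:E|)%E])| <= e).
rewrite sub0r normrN ger0_norm ?fine_ge0 //.
rewrite -lee_fin fineK ?fin_num_measure //.
apply: (@le_trans _ _ (P A)); last first.
  by apply: le_trans PA _; rewrite lee_fin ge_min lexx.
apply: le_measure; rewrite ?inE // => w /=.
rewrite lte_fin => lt; apply: contrapT => /hA.
by rewrite le_min => /andP[_]; rewrite leNgt lt.
Qed.

Lemma vanishingM (Z1 Z2 : nat -> Omega -> R) :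
  vanishing Z1 -> vanishing Z2 -> vanishing (fun n w => Z1 n w * Z2 n w).
Proof.
move=> h1 h2 e e0.
have e20 : 0 < Num.min (e / 2) 1 by rewrite lt_min divr_gt0 /=.
apply: filterS2 (h1 _ e20) (h2 _ e20) => n [A [mA PA hA]] [B [mB PB hB]].
exists (A `|` B); split; first exact: measurableU.
  apply: le_trans (measureU2 _ mA mB) _.
  rewrite [X in X%:E]splitr EFinD; apply: leeD.
    by apply: le_trans PA _; rewrite lee_fin ge_min lexx.
  by apply: le_trans PB _; rewrite lee_fin ge_min lexx.
move=> w /not_orP[/hA h /hB h']; rewrite normrM -[e]mulr1; apply: ler_pM => //.
  apply: le_trans h _; rewrite ge_min; apply/orP; left.
  by rewrite ler_pdivrMr // ler_peMr ?ler1n // ltW.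
by apply: le_trans h' _; rewrite ge_min lexx orbT.
Qed.

Lemma vanishingZ (a : R) (Z : nat -> Omega -> R) :
  vanishing Z -> vanishing (fun n w => a * Z n w).
Proof.
move=> h e e0; have a1 : 1 <= `|a| + 1 by rewrite lerDr.
have a0 := lt_le_trans ltr01 a1.
apply: filterS (h _ (divr_gt0 e0 a0)) => n [A [mA PA hA]].
exists A; split => //.
  apply: le_trans PA _; rewrite lee_fin ler_pdivrMr // ler_peMr // ltW //.
move=> w /hA hw; rewrite normrM.
apply: (@le_trans _ _ ((`|a| + 1) * (e / (`|a| + 1)))).
  by apply: ler_pM => //; rewrite lerDl.
by rewrite mulrC divfK // gt_eqF.
Qed.

Lemma vanishing_approx (Z : nat -> Omega -> R) :
  (forall e : R, 0 < e -> exists2 Z', vanishing Z' &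
    \forall n \near \oo, exists A : set Omega,
      [/\ measurable A, (P A <= e%:E)%E &
      forall w, ~ A w -> `|Z n w - Z' n w| <= e]) ->
  vanishing Z.
Proof.
move=> h e e0; have e2 : 0 < e / 2 by rewrite divr_gt0.
have [Z' vZ' hZ] := h _ e2.
apply: filterS2 (vZ' _ e2) hZ => n [A [mA PA hA]] [B [mB PB hB]].
exists (A `|` B); split; first exact: measurableU.
  apply: le_trans (measureU2 _ mA mB) _.
  by rewrite [e]splitr EFinD; exact: leeD.
move=> w /not_orP[nA nB]; rewrite [e]splitr -[Z n w](subrK (Z' n w)).
by apply: le_trans (ler_normD _ _) _; apply: lerD; [exact: hB|exact: hA].
Qed.

End vanishing.

(** * Smoothed bounds for the Gaussian distribution function *)

Section gaussian_cdf.
Context {R : realType}.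
Implicit Types (t V e : R).

Let F V t : \bar R := gaussian 0 V [set s : R | s <= t].

Lemma gaussian_cdf_pos V t : 0 < V -> F V t = (Phi (t / Num.sqrt V))%:E.
Proof.
move=> V0; rewrite /F /gaussian gt_eqF // set_le_itv.
by apply: normal_cdf_Phi; rewrite sqrtr_gt0.
Qed.

Lemma gaussian_cdf0 t : F 0 t = (if 0 <= t then 1 else 0)%:E.
Proof.
rewrite /F /gaussian eqxx.
transitivity (\d_(0 : measurableTypeR R) [set s : R | s <= t] : \bar R) => //.
rewrite diracE; congr (_%:E).
by case: ifP => h; [rewrite mem_set|rewrite memNset //= h].
Qed.

(** Rules out [t = 0] in the degenerate case [V = 0], the point where the lower half of the sandwich
    fails. *)
Lemma dirac_cdf_discontinuous : ~ {for (0 : R), continuous (F 0)}.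
Proof.
rewrite /prop_for /continuous_at gaussian_cdf0 lexx => /fine_cvgP[_].
move=> /cvgrPdist_lt /(_ 1 ltr01) /nbhs_normP[r /= r0 hr].
have := hr (- (r / 2)); rewrite /= opprK add0r.
rewrite ger0_norm ?divr_ge0 ?(ltW r0) // ltr_pdivrMr // ltr_pMr // ltr1n.
move=> /(_ isT); rewrite gaussian_cdf0 oppr_ge0 leNgt divr_gt0 //=.
by rewrite subr0 normr1 ltxx.
Qed.

Lemma Phi_tails e : 0 < e -> \forall eta \near (0 : R)^'+,
  Phi (- eta^-1) <= e /\ 1 - e <= Phi (eta^-1).
Proof.
move=> e0.
have [A hA] : exists A, forall x, x < A -> Phi x <= e.
  have := @cvg_Phi_ninfty R => /cvgrPdist_le /(_ _ e0) [A [_ hA]].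
  exists A => x /hA; rewrite sub0r normrN ger0_norm //; exact: Phi_ge0.
have [B hB] : exists B, forall x, B < x -> 1 - e <= Phi x.
  have := @cvg_Phi_pinfty R => /cvgrPdist_le /(_ _ e0) [B [_ hB]].
  exists B => x /hB; rewrite ger0_norm ?subr_ge0 ?Phi_le1 //.
  by rewrite lerBlDr lerBlDl.
pose C := 1 + `|A| + `|B|.
have C0 : 0 < C by rewrite !ltr_pwDl.
near=> eta.
have eta0 : 0 < eta by [].
have etaC : C < eta^-1.
  rewrite -[C]invrK ltf_pV2 ?posrE ?invr_gt0 //.
  by near: eta; apply: nbhs_right_lt; rewrite invr_gt0.
have A1 := ler_norm (- A); have B1 := ler_norm B; rewrite normrN in A1.
have nA : 0 <= `|A| by []. have nB : 0 <= `|B| by [].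
split; [apply: hA; rewrite ltrNl|apply: hB]; apply: le_lt_trans etaC.
  by rewrite /C; lra.
by rewrite /C; lra.
Unshelve. all: by end_near.
Qed.

(** The smoothing variance is [eta ^ 4], hence the standard deviation [eta ^ 2]: at distance [eta]
    from its centre the kernel takes the values [Phi (- eta^-1)] and [Phi (eta^-1)]. Of the shift
    [2 * eta], one [eta] pays for this transition and the other for a perturbation of the statistic
    by at most [eta]. The last two bounds compare the limits of the smoothed probabilities with the
    target. *)
Lemma gaussian_sandwich V t e : 0 <= V -> 0 < e ->
  {for t, continuous (F V)} ->
  exists eta : R, [/\ 0 < eta <= e, 1 - e <= Phi (eta^-1),
    Phi (- eta^-1) <= e,
    Phi ((t + 2 * eta) / Num.sqrt (eta ^+ 4 + V)) <= fine (F V t) + e &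
    fine (F V t) - e <= Phi ((t - 2 * eta) / Num.sqrt (eta ^+ 4 + V))].
Proof.
move=> V0 e0 ct; have [Veq|Vn] := eqVneq V 0.
  rewrite Veq in ct *.
  have tn : t != 0.
    by apply/eqP => t0; rewrite t0 in ct; exact: dirac_cdf_discontinuous ct.
  (* With [eta < |t| / 4], the shifted points [t - 2 * eta] and [t + 2 * eta] keep the sign of [t]
     and stay farther than [eta] from 0. *)
  have tt : 0 < `|t| / 4 by rewrite divr_gt0 // normr_gt0.
  near (0 : R)^'+ => eta.
  have eta0 : 0 < eta by [].
  have etat : eta < `|t| / 4 by near: eta; exact: nbhs_right_lt.
  have [h1 h2] : Phi (- eta^-1) <= e /\ 1 - e <= Phi (eta^-1).
    by near: eta; exact: Phi_tails.
  have etae : eta <= e by near: eta; exact: nbhs_right_le.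
  exists eta; rewrite eta0 etae addr0 gaussian_cdf0.
  have -> : Num.sqrt (eta ^+ 4) = eta ^+ 2.
    rewrite (_ : eta ^+ 4 = (eta ^+ 2) ^+ 2); last by rewrite -exprM.
    by rewrite sqrtr_sqr ger0_norm ?sqr_ge0.
  have e2 : 0 < eta ^+ 2 by rewrite exprn_gt0.
  have key : eta^-1 * eta ^+ 2 = eta by rewrite expr2 mulKf // gt_eqF.
  case: (ltrgtP 0 t) tn etat => // t0 _;
    [rewrite gtr0_norm //|rewrite ltr0_norm //] => etat; split => //=.
  - by apply: le_trans (Phi_le1 _) _; rewrite lerDl ltW.
  - apply: le_trans h2 _; apply: Phi_homo; rewrite ler_pdivlMr // key; lra.
  - rewrite add0r; apply: le_trans h1; apply: Phi_homo.
    rewrite ler_pdivrMr // mulNr key; lra.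
  - by apply: le_trans (Phi_ge0 _); rewrite sub0r oppr_le0 ltW.
have Vp : 0 < V by rewrite lt_def Vn.
rewrite gaussian_cdf_pos //=.
have lim (c : R) : Phi ((t + c * eta) / Num.sqrt (eta ^+ 4 + V))
    @[eta --> (0 : R)^'+] --> Phi (t / Num.sqrt V).
  apply: (cvg_comp (fun eta => (t + c * eta) / Num.sqrt (eta ^+ 4 + V)) (@Phi R));
    last exact: continuous_Phi.
  have h0 : eta @[eta --> (0 : R)^'+] --> (0 : R) by exact: cvg_at_right_filter.
  apply: cvgM.
    rewrite -[X in _ --> X]addr0 -[X in _ --> _ + X](mulr0 c).
    by apply: cvgD; [exact: cvg_cst|apply: cvgM => //; exact: cvg_cst].
  apply: cvgV; first by rewrite gt_eqF // sqrtr_gt0.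
  apply: (cvg_comp (fun eta => eta ^+ 4 + V) Num.sqrt); last exact: sqrt_continuous.
  suff : eta ^+ 4 + V @[eta --> (0 : R)^'+] --> (0 : R) ^+ 4 + V.
    by rewrite expr0n /= add0r.
  apply: cvgD; last exact: cvg_cst.
  exact: (cvg_comp _ _ h0 (@exprn_continuous R 4 0)).
have /cvgrPdist_le /(_ e e0) l1 := lim 2.
have /cvgrPdist_le /(_ e e0) l2 := lim (- 2).
near (0 : R)^'+ => eta.
exists eta.
have [h1 h2] : Phi (- eta^-1) <= e /\ 1 - e <= Phi (eta^-1).
  by near: eta; exact: Phi_tails.
have etae : eta <= e by near: eta; exact: nbhs_right_le.
have a1 : `|Phi (t / Num.sqrt V) - Phi ((t + 2 * eta) / Num.sqrt (eta ^+ 4 + V))| <= e.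
  by near: eta.
have a2 : `|Phi (t / Num.sqrt V) -
    Phi ((t + -2 * eta) / Num.sqrt (eta ^+ 4 + V))| <= e.
  by near: eta.
split => //; first by rewrite etae andbT.
  by move: a1; rewrite ler_distl => /andP[]; lra.
by rewrite -mulNr; move: a2; rewrite ler_distl => /andP[]; lra.
Unshelve. all: by end_near.
Qed.

End gaussian_cdf.

Section sandwich_arithmetic.
Context {R : realType}.

(** Here and in the next lemma, [s] indicates that the statistic is at most [t], [b] indicates the
    exceptional event, and [h] is the smoothed indicator. *)
Lemma indicator_le (h e : R) (s b : bool) : 0 <= h -> 0 < e ->
  (s -> ~~ b -> 1 - e <= h) -> s%:R <= h + b%:R + e.
Proof.
by case: s b => [] [] h0 e0 /= H; lra.
Qed.

Lemma le_indicator (h e : R) (s b : bool) : h <= 1 -> 0 < e ->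
  (~~ s -> ~~ b -> h <= e) -> h <= s%:R + b%:R + e.
Proof.
by case: s b => [] [] h0 e0 /= H; lra.
Qed.

Lemma shift_up (z a t eta : R) : `|z - a| <= eta -> z <= t ->
  eta <= t + 2 * eta - a.
Proof. by rewrite ler_norml => /andP[]; lra. Qed.

Lemma shift_low (z a t eta : R) : `|z - a| <= eta -> t < z ->
  t - 2 * eta - a <= - eta.
Proof. by rewrite ler_norml => /andP[]; lra. Qed.

Lemma sandwich_distance (f p pb e qu ql iu il : R) :
  `|qu - iu| <= e / 4 -> `|ql - il| <= e / 4 ->
  p <= iu + pb + e / 4 -> il <= p + pb + e / 4 ->
  qu <= f + e / 4 -> f - e / 4 <= ql -> pb <= e / 4 -> `|f - p| <= e.
Proof.
rewrite !ler_distl => /andP[? ?] /andP[? ?] ? ? ? ? ?.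
by apply/andP; split; lra.
Qed.

End sandwich_arithmetic.

Section central_limit_theorem.
Context {dO d : measure_display} {Omega : measurableType dO}
  {T : measurableType d} {R : realType} (P : probability Omega R)
  (W : {RV P >-> T}) (Ws : nat -> {RV P >-> T}).
Hypothesis iid : iid_copies W Ws.
Let data n := sample (fun i => Ws i : Omega -> T) n.
Variable psi : T -> R.
Hypothesis mpsi : measurable_fun setT psi.
Hypothesis psi2 : L2 P (fun w => psi (W w)).
Hypothesis psi0 : \int[P]_w psi (W w) = 0.
Let V := \int[P]_w (psi (W w) ^+ 2).

Let A n w := (\sum_(i < n) psi (tnth (data n w) i)) / Num.sqrt n%:R.

(** The central limit theorem and Slutsky's lemma in one argument: the sandwich admits any [Z]
    within [eta] of the normalized sum off a set of probability at most [eta], so the perturbed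
    statistic is compared with the smoothed sum directly. *)
Lemma clt_slutsky (Z : nat -> Omega -> R) :
  (forall n, measurable_fun setT (Z n)) ->
  vanishing P (fun n w => Z n w - A n w) ->
  cvg_in_dist P Z (gaussian 0 V).
Proof.
move=> mZ ZA F t ct.
have V0 : 0 <= V by apply: Rintegral_ge0 => w _; exact: sqr_ge0.
have mA n : measurable_fun setT (A n).
  apply: measurable_funM => //.
  apply: (measurableT_comp (f := fun s : n.-tuple T => \sum_(i < n) psi (tnth s i))
    (g := data n)); last exact: measurable_sample.
  apply: measurable_sum => i; apply: (measurableT_comp mpsi).
  exact: measurable_tnth.
have mS n : measurable [set w | Z n w <= t].
  rewrite (_ : [set w | _] = Z n @^-1` `]-oo, t]%classic); last first.
    by apply/seteqP; split=> w; rewrite /= in_itv.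
  by rewrite -[X in measurable X]setTI; exact: mZ.
have Ffin : F t \is a fin_num.
  by apply: fin_num_measure; rewrite set_le_itv.
rewrite -(fineK Ffin); apply/fine_cvgP; split.
  by apply: nearW => n; exact: fin_num_measure.
apply/cvgrPdist_le => e e0.
have e4 : 0 < e / 4 by rewrite divr_gt0.
have [eta [/andP[eta0 etae] up lo hup hlo]] := gaussian_sandwich V0 e4 ct.
set f := fine (F t) in hup hlo *.
have v0 : 0 < eta ^+ 4 by rewrite exprn_gt0.
have sq4 : Num.sqrt (eta ^+ 4) = eta ^+ 2.
  rewrite (_ : eta ^+ 4 = (eta ^+ 2) ^+ 2); last by rewrite -exprM.
  by rewrite sqrtr_sqr ger0_norm ?sqr_ge0.
have en0 : eta != 0 by rewrite gt_eqF.
have e20 : 0 < eta ^+ 2 by rewrite exprn_gt0.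
have key : eta^-1 * eta ^+ 2 = eta by rewrite expr2 mulKf.
have cu : \int[P]_w heat (t + 2 * eta) (A n w) (eta ^+ 4) @[n --> \oo]
    --> heat (t + 2 * eta) 0 (eta ^+ 4 + V).
  exact: (smooth_clt iid mpsi psi2 psi0).
have cl : \int[P]_w heat (t - 2 * eta) (A n w) (eta ^+ 4) @[n --> \oo]
    --> heat (t - 2 * eta) 0 (eta ^+ 4 + V).
  exact: (smooth_clt iid mpsi psi2 psi0).
move/cvgrPdist_le : cu => /(_ _ e4) cu.
move/cvgrPdist_le : cl => /(_ _ e4) cl.
apply: filterS3 (ZA _ eta0) cu cl => n [B [mB PB hB]] Cu Cl.
have heat0 a v : heat a 0 v = Phi (a / Num.sqrt v) by rewrite /heat subr0.
rewrite heat0 in Cu; rewrite heat0 in Cl.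
set S := [set w | Z n w <= t].
have PE (D : set Omega) : measurable D ->
    \int[P]_w \1_D w = fine (P D).
  by move=> mD; rewrite /Rintegral integral_indic // setIT.
have i1 (D : set Omega) : measurable D -> L1 P (\1_D : Omega -> R).
  by move=> mD; exact: integrable_indic.
have ih a : L1 P (fun w => heat a (A n w) (eta ^+ 4)).
  apply: (@L1_bounded _ _ _ _ _ 1); first exact: measurable_heat.
  by move=> w; exact: heat_norm_le1.
have PBr : fine (P B) <= eta by rewrite -lee_fin fineK // fin_num_measure.
have iS := i1 _ (mS n); have iB := i1 _ mB; rewrite -/S in iS.
have sumE f1 f2 : L1 P f1 -> L1 P f2 ->
    \int[P]_w (f1 w + f2 w + e / 4) =
    \int[P]_w f1 w + \int[P]_w f2 w + e / 4.
  move=> h1 h2; rewrite RintegralD //; last 2 first.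
  - exact: L1D.
  - exact: L1_cst.
  by rewrite RintegralD // Rintegral_prob_cst.
have U : fine (P S) <= \int[P]_w heat (t + 2 * eta) (A n w) (eta ^+ 4)
    + fine (P B) + e / 4.
  rewrite -(PE S (mS n)) -(PE B mB) -sumE //.
  apply: le_Rintegral => //; first by apply: L1D (L1_cst _ _); exact: L1D.
  move=> w _; rewrite !indicE.
  apply: indicator_le => //; first exact: Phi_ge0.
  rewrite !inE => wS /negP; rewrite inE => wB.
  apply: (le_trans up); apply: Phi_homo; rewrite sq4 ler_pdivlMr // key.
  exact: shift_up (hB _ wB) wS.
have Lo : \int[P]_w heat (t - 2 * eta) (A n w) (eta ^+ 4) <=
    fine (P S) + fine (P B) + e / 4.
  rewrite -(PE S (mS n)) -(PE B mB) -sumE //.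
  apply: le_Rintegral => //; first exact: ih.
    by apply: L1D (L1_cst _ _); exact: L1D.
  move=> w _; rewrite !indicE.
  apply: le_indicator => //; first exact: Phi_le1.
  move=> /negP; rewrite inE => /negP; rewrite -ltNge => wS.
  move=> /negP; rewrite inE => wB.
  apply: le_trans lo; apply: Phi_homo; rewrite sq4 ler_pdivrMr // mulNr key.
  exact: shift_low (hB _ wB) wS.
change (`|f - fine (P S)| <= e).
apply: (sandwich_distance Cu Cl U Lo hup hlo).
exact: le_trans PBr etae.
Qed.

End central_limit_theorem.

(** * Weak laws of large numbers *)

Section weak_law.
Context {dO d : measure_display} {Omega : measurableType dO}
  {T : measurableType d} {R : realType} (P : probability Omega R)
  (W : {RV P >-> T}) (Ws : nat -> {RV P >-> T}).
Hypothesis iid : iid_copies W Ws.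
Let data n := sample (fun i => Ws i : Omega -> T) n.

Definition sample_mean (f : T -> R) (n : nat) (w : Omega) : R :=
  n%:R^-1 * \sum_(i < n) f (tnth (data n w) i).

Lemma measurable_sample_mean f n : measurable_fun setT f ->
  measurable_fun setT (sample_mean f n).
Proof.
move=> mf; apply: measurable_funM => //.
apply: (measurableT_comp (f := fun s : n.-tuple T => \sum_(i < n) f (tnth s i))
  (g := data n)); last exact: measurable_sample.
apply: measurable_sum => i; apply: (measurableT_comp mf).
exact: measurable_tnth.
Qed.

Lemma measurable_snd_comp n (f : T -> R) : measurable_fun setT f ->
  measurable_fun setT (fun p : n.-tuple T * T => f p.2).
Proof. by move=> mf; apply: measurableT_comp => //; exact: measurable_snd. Qed.

Lemma sum_setT n (F : 'I_n -> R) : \sum_(i in [set: 'I_n]%SET) F i = \sum_(i < n) F i.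
Proof. by apply: eq_bigl => i; rewrite inE. Qed.

(** The whole sample serves as a single fold: a summand that ignores the data is determined off any
    fold, and the second-moment bound for fold sums applies. *)
Lemma weak_law_L2 (f : T -> R) : measurable_fun setT f ->
  L2 P (fun w => f (W w)) -> \int[P]_w f (W w) = 0 ->
  vanishing P (sample_mean f).
Proof.
move=> mf f2 f0; apply: vanishing_sqr.
set c := \int[P]_w (f (W w) ^+ 2).
apply: (@ge0_vanishing _ _ _ _ _ (fun n => c / n%:R)).
- by move=> n; apply: measurable_funX; exact: measurable_sample_mean.
- by move=> n w; exact: sqr_ge0.
- move=> n.
  have ind := fold_sum_second_moment iid (J := [set: 'I_n]%SET)
    (r := fun _ => f) (c := c) (measurable_snd_comp mf) (fun _ _ _ => erefl)
    (fun _ => f0).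
  have {}ind := ind (fun _ => _); rewrite cardsT card_ord in ind.
  under eq_integral do rewrite exprMn EFinM.
  rewrite ge0_integralZl_EFin ?sqr_ge0 //; last 2 first.
  + by move=> w _; rewrite lee_fin sqr_ge0.
  + apply/measurable_EFinP; apply: measurable_funX.
    apply: (measurableT_comp (f := fun s : n.-tuple T =>
      \sum_(i < n) f (tnth s i)) (g := data n)); last exact: measurable_sample.
    apply: measurable_sum => i; apply: (measurableT_comp mf).
    exact: measurable_tnth.
  apply: (@le_trans _ _ ((n%:R^-1 ^+ 2)%:E * (n%:R * c)%:E)%E).
    apply: lee_wpmul2l; first by rewrite lee_fin sqr_ge0.
    under eq_integral do rewrite -sum_setT.
    by apply: ind; rewrite L1_EFin //; exact: L2_L1_sqr.
  rewrite -EFinM lee_fin; case: n {ind} => [|n].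
    by rewrite invr0 !(mul0r, mulr0, expr0n).
  by rewrite expr2 -mulrA mulKf ?pnatr_eq0 // mulrC.
- rewrite -[X in _ --> X](mulr0 c); apply: cvgM; first exact: cvg_cst.
  apply/gtr0_cvgV0; last exact: cvgr_idn.
  by near=> n; rewrite ltr0n; near: n; exact: nbhs_infty_gt.
Unshelve. all: by end_near.
Qed.

Lemma truncation_tail (f : T -> R) : measurable_fun setT f ->
  (forall x, 0 <= f x) -> L1 P (fun w => f (W w)) ->
  \int[P]_w (f (W w) - Num.min (f (W w)) n%:R) @[n --> \oo] --> (0 : R).
Proof.
move=> mf f0 f1.
have mW := L1_measurable f1.
pose F n w := (f (W w) - Num.min (f (W w)) n%:R)%:E.
have F0 n w : 0 <= f (W w) - Num.min (f (W w)) (n%:R : R).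
  by rewrite subr_ge0 ge_min lexx.
have mF n : measurable_fun setT (F n).
  apply/measurable_EFinP; apply: measurable_funB => //.
  exact: measurable_minr.
have := @dominated_cvg _ _ _ P setT measurableT F (cst 0%E)
  (fun w => (f (W w))%:E) mF.
rewrite integral0 => H.
apply: fine_cvg; apply: H.
- move=> w _; apply: cvg_near_cst; near=> n.
  rewrite /F (min_idPl _) ?subrr //.
  by near: n; exact: nbhs_infty_ger.
- by [].
- exact: f1.
- move=> n w _; rewrite gee0_abs ?lee_fin // lerBlDl lerDr.
  by rewrite le_min f0 ler0n.
Unshelve. all: by end_near.
Qed.

(** Needed for the square of the influence function, which is merely integrable. Truncation at [K]
    leaves a bounded function, covered by [weak_law_L2]; the sample mean of the tail is controlled
    by Markov's inequality. *)
Lemma weak_law_L1 (f : T -> R) : measurable_fun setT f ->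
  (forall x, 0 <= f x) -> L1 P (fun w => f (W w)) ->
  vanishing P (fun n w => sample_mean f n w - \int[P]_w f (W w)).
Proof.
move=> mf f0 f1; apply: vanishing_approx => e e0.
have e2 : 0 < e / 2 by rewrite divr_gt0.
(* The tail mean [tau] has to meet two bounds: [e / 2] for its share of the centring, and
   [e / 2 * e] so that Markov's inequality at level [e / 2] costs probability at most [e]. *)
have m0 : 0 < Num.min (e / 2) (e / 2 * e) by rewrite lt_min e2 mulr_gt0.
have := truncation_tail mf f0 f1 => /cvgrPdist_le /(_ _ m0) [K _ /(_ K (leqnn K))].
rewrite sub0r normrN => hK.
pose fK x := Num.min (f x) (K%:R : R); pose gK x := f x - fK x.
have mfK : measurable_fun setT fK by exact: measurable_minr.
have mgK : measurable_fun setT gK by exact: measurable_funB.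
have g0 x : 0 <= gK x by rewrite subr_ge0 ge_min lexx.
have fK0 x : 0 <= fK x by rewrite le_min f0 ler0n.
have mW (g : T -> R) : measurable_fun setT g -> measurable_fun setT (fun w => g (W w)).
  by move=> mg; apply: measurableT_comp => //; exact: measurable_funPT.
have LfK : L1 P (fun w => fK (W w)).
  apply: (@L1_bounded _ _ _ _ _ K%:R); first exact: mW.
  by move=> w; rewrite ger0_norm // ge_min lexx orbT.
have LgK : L1 P (fun w => gK (W w)) by exact: L1B.
set mu := \int[P]_w fK (W w); set tau := \int[P]_w gK (W w).
have tau0 : 0 <= tau by apply: Rintegral_ge0 => w _; exact: g0.
have tauE : tau <= Num.min (e / 2) (e / 2 * e).
  by move: hK; rewrite ger0_norm.
have muE : \int[P]_w f (W w) = mu + tau.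
  rewrite -RintegralD //; apply: eq_Rintegral => w _.
  by rewrite /gK addrC subrK.
exists (sample_mean (fun x => fK x - mu)).
  apply: weak_law_L2; first exact: measurable_funB.
    apply: L2B (L2_cst _ _); split; first exact: mW.
    apply: (@le_lt_trans _ _ (\int[P]_w ((K%:R : R) ^+ 2)%:E)%E).
      apply: ge0_le_integral => //.
      - by move=> w _; rewrite lee_fin sqr_ge0.
      - by apply/measurable_EFinP; apply: measurable_funX; exact: mW.
      - move=> w _; rewrite lee_fin lerXn2r ?nnegrE ?ler0n //.
        by rewrite ge_min lexx orbT.
    by rewrite integral_cst //= probability_setT mule1 ltry.
  rewrite RintegralB // ?Rintegral_prob_cst ?subrr //; exact: L1_cst.
exists 1%N => // n /= n0; exists [set w | e / 2 <= sample_mean gK n w].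
have nR : n%:R != 0 :> R by rewrite pnatr_eq0 -lt0n.
have mS : measurable [set w | e / 2 <= sample_mean gK n w].
  rewrite -[X in measurable X]setTI.
  rewrite (_ : [set w | _] = sample_mean gK n @^-1` `[e / 2, +oo[%classic).
    exact: measurable_sample_mean.
  by apply/seteqP; split=> w; rewrite /= in_itv /= andbT.
have sm0 w : 0 <= sample_mean gK n w.
  by rewrite mulr_ge0 ?invr_ge0 // sumr_ge0.
have decomp w : sample_mean f n w - \int[P]_w f (W w) -
    sample_mean (fun x => fK x - mu) n w =
    sample_mean gK n w - tau.
  rewrite /sample_mean muE /gK !sumrB sumr_const card_ord.
  by rewrite -[mu *+ n]mulr_natl; field.
split => //.
- have mk := markov_ge0 P (measurable_sample_mean n mgK) sm0 e2.
  apply: le_trans mk _.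
  rewrite lee_pdivrMl // -EFinM.
  apply: (@le_trans _ _ tau%:E); last first.
    by rewrite lee_fin; apply: le_trans tauE _; rewrite ge_min lexx orbT.
  under eq_integral do rewrite EFinM.
  rewrite ge0_integralZl_EFin ?invr_ge0 //; last 2 first.
  + by move=> w _; rewrite lee_fin sumr_ge0.
  + apply/measurable_EFinP.
    apply: (measurableT_comp (f := fun s : n.-tuple T =>
      \sum_(i < n) gK (tnth s i)) (g := data n)); last exact: measurable_sample.
    apply: measurable_sum => i; apply: (measurableT_comp mgK).
    exact: measurable_tnth.
  have ind := fold_sum_first_moment iid (J := [set: 'I_n]%SET)
    (r := fun _ => gK) (c := tau) (measurable_snd_comp mgK) (fun _ _ _ => erefl)
    (fun _ => g0).
  rewrite cardsT card_ord in ind.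
  apply: (@le_trans _ _ (n%:R^-1%:E * (n%:R * tau)%:E)%E).
    apply: lee_wpmul2l; first by rewrite lee_fin invr_ge0.
    under eq_integral do rewrite -sum_setT.
    by apply: ind; rewrite L1_EFin.
  by rewrite -EFinM lee_fin mulKf.
- move=> w /negP; rewrite -ltNge => lt; rewrite decomp.
  rewrite [e]splitr; apply: le_trans (ler_normB _ _) _.
  rewrite (ger0_norm tau0) ger0_norm //; apply: lerD; first exact: ltW.
  by apply: le_trans tauE _; rewrite ge_min lexx.
Qed.

End weak_law.

(** * Nuisance perturbations *)

Section conditioning.
Context {dO dx : measure_display} {Omega : measurableType dO}
  {Xt : measurableType dx} {R : realType} (P : probability Omega R)
  (X : Omega -> Xt).
Hypothesis mX : measurable_fun setT X.
Import HBNNSimple.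

Let mpre (A : set Xt) : measurable A -> measurable (X @^-1` A).
Proof. by move=> mA; rewrite -[X in measurable X]setTI; exact: mX. Qed.

Lemma integral_nnsfun_comp (Z : Omega -> R) (g : {nnsfun Xt >-> R}) :
  measurable_fun setT Z -> (forall w, 0 <= Z w) ->
  (\int[P]_w (g (X w) * Z w)%:E =
   \sum_(k \in range g) (k%:E *
     \int[P]_(w in X @^-1` (g @^-1` [set k])) (Z w)%:E))%E.
Proof.
move=> mZ Z0.
have mA k : measurable (g @^-1` [set k]) by exact: measurable_sfunP.
transitivity (\sum_(k \in range g)
    \int[P]_w ((k * \1_(g @^-1` [set k]) (X w)) * Z w)%:E)%E.
  rewrite -ge0_integral_fsum //; last 2 first.
  - move=> k; apply/measurable_EFinP; apply: measurable_funM => //.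
    apply: measurable_funM => //.
    by apply: (measurableT_comp _ mX); exact: measurable_indic.
  - move=> k w _; rewrite EFinM mule_ge0 ?lee_fin //.
    by rewrite -lee_fin EFinM; exact: nnfun_muleindic_ge0.
  apply: eq_integral => w _.
  rewrite fsumEFin //; congr EFin.
  by rewrite fimfunE !fsbig_finite //= big_distrl.
apply: eq_fsbigr => k; rewrite inE => -[x _ kE].
have k0 : 0 <= k by rewrite -kE.
under eq_integral do rewrite -mulrA EFinM.
rewrite ge0_integralZl_EFin //; last 2 first.
- by move=> w _; rewrite lee_fin mulr_ge0.
- apply/measurable_EFinP; apply: measurable_funM => //.
  by apply: (measurableT_comp _ mX); exact: measurable_indic.
congr (_ * _)%E; rewrite [RHS]integral_mkcond; apply: eq_integral => w _.
rewrite patchE indicE -[w \in _]/(X w \in g @^-1` [set k]).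
by case: (X w \in _); rewrite ?mul1r ?mul0r.
Qed.

(** A simple [h] reduces to events generated by [X], and monotone convergence does the rest. As an
    inequality it serves both the conditional mean, where it is applied in the two directions, and
    the conditional variance bound. *)
Lemma le_integral_comp (Z1 Z2 : Omega -> R) (h : Xt -> R) :
  measurable_fun setT Z1 -> (forall w, 0 <= Z1 w) ->
  measurable_fun setT Z2 -> (forall w, 0 <= Z2 w) ->
  (forall A, measurable A -> (\int[P]_(w in X @^-1` A) (Z1 w)%:E <=
    \int[P]_(w in X @^-1` A) (Z2 w)%:E)%E) ->
  measurable_fun setT h -> (forall x, 0 <= h x) ->
  (\int[P]_w (h (X w) * Z1 w)%:E <= \int[P]_w (h (X w) * Z2 w)%:E)%E.
Proof.
move=> mZ1 Z10 mZ2 Z20 Z12 mh h0.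
have mEh : measurable_fun setT (EFin \o h) by exact/measurable_EFinP.
pose g := nnsfun_approx measurableT mEh.
have lim (Z : Omega -> R) : measurable_fun setT Z -> (forall w, 0 <= Z w) ->
    (\int[P]_w (g n (X w) * Z w)%:E)%E @[n --> \oo] -->
    (\int[P]_w (h (X w) * Z w)%:E)%E.
  move=> mZ Z0.
  have := @cvg_monotone_convergence _ _ _ P setT measurableT
    (fun n w => (g n (X w) * Z w)%:E).
  rewrite (_ : (fun w => limn _) = fun w => (h (X w) * Z w)%:E).
    apply.
    - move=> n; apply/measurable_EFinP; apply: measurable_funM => //.
      by apply: (measurableT_comp _ mX); exact: measurable_funPT.
    - by move=> n w _; rewrite lee_fin mulr_ge0.
    - move=> w _ n k nk; rewrite lee_fin ler_wpM2r //.
      exact/lefP/nd_nnsfun_approx.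
  apply/funext => w; apply/cvg_lim => //.
  apply: cvg_EFin; first exact: nearW.
  apply: cvgM; last exact: cvg_cst.
  have : (EFin \o g ^~ (X w)) n @[n --> \oo] --> (h (X w))%:E.
    by apply: (cvg_nnsfun_approx _ mEh) => // x _; rewrite lee_fin.
  by move/fine_cvg.
rewrite -(cvg_lim _ (lim _ mZ1 Z10)) // -(cvg_lim _ (lim _ mZ2 Z20)) //.
apply: lee_lim; [exact/cvgP/lim|exact/cvgP/lim|].
apply: nearW => n; rewrite !integral_nnsfun_comp //.
apply: lee_fsum => // k [x _ kE].
apply: lee_wpmul2l; first by rewrite lee_fin -kE.
by apply: Z12; exact: measurable_sfunP.
Qed.

Lemma L2_comp_measurable (g : Xt -> R) : measurable_fun setT g ->
  measurable_fun setT (fun w => g (X w)).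
Proof. by move=> mg; apply: measurableT_comp. Qed.

(* [e + |e|] and [|e|] have the same integral over every [X]-measurable event. *)
Lemma Rintegral_cond_centered (e : Omega -> R) (g : Xt -> R) :
  L2 P e -> measurable_fun setT g -> L2 P (fun w => g (X w)) ->
  (forall A, measurable A -> (\int[P]_(w in X @^-1` A) (e w)%:E = 0)%E) ->
  \int[P]_w (g (X w) * e w) = 0.
Proof.
move=> e2 mg g2 eA.
have [me _] := e2; have e1 := L2_L1 e2.
have ae2 : L2 P (fun w => `|e w|).
  apply: (L2_le _ _ e2) => [|w]; last by rewrite normr_id.
  exact: measurableT_comp.
pose Z1 w : R := e w + `|e w|; pose Z2 w : R := `|e w|.
have Z10 w : 0 <= Z1 w.
  by rewrite /Z1 addrC -lerBlDr sub0r -normrN; exact: ler_norm.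
have Z20 w : 0 <= Z2 w by exact: normr_ge0.
have mZ2 : measurable_fun setT Z2 by exact: measurableT_comp.
have mZ1 : measurable_fun setT Z1 by exact: measurable_funD.
have Z12 A : measurable A -> (\int[P]_(w in X @^-1` A) (Z1 w)%:E =
    \int[P]_(w in X @^-1` A) (Z2 w)%:E)%E.
  move=> mA; under eq_integral do rewrite EFinD.
  rewrite integralD //; last 3 first.
  - exact: mpre.
  - by apply: integrableS e1 => //; exact: mpre.
  - by apply: (integrableS measurableT) => //; [exact: mpre|exact: L2_L1 ae2].
  by rewrite eA // add0e.
have nneg (h : Xt -> R) : measurable_fun setT h -> (forall x, 0 <= h x) ->
    L2 P (fun w => h (X w)) -> \int[P]_w (h (X w) * e w) = 0.
  move=> mh h0 h2.
  have L1e : L1 P (fun w => h (X w) * e w) by exact: L2_L1M.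
  have L1a : L1 P (fun w => h (X w) * `|e w|) by exact: L2_L1M.
  have : \int[P]_w (h (X w) * Z1 w) = \int[P]_w (h (X w) * Z2 w).
    congr fine; apply/eqP; rewrite eq_le; apply/andP; split.
      by apply: le_integral_comp => // A mA; rewrite Z12.
    by apply: le_integral_comp => // A mA; rewrite Z12.
  rewrite /Z1 /Z2; under eq_Rintegral do rewrite mulrDr.
  rewrite RintegralD // => /eqP; rewrite -subr_eq0 addrK => /eqP.
  exact.
have ag2 : L2 P (fun w => `|g (X w)|).
  apply: (L2_le _ _ g2) => [|w]; last by rewrite normr_id.
  by apply: measurableT_comp => //; exact: L2_comp_measurable.
have mag : measurable_fun setT (fun x => `|g x|) by exact: measurableT_comp.
(* The weight is split like the residual, as [g + |g|] minus [|g|]. *)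
have I1 := nneg (fun x => g x + `|g x|) (measurable_funD mg mag).
have I2 := nneg (fun x => `|g x|) mag (fun x => normr_ge0 _) ag2.
have {}I1 : \int[P]_w ((g (X w) + `|g (X w)|) * e w) = 0.
  apply: I1; last exact: L2D.
  by move=> x; rewrite addrC -lerBlDr sub0r -normrN; exact: ler_norm.
have : \int[P]_w (g (X w) * e w + `|g (X w)| * e w) = 0.
  by rewrite -I1; apply: eq_Rintegral => w _; rewrite mulrDl.
rewrite RintegralD //; [|exact: L2_L1M|exact: L2_L1M].
by rewrite I2 addr0.
Qed.

Lemma integral_cond_variance_le (Z : Omega -> R) (sigma2 g : Xt -> R) (S : R) :
  measurable_fun setT Z -> (forall w, 0 <= Z w) -> 0 <= S ->
  measurable_fun setT sigma2 ->
  ae_bounded_by P X sigma2 S ->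
  P.-integrable setT (EFin \o (sigma2 \o X)) ->
  (forall A, measurable A -> (\int[P]_(w in X @^-1` A) (Z w)%:E =
    \int[P]_(w in X @^-1` A) (sigma2 (X w))%:E)%E) ->
  measurable_fun setT g ->
  (\int[P]_w (g (X w) ^+ 2 * Z w)%:E <=
   S%:E * \int[P]_w (g (X w) ^+ 2)%:E)%E.
Proof.
move=> mZ Z0 S0 ms sS is2 ZA mg.
have mg2 : measurable_fun setT (fun x => g x ^+ 2) by exact: measurable_funX.
apply: (@le_trans _ _ (\int[P]_w (g (X w) ^+ 2 * S)%:E)%E).
  apply: (le_integral_comp (h := fun x => g x ^+ 2)) => //; last first.
    by move=> x; exact: sqr_ge0.
  move=> A mA; rewrite ZA //.
  (* The version [sigma2] may be negative at some points, while the almost-everywhere comparison is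
     for nonnegative integrands; the absolute value obeys the same bound [S]. *)
  apply: (@le_trans _ _ (\int[P]_(w in X @^-1` A) `|sigma2 (X w)|%:E)%E).
    apply: le_integral.
    - exact: mpre.
    - by apply: integrableS is2 => //; exact: mpre.
    - by apply: integrableS (L1_abs is2) => //; exact: mpre.
    - by move=> w _; rewrite lee_fin ler_norm.
  apply: ae_ge0_le_integral => //.
  - exact: mpre.
  - apply: measurable_funTS; apply/measurable_EFinP.
    by apply: measurableT_comp => //; exact: L2_comp_measurable.
  - by apply: filterS sS => w h _; rewrite lee_fin.
under eq_integral do rewrite mulrC EFinM.
rewrite ge0_integralZl_EFin //.
- by move=> w _; rewrite lee_fin sqr_ge0.
- by apply/measurable_EFinP; exact: (L2_comp_measurable mg2).
Qed.

Lemma ae_bounded_ge0 (g : Xt -> R) (C : R) : ae_bounded_by P X g C -> 0 <= C.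
Proof.
move=> [N [mN PN sub]]; rewrite leNgt; apply/negP => C0.
have : N = setT.
  rewrite -subTset => w _; apply: sub => /= h.
  by have := le_lt_trans h C0; rewrite normr_lt0.
by move=> NT; move: PN; rewrite NT probability_setT => -[] /eqP; rewrite oner_eq0.
Qed.

Lemma integral_ae_bounded_le (a g : Xt -> R) (C : R) :
  measurable_fun setT a -> measurable_fun setT g -> ae_bounded_by P X a C ->
  (\int[P]_w ((a (X w) * g (X w)) ^+ 2)%:E <=
   (C ^+ 2)%:E * \int[P]_w (g (X w) ^+ 2)%:E)%E.
Proof.
move=> ma mg aC.
have mag : measurable_fun setT (fun w => a (X w) * g (X w)).
  by apply: measurable_funM; exact: L2_comp_measurable.
have mg2 : measurable_fun setT (fun w => g (X w) ^+ 2).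
  by apply: measurable_funX; exact: L2_comp_measurable.
rewrite -ge0_integralZl_EFin ?sqr_ge0 //; last 2 first.
- by move=> w _; rewrite lee_fin sqr_ge0.
- exact/measurable_EFinP.
apply: ae_ge0_le_integral => //.
- by move=> w _; rewrite lee_fin sqr_ge0.
- by apply/measurable_EFinP; exact: measurable_funX.
- by move=> w _; rewrite mule_ge0 // lee_fin sqr_ge0.
- by apply/measurable_EFinP; exact: measurable_funM.
apply: filterS aC => w h _; rewrite lee_fin exprMn.
rewrite ler_wpM2r ?sqr_ge0 // -[a (X w) ^+ 2]real_normK ?num_real //.
by rewrite lerXn2r ?nnegrE // (le_trans _ h).
Qed.

End conditioning.

Lemma expectationE {d : measure_display} {T : measurableType d} {R : realType}
  (P : probability T R) (f : T -> R) : ('E_P[f] = \int[P]_w (f w)%:E)%E.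
Proof. by rewrite unlock. Qed.

Lemma l2norm_sqr {dO d : measure_display} {Omega : measurableType dO}
  {T : measurableType d} {R : realType} (P : probability Omega R)
  (W : Omega -> T) (a : T -> R) :
  (l2norm P W a ^+ 2 = \int[P]_w (a (W w) ^+ 2)%:E)%E.
Proof.
rewrite /l2norm expectationE sqr_sqrte //.
by apply: integral_ge0 => w _; rewrite lee_fin sqr_ge0.
Qed.

(** * The influence function and the score error at fixed nuisance functions *)

Section nuisance_perturbation.
Context {dO dw dx : measure_display} {Omega : measurableType dO}
  {Wt : measurableType dw} {Xt : measurableType dx} {R : realType}
  (P : probability Omega R) (W : {RV P >-> Wt})
  (xc : {mfun Wt >-> Xt}) (yc : {mfun Wt >-> R})
  (m : Wt -> (Xt -> R) -> R) (gamma0 sigma02 alpha0 : Xt -> R) (M S : R).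
Let X : Omega -> Xt := fun omega => xc (W omega).
Let Y : Omega -> R := fun omega => yc (W omega).
Let e w := Y w - gamma0 (X w).

Hypothesis m_linear : linear_functional P W xc m.
Hypothesis gamma0_cond : cond_expectation P X Y gamma0.
Hypothesis gamma0_sq : sq_integrable P X gamma0.
Hypothesis alpha0_riesz : riesz_representer P W xc m alpha0.
Hypothesis sigma02_cond :
  cond_expectation P X (fun w => (Y w - gamma0 (X w)) ^+ 2) sigma02.
Hypothesis m_bounded : forall alpha, sq_integrable P X alpha ->
  ('E_P[fun w => (m (W w) alpha ^+ 2)%R] <=
   M%:E * l2norm P W (fun w => alpha (xc w)) ^+ 2)%E.
Hypothesis sigma02_bounded : ae_bounded_by P X sigma02 S.
Hypothesis m_gamma0_sq : ('E_P[fun w => (m (W w) gamma0 ^+ 2)%R] < +oo)%E.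

Let mX : measurable_fun setT X.
Proof. by apply: measurableT_comp => //; exact: measurable_funPT. Qed.

Lemma sq_integrableP (g : Xt -> R) :
  sq_integrable P X g <->
  measurable_fun setT g /\ L2 P (fun w => g (X w)).
Proof.
rewrite /sq_integrable expectationE; split=> -[mg].
  by split => //; split => //; exact: measurableT_comp.
by move=> [].
Qed.

Let e_L2 : L2 P e.
Proof.
have [mg0 _] := gamma0_sq; have [_ i _ _] := sigma02_cond.
apply: L1_sqr_L2 i; apply: measurable_funB; last exact: measurableT_comp.
by apply: measurableT_comp => //; exact: measurable_funPT.
Qed.

Let e_centered A : measurable A -> (\int[P]_(w in X @^-1` A) (e w)%:E = 0)%E.
Proof.
move=> mA; have [mg0 iY ig eq] := gamma0_cond.
have mXA : measurable (X @^-1` A).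
  by rewrite -[X in measurable X]setTI; exact: mX.
rewrite /e; under eq_integral do rewrite EFinB.
rewrite integralB_EFin //; last 2 first.
- by apply: integrableS iY.
- by apply: integrableS ig.
rewrite eq // subee //; apply: integrable_fin_num => //.
by apply: integrableS ig.
Qed.

Let S_ge0 : 0 <= S.
Proof. exact: (ae_bounded_ge0 sigma02_bounded). Qed.

Lemma integral_sqr_residual (a : Xt -> R) : measurable_fun setT a ->
  (\int[P]_w ((a (X w) * e w) ^+ 2)%:E <=
   S%:E * \int[P]_w (a (X w) ^+ 2)%:E)%E.
Proof.
move=> ma; have [ms _ is2 eq] := sigma02_cond.
have [me _] := e_L2.
under eq_integral do rewrite exprMn.
apply: (integral_cond_variance_le mX (sigma2 := sigma02)) => //.
- exact: measurable_funX.
- by move=> w; exact: sqr_ge0.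
Qed.

Lemma residual_L2 (a : Xt -> R) : measurable_fun setT a ->
  L2 P (fun w => a (X w)) -> L2 P (fun w => a (X w) * e w).
Proof.
move=> ma [mXa a2]; split.
  by apply: measurable_funM => //; have [] := e_L2.
apply: le_lt_trans (integral_sqr_residual ma) _.
by apply: lte_mul_pinfty => //; rewrite ?lee_fin ?S_ge0.
Qed.

Lemma residual_mean (a : Xt -> R) : measurable_fun setT a ->
  L2 P (fun w => a (X w)) -> \int[P]_w (a (X w) * e w) = 0.
Proof. by move=> ma a2; exact: (Rintegral_cond_centered mX). Qed.

Definition influence (w : Wt) : R :=
  debiased_score xc yc m gamma0 alpha0 w - theta0 P W m gamma0.

Lemma measurable_debiased_score (g a : Xt -> R) :
  sq_integrable P X g -> measurable_fun setT a ->
  measurable_fun setT (debiased_score xc yc m g a).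
Proof.
move=> sg ma; have [mg _] := sg.
apply: measurable_funD; first exact: m_linear.1.
apply: measurable_funM; first exact: measurableT_comp.
by apply: measurable_funB => //; exact: measurableT_comp.
Qed.

Let m_L2 (g : Xt -> R) : sq_integrable P X g ->
  ('E_P[fun w => (m (W w) g ^+ 2)%R] < +oo)%E -> L2 P (fun w => m (W w) g).
Proof.
rewrite expectationE => sg fin; split => //.
by apply: (measurableT_comp (m_linear.1 _ sg)); exact: measurable_funPT.
Qed.

Lemma measurable_influence : measurable_fun setT influence.
Proof.
apply: measurable_funB => //; apply: measurable_debiased_score => //.
by have [[]] := alpha0_riesz.
Qed.

Lemma influence_L2 : L2 P (fun w => influence (W w)).
Proof.
have [/sq_integrableP[ma a2] _] := alpha0_riesz.
apply: L2B (L2_cst _ _); apply: L2D; first exact: m_L2.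
exact: residual_L2.
Qed.

Lemma influence_mean : \int[P]_w influence (W w) = 0.
Proof.
have [/sq_integrableP[ma a2] _] := alpha0_riesz.
have i1 : L1 P (fun w => m (W w) gamma0) by apply: L2_L1; exact: m_L2.
have i2 : L1 P (fun w => alpha0 (X w) * e w).
  by apply: L2_L1; exact: residual_L2.
rewrite RintegralB //; [|exact: L1D|exact: L1_cst].
rewrite RintegralD // Rintegral_prob_cst residual_mean // addr0.
by rewrite /theta0 expectationE subrr.
Qed.

Lemma influence_variance :
  asymptotic_variance P W xc yc m gamma0 alpha0 =
  \int[P]_w (influence (W w) ^+ 2).
Proof.
rewrite /asymptotic_variance expectationE; congr fine.
apply: eq_integral => w _; congr EFin; congr (_ ^+ 2).
by rewrite /influence /debiased_score addrAC.
Qed.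

Definition score_error (g a : Xt -> R) (w : Wt) : R :=
  debiased_score xc yc m g a w - debiased_score xc yc m gamma0 alpha0 w.

Section fixed_nuisance.
Variables (g a : Xt -> R) (C : R).
Hypothesis mg : measurable_fun setT g.
Hypothesis ma : measurable_fun setT a.
Hypothesis aC : ae_bounded_by P X a C.
Hypothesis dg2 : L2 P (fun w => g (X w) - gamma0 (X w)).
Hypothesis da2 : L2 P (fun w => a (X w) - alpha0 (X w)).
Let dg x := g x - gamma0 x.
Let da x := a x - alpha0 x.

Let mg0 : measurable_fun setT gamma0. Proof. by have [] := gamma0_sq. Qed.
Let ma0 : measurable_fun setT alpha0.
Proof. by have [[]] := alpha0_riesz. Qed.
Let mdg : measurable_fun setT dg. Proof. exact: measurable_funB. Qed.
Let mda : measurable_fun setT da. Proof. exact: measurable_funB. Qed.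

Let dg_sq : sq_integrable P X dg.
Proof. by apply/sq_integrableP. Qed.

Let g_sq : sq_integrable P X g.
Proof.
apply/sq_integrableP; split => //.
have /sq_integrableP[_ g02] := gamma0_sq.
by have := L2D dg2 g02; congr L2; apply/funext => w; rewrite subrK.
Qed.

(** The perturbed [a], and not [alpha0], multiplies [dg]. This absorbs the product [da * dg] and
    leaves three terms, whose second moments are controlled in turn by [m_bounded], by the
    conditional variance bound and by the bound on [a]. *)
Lemma score_errorE w : score_error g a w =
  m w dg + da (xc w) * (yc w - gamma0 (xc w)) - a (xc w) * dg (xc w).
Proof.
have lin := m_linear.2 w 1 (-1) _ _ g_sq gamma0_sq.
have -> : m w dg = m w g - m w gamma0.
  rewrite (_ : dg = fun x => 1 * g x + -1 * gamma0 x); first by rewrite lin; ring.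
  by apply/funext => x; rewrite /dg; ring.
by rewrite /score_error /debiased_score /da /dg; ring.
Qed.

Let m_dg_le : (\int[P]_w (m (W w) dg ^+ 2)%:E <=
  M%:E * \int[P]_w (dg (X w) ^+ 2)%:E)%E.
Proof. by have := m_bounded dg_sq; rewrite expectationE l2norm_sqr. Qed.

Let m_dg_L2 : L2 P (fun w => m (W w) dg).
Proof.
apply: m_L2 => //; rewrite expectationE; apply: le_lt_trans m_dg_le _.
by rewrite L1_EFin ?ltry //; exact: L2_L1_sqr dg2.
Qed.

Let da_e_L2 : L2 P (fun w => da (X w) * e w).
Proof. exact: residual_L2. Qed.

Let a_dg_L2 : L2 P (fun w => a (X w) * dg (X w)).
Proof.
split; first by apply: measurable_funM; exact: measurableT_comp.
apply: le_lt_trans (integral_ae_bounded_le mX ma mdg aC) _.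
by rewrite L1_EFin ?ltry //; exact: L2_L1_sqr dg2.
Qed.

Lemma score_error_L2 : L2 P (fun w => score_error g a (W w)).
Proof.
rewrite (_ : (fun w => _) = fun w => m (W w) dg + da (X w) * e w -
    a (X w) * dg (X w)); last by apply/funext => w; rewrite score_errorE.
by apply: L2B => //; exact: L2D.
Qed.

Lemma score_error_second_moment :
  \int[P]_w (score_error g a (W w) ^+ 2) <=
  3 * (M + C ^+ 2) * \int[P]_w ((g (X w) - gamma0 (X w)) ^+ 2) +
  3 * S * \int[P]_w ((a (X w) - alpha0 (X w)) ^+ 2).
Proof.
set G := \int[P]_w ((g (X w) - gamma0 (X w)) ^+ 2).
set A := \int[P]_w ((a (X w) - alpha0 (X w)) ^+ 2).
have i1 := L2_L1_sqr m_dg_L2; have i2 := L2_L1_sqr da_e_L2.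
have i3 := L2_L1_sqr a_dg_L2.
have b1 : \int[P]_w (m (W w) dg ^+ 2) <= M * G.
  rewrite -lee_fin EFinM /G -!L1_EFin //; exact: L2_L1_sqr dg2.
have b2 : \int[P]_w ((da (X w) * e w) ^+ 2) <= S * A.
  rewrite -lee_fin EFinM /A -!L1_EFin //; last exact: L2_L1_sqr da2.
  exact: integral_sqr_residual.
have b3 : \int[P]_w ((a (X w) * dg (X w)) ^+ 2) <= C ^+ 2 * G.
  rewrite -lee_fin EFinM /G -!L1_EFin //; last exact: L2_L1_sqr dg2.
  exact: integral_ae_bounded_le.
(* The factor 3 comes from [(x + y - z) ^ 2 <= 3 (x ^ 2 + y ^ 2 + z ^ 2)]. *)
apply: (@le_trans _ _ (\int[P]_w (3 * (m (W w) dg ^+ 2 +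
    (da (X w) * e w) ^+ 2 + (a (X w) * dg (X w)) ^+ 2)))).
  apply: le_Rintegral => //; first exact: L2_L1_sqr score_error_L2.
    by apply: L1Z; apply: L1D => //; exact: L1D.
  move=> w _; rewrite score_errorE -/(X w) -/(Y w) -/(e w).
  move: (m _ _) (da _ * _) (a _ * _) => x y z.
  have := sqr_ge0 (x - y); have := sqr_ge0 (x + z); have := sqr_ge0 (y + z).
  nra.
rewrite RintegralZl //; last by apply: L1D => //; exact: L1D.
rewrite RintegralD //; last exact: L1D.
rewrite RintegralD //.
move: b1 b2 b3; move: (\int[P]_w _) (\int[P]_w _) (\int[P]_w _) => x y z.
nra.
Qed.

(* Neyman orthogonality: the first-order terms of the mean cancel. *)
Lemma score_error_mean_sqr :
  (\int[P]_w score_error g a (W w)) ^+ 2 <=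
  \int[P]_w ((g (X w) - gamma0 (X w)) ^+ 2) *
  \int[P]_w ((a (X w) - alpha0 (X w)) ^+ 2).
Proof.
have i1 := L2_L1 m_dg_L2; have i2 := L2_L1 da_e_L2; have i3 := L2_L1 a_dg_L2.
have [/sq_integrableP[_ a02] riesz] := alpha0_riesz.
have i4 : L1 P (fun w => alpha0 (X w) * dg (X w)) by exact: L2_L1M.
have mE : \int[P]_w m (W w) dg = \int[P]_w (alpha0 (X w) * dg (X w)).
  by have := riesz _ dg_sq; rewrite !expectationE => h; congr fine.
have -> : \int[P]_w score_error g a (W w) =
    - \int[P]_w (dg (X w) * da (X w)).
  under eq_Rintegral do rewrite score_errorE.
  rewrite RintegralB //; last exact: L1D.
  rewrite RintegralD // residual_mean // addr0 mE -RintegralB //.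
  rewrite -mulN1r -RintegralZl //; last exact: L2_L1M.
  by apply: eq_Rintegral => w _; rewrite /da; ring.
by rewrite sqrrN; exact: Cauchy_Schwarz.
Qed.

End fixed_nuisance.

End nuisance_perturbation.

(** * Cross-fitting *)

(** Here [S] is a fold sum, [k] the fold size, [b] the conditional mean of a summand and [x] the
    centred sum. Since [k <= n], the drift [k b / sqrt n] is at most [sqrt n] times [b] in absolute
    value. *)
Lemma drift_split (R : realType) (n k : nat) (x b S e : R) :
  (0 < n)%N -> (k%:R <= n%:R :> R) -> S - k%:R * b = x ->
  n%:R^-1 * x ^+ 2 <= e ^+ 2 -> 0 <= e -> `|Num.sqrt n%:R * b| <= e ->
  `|(Num.sqrt n%:R)^-1 * S| <= e + e.
Proof.
move=> n0 kn Sx xe e0 be.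
have q0 : 0 < Num.sqrt (n%:R : R) by rewrite sqrtr_gt0 ltr0n.
have -> : (Num.sqrt n%:R)^-1 * S =
    (Num.sqrt n%:R)^-1 * x + (Num.sqrt n%:R)^-1 * (k%:R * b).
  by rewrite -Sx; ring.
apply: le_trans (ler_normD _ _) _; apply: lerD.
  rewrite -(ler_pXn2r (n := 2)) ?nnegrE // real_normK ?num_real //.
  by rewrite exprMn exprVn sqr_sqrtr.
rewrite !normrM normr_nat gtr0_norm ?invr_gt0 //.
rewrite normrM (gtr0_norm q0) in be; apply: le_trans be.
rewrite mulrA ler_wpM2r // mulrC ler_pdivrMr //.
by rewrite -expr2 sqr_sqrtr.
Qed.

Section conditional_negligibility.
Context {dO d : measure_display} {Omega : measurableType dO}
  {T : measurableType d} {R : realType} (P : probability Omega R)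
  (W : {RV P >-> T}) (Ws : nat -> {RV P >-> T}).
Hypothesis iid : iid_copies W Ws.
Let data n := sample (fun i => Ws i : Omega -> T) n.

(** For some samples the section need not be integrable, so Fubini does not apply; Tonelli for the
    positive and the negative part gives measurability all the same. *)
Lemma measurable_Rintegral_section n (r : n.-tuple T -> T -> R) :
  measurable_fun setT (fun p : n.-tuple T * T => r p.1 p.2) ->
  measurable_fun [set: n.-tuple T] (fun s => \int[P]_w r s (W w)).
Proof.
move=> mr.
have mF : measurable_fun setT (fun p : n.-tuple T * Omega =>
    (r p.1 (W p.2))%:E).
  apply/measurable_EFinP; apply: (measurableT_comp
    (g := fun p : n.-tuple T * Omega => (p.1, W p.2)) mr).
  apply: measurable_fun_pair => //.
  by apply: measurableT_comp => //; exact: measurable_snd.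
apply: (measurableT_comp (f := @fine R)
  (g := fun s => (\int[P]_w (r s (W w))%:E)%E)); first exact: fine_measurable.
have mpos : measurable_fun [set: n.-tuple T]
    (fun s => \int[P]_w (maxe (r s (W w))%:E 0))%E.
  apply: (measurable_fun_fubini_tonelli_F (m2 := P)
    (fun p : n.-tuple T * Omega => maxe (r p.1 (W p.2))%:E 0%E)).
    by apply: measurable_maxe => //; exact: mF.
  by move=> p; rewrite le_max lexx orbT.
have mneg : measurable_fun [set: n.-tuple T]
    (fun s => \int[P]_w (maxe (- (r s (W w))%:E) 0))%E.
  apply: (measurable_fun_fubini_tonelli_F (m2 := P)
    (fun p : n.-tuple T * Omega => maxe (- (r p.1 (W p.2))%:E)%E 0%E)).
    apply: measurable_maxe => //; apply: (measurableT_comp (f := oppe)) => //.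
  by move=> p; rewrite le_max lexx orbT.
have -> : (fun s => \int[P]_w (r s (W w))%:E)%E = (fun s =>
    \int[P]_w (maxe (r s (W w))%:E 0) -
    \int[P]_w (maxe (- (r s (W w))%:E) 0))%E.
  apply/funext => s; rewrite integralE.
  by congr (_ - _)%E; apply: eq_integral => w _; rewrite ?funeposE ?funenegE.
exact: (emeasurable_funB mpos mneg).
Qed.

(* [good eta] is an event on which the second moment of [r] given the sample is
   small; multiplying by its indicator makes the moment bounds unconditional. *)
Variables (J : forall n, {set 'I_n}) (r : forall n, n.-tuple T -> T -> R)
  (good : forall n, R -> set (n.-tuple T)) (K : R).
Arguments r {n}.

Hypothesis mr : forall n,
  measurable_fun setT (fun p : n.-tuple T * T => r p.1 p.2).
Hypothesis r_off : forall n, off_fold (J n) (@r n).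
Hypothesis mgood : forall n eta, measurable (@good n eta).
Hypothesis good_off : forall n eta, off_fold (J n) (@good n eta).
Hypothesis K_ge0 : 0 <= K.
Hypothesis r_L2 : forall n eta (s : n.-tuple T), good eta s ->
  L2 P (fun w => r s (W w)).
Hypothesis r_second_moment : forall n eta (s : n.-tuple T), good eta s ->
  \int[P]_w (r s (W w) ^+ 2) <= K * eta.
Hypothesis good_near : forall e eta : R, 0 < e -> 0 < eta ->
  \forall n \near \oo, exists A : set Omega,
    [/\ measurable A, (P A <= e%:E)%E & forall w, ~ A w -> good eta (data n w)].

Let cut n eta (s : n.-tuple T) : R := \1_(@good n eta) s.

Let cut_good n eta (s : n.-tuple T) : good eta s -> cut eta s = 1.
Proof. by move=> h; rewrite /cut indicE mem_set. Qed.

Let cut_bad n eta (s : n.-tuple T) : ~ good eta s -> cut eta s = 0.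
Proof. by move=> h; rewrite /cut indicE memNset. Qed.

Let mcut n eta : measurable_fun setT (fun p : n.-tuple T * T => cut eta p.1).
Proof.
apply: (measurableT_comp (f := \1_(@good n eta) : _ -> R)).
  by apply: measurable_indic; exact: mgood.
exact: measurable_fst.
Qed.

Let cut_off n eta : off_fold (J n) (@cut n eta).
Proof.
move=> s t st; have E := good_off eta st.
have [gs|bs] := pselect (good eta s); last by rewrite !cut_bad // -E.
by rewrite !cut_good // -E.
Qed.

Let card_fold n : (#|J n|%:R : R) <= n%:R.
Proof. by rewrite ler_nat; have := max_card (mem (J n)); rewrite card_ord. Qed.

Let share_le1 n : n%:R^-1 * #|J n|%:R <= 1 :> R.
Proof.
have := card_fold n; case: (posnP n) => [->|n0] h.
  by rewrite invr0 mul0r.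
by rewrite ler_pdivrMl ?mulr1 // ltr0n.
Qed.

Let measurable_fold_sum n (f : n.-tuple T -> T -> R) :
  measurable_fun setT (fun p : n.-tuple T * T => f p.1 p.2) ->
  measurable_fun setT (fun w => \sum_(i in J n) f (data n w) (tnth (data n w) i)).
Proof.
move=> mf; apply: (measurableT_comp (f := fun s : n.-tuple T =>
  \sum_(i in J n) f s (tnth s i)) (g := data n)); last exact: measurable_sample.
under eq_fun do rewrite -big_enum /=.
by apply: measurable_sum => i; exact: measurable_plug.
Qed.

Lemma fold_sqr_vanishing : vanishing P (fun n w =>
  n%:R^-1 * \sum_(i in J n) r (data n w) (tnth (data n w) i) ^+ 2).
Proof.
move=> e e0.
have e2 : 0 < e / 2 by rewrite divr_gt0.
(* Markov's inequality at level [e] then costs [e / 2], and the other half is spent on the bad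
   samples. The [+ 1] covers [K = 0]. *)
pose eta := (e * (e / 2)) / (K + 1).
have K1 : 0 < K + 1 by rewrite ltr_wpDl.
have eta0 : 0 < eta by rewrite divr_gt0 // mulr_gt0.
have Keta : K * eta <= e * (e / 2).
  rewrite /eta mulrA ler_pdivrMr // mulrC ler_wpM2l ?lerDl // ltW // mulr_gt0 //.
apply: filterS (good_near e2 eta0) => n [A [mA PA hA]].
pose f (s : n.-tuple T) (w : T) := cut eta s * r s w ^+ 2.
pose Z w := n%:R^-1 * \sum_(i in J n) f (data n w) (tnth (data n w) i).
have mf : measurable_fun setT (fun p : n.-tuple T * T => f p.1 p.2).
  by apply: measurable_funM; [exact: mcut|apply: measurable_funX; exact: mr].
have f0 s w : 0 <= f s w by rewrite mulr_ge0 ?sqr_ge0 // indicE.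
have mS := measurable_fold_sum mf.
have mZ : measurable_fun setT Z by exact: measurable_funM.
have Z0 w : 0 <= Z w by rewrite mulr_ge0 ?invr_ge0 // sumr_ge0.
have ZE : (\int[P]_w (Z w)%:E <= (K * eta)%:E)%E.
  under eq_integral do rewrite EFinM.
  rewrite ge0_integralZl_EFin ?invr_ge0 //; last 2 first.
  - by move=> w _; rewrite lee_fin sumr_ge0.
  - exact/measurable_EFinP.
  apply: (@le_trans _ _ (n%:R^-1%:E * (#|J n|%:R * (K * eta))%:E)%E).
    apply: lee_wpmul2l; first by rewrite lee_fin invr_ge0.
    apply: (fold_sum_first_moment iid) => //.
      by move=> s t st; rewrite /f (cut_off _ st) (r_off st).
    move=> s; have [gs|bs] := pselect (good eta s); rewrite /f.
      under eq_integral do rewrite (cut_good gs) mul1r.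
      rewrite (L1_EFin (L2_L1_sqr (r_L2 gs))) lee_fin; exact: r_second_moment gs.
    under eq_integral do rewrite (cut_bad bs) mul0r.
    by rewrite integral0 lee_fin mulr_ge0 // ltW.
  rewrite -EFinM lee_fin [X in X <= _]mulrA.
  by apply: ler_piMl (share_le1 n); exact: mulr_ge0 K_ge0 (ltW eta0).
have mB : measurable [set w | e <= Z w].
  rewrite -[X in measurable X]setTI.
  rewrite (_ : [set w | _] = Z @^-1` `[e, +oo[%classic); first exact: mZ.
  by apply/seteqP; split=> w; rewrite /= in_itv /= andbT.
exists (A `|` [set w | e <= Z w]); split; first exact: measurableU.
  apply: le_trans (measureU2 _ mA mB) _.
  rewrite [X in X%:E]splitr EFinD; apply: leeD => //.
  apply: le_trans (markov_ge0 P mZ Z0 e0) _.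
  rewrite lee_pdivrMl // -EFinM; apply: le_trans ZE _.
  by rewrite lee_fin.
move=> w /not_orP[/hA gw /negP]; rewrite -ltNge => Zw.
rewrite ger0_norm; last first.
  by rewrite mulr_ge0 ?invr_ge0 // sumr_ge0 // => i _; exact: sqr_ge0.
move: (ltW Zw); rewrite /Z /f.
by under eq_bigr do rewrite (cut_good gw) mul1r.
Qed.

Hypothesis bias : vanishing P
  (fun n w => Num.sqrt n%:R * \int[P]_w' r (data n w) (W w')).

Lemma fold_drift_vanishing : vanishing P (fun n w =>
  (Num.sqrt n%:R)^-1 * \sum_(i in J n) r (data n w) (tnth (data n w) i)).
Proof.
(* Three exceptional sets are discarded, each of probability at most [e]: bad samples, large bias
   and large centred sum. For the last one Markov's inequality is applied to a square at level
   [e ^ 2], hence the choice of [eta]. *)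
move=> e' e'0; pose e := e' / 3.
have e0 : 0 < e by rewrite divr_gt0.
pose eta := (e ^+ 2 * e) / (K + 1).
have K1 : 0 < K + 1 by rewrite ltr_wpDl.
have e20 : 0 < e ^+ 2 by rewrite exprn_gt0.
have eta0 : 0 < eta by rewrite divr_gt0 // mulr_gt0.
have Keta : K * eta <= e ^+ 2 * e.
  rewrite /eta mulrA ler_pdivrMr // mulrC ler_wpM2l ?lerDl // ltW // mulr_gt0 //.
have n1 : \forall n \near \oo, (0 < n)%N by exact: nbhs_infty_gt.
apply: filterS3 n1 (good_near e0 eta0) (bias e0) =>
  n n0 [A [mA PA hA]] [B [mB PB hB]].
pose b (s : n.-tuple T) := \int[P]_w r s (W w).
pose f (s : n.-tuple T) (w : T) := cut eta s * (r s w - b s).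
pose Z w := n%:R^-1 * (\sum_(i in J n) f (data n w) (tnth (data n w) i)) ^+ 2.
have mb : measurable_fun setT (fun p : n.-tuple T * T => b p.1).
  apply: (measurableT_comp (f := b)); first exact: measurable_Rintegral_section.
  exact: measurable_fst.
have mf : measurable_fun setT (fun p : n.-tuple T * T => f p.1 p.2).
  apply: measurable_funM; first exact: mcut.
  by apply: measurable_funB; [exact: mr|exact: mb].
have mS := measurable_fold_sum mf.
have mZ : measurable_fun setT Z.
  by apply: measurable_funM => //; exact: measurable_funX.
have Z0 w : 0 <= Z w by rewrite mulr_ge0 ?invr_ge0 // sqr_ge0.
have ZE : (\int[P]_w (Z w)%:E <= (K * eta)%:E)%E.
  under eq_integral do rewrite EFinM.
  rewrite ge0_integralZl_EFin ?invr_ge0 //; last 2 first.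
  - by move=> w _; rewrite lee_fin sqr_ge0.
  - by apply/measurable_EFinP; exact: measurable_funX.
  apply: (@le_trans _ _ (n%:R^-1%:E * (#|J n|%:R * (K * eta))%:E)%E).
    apply: lee_wpmul2l; first by rewrite lee_fin invr_ge0.
    apply: (fold_sum_second_moment iid) => //.
    - by move=> s t st; rewrite /f /b (cut_off _ st) (r_off st).
    - move=> s; have [gs|bs] := pselect (good eta s); rewrite /f.
        under eq_Rintegral do rewrite (cut_good gs) mul1r.
        rewrite RintegralB //; [|exact: L2_L1 (r_L2 gs)|exact: L1_cst].
        by rewrite Rintegral_prob_cst subrr.
      under eq_Rintegral do rewrite (cut_bad bs) mul0r.
      exact: Rintegral_prob_cst.
    - move=> s; have [gs|bs] := pselect (good eta s); rewrite /f.
        under eq_integral do rewrite (cut_good gs) mul1r.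
        rewrite (L1_EFin (L2_L1_sqr (L2B (r_L2 gs) (L2_cst P _)))) lee_fin.
        apply: le_trans (r_second_moment gs).
        rewrite (Rintegral_sqrD _ (r_L2 gs)) -/(b s) sqrrN.
        by have := sqr_ge0 (b s); lra.
      under eq_integral do rewrite (cut_bad bs) mul0r expr0n /=.
      by rewrite integral0 lee_fin mulr_ge0 // ltW.
  rewrite -EFinM lee_fin [X in X <= _]mulrA.
  by apply: ler_piMl (share_le1 n); exact: mulr_ge0 K_ge0 (ltW eta0).
have mC : measurable [set w | e ^+ 2 <= Z w].
  rewrite -[X in measurable X]setTI.
  rewrite (_ : [set w | _] = Z @^-1` `[e ^+ 2, +oo[%classic); first exact: mZ.
  by apply/seteqP; split=> w; rewrite /= in_itv /= andbT.
exists (A `|` B `|` [set w | e ^+ 2 <= Z w]); split.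
- by apply: measurableU => //; exact: measurableU.
- apply: le_trans (measureU2 _ (measurableU _ _ mA mB) mC) _.
  have -> : e' = e + e + e by rewrite /e; field.
  rewrite EFinD; apply: leeD.
    by apply: le_trans (measureU2 _ mA mB) _; rewrite EFinD; exact: leeD.
  apply: le_trans (markov_ge0 P mZ Z0 e20) _.
  rewrite lee_pdivrMl // -EFinM; apply: le_trans ZE _.
  by rewrite lee_fin.
move=> w /not_orP[/not_orP[/hA gw /hB bw] /negP]; rewrite -ltNge => Zw.
apply: (@le_trans _ _ (e + e)); last by rewrite /e; lra.
apply: (@drift_split R n #|J n| _ (b (data n w)) _ e n0 (card_fold n) _ _ (ltW e0) bw);
  last exact: ltW Zw.
rewrite /f; under [RHS]eq_bigr do rewrite (cut_good gw) mul1r.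
by rewrite sumrB sumr_const mulr_natl.
Qed.

End conditional_negligibility.

(** * Exceptional events for extended-real errors *)

Section ereal_squares.
Context {R : realType}.
Implicit Types (x y z : \bar R) (e : R).

Lemma lt_sqre e x : 0 < e -> (0 <= x)%E ->
  (e%:E < x)%E = ((e ^+ 2)%:E < x ^+ 2)%E.
Proof.
move=> e0; case: x => [x| |] // x0; last by rewrite expe2 mulyy !ltry.
by rewrite -EFin_expe !lte_fin ltr_pXn2r ?nnegrE // ltW.
Qed.

Lemma le_sqre e x : 0 < e -> (0 <= x)%E ->
  (x <= e%:E)%E -> (x ^+ 2 <= (e ^+ 2)%:E)%E.
Proof. by move=> e0 x0; rewrite !leNgt lt_sqre. Qed.

Lemma sqreM3 x y z : ((x * y * z) ^+ 2 = x ^+ 2 * y ^+ 2 * z ^+ 2)%E.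
Proof. by rewrite !expe2 muleACA (muleACA x y). Qed.

End ereal_squares.

(** Measurability is required of the square because the square of an L2 norm is an integral
    depending on the sample, which Tonelli makes measurable. The exceptional event is rewritten in
    terms of squares accordingly. *)
Lemma cvg_in_prob_event {dO : measure_display} {Omega : measurableType dO}
  {R : realType} (P : probability Omega R) (Z : nat -> Omega -> \bar R)
  (z e : R) :
  (forall n, measurable_fun setT (fun w => Z n w ^+ 2)%E) ->
  (forall n w, 0 <= Z n w)%E -> cvg_in_prob P Z 0 -> 0 < z -> 0 < e ->
  \forall n \near \oo, exists A : set Omega,
    [/\ measurable A, (P A <= e%:E)%E & forall w, ~ A w -> (Z n w <= z%:E)%E].
Proof.
move=> mZ Z0 /(_ z) cZ z0 e0.
have /fine_cvgP[_ /cvgrPdist_le /(_ _ e0)] := cZ z0.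
apply: filterS => n; pose A := [set w | (z%:E < `|Z n w - 0%:E|)%E].
have AE : A = [set w | ((z ^+ 2)%:E < Z n w ^+ 2)%E].
  apply/seteqP; split=> w; rewrite /A /= sube0 (gee0_abs (Z0 n w)).
    by rewrite (lt_sqre z0 (Z0 n w)).
  by rewrite (lt_sqre z0 (Z0 n w)).
have mA : measurable A.
  rewrite AE -[X in measurable X]setTI.
  rewrite (_ : [set w | _] =
      (fun w => Z n w ^+ 2)%E @^-1` `](z ^+ 2)%:E, +oo[%classic).
    by apply: mZ => //; exact: emeasurable_itv.
  by apply/seteqP; split=> w; rewrite /= in_itv /= andbT.
rewrite /= sub0r normrN ger0_norm ?fine_ge0 // => PA.
exists A; split => //.
  by rewrite -(fineK (fin_num_measure P _ mA)) lee_fin.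
by move=> w /negP; rewrite sube0 (gee0_abs (Z0 n w)) -leNgt.
Qed.

Section learner_score.
Context {dw dx : measure_display} {Wt : measurableType dw}
  {Xt : measurableType dx} {R : realType}.
Variables (xc : {mfun Wt >-> Xt}) (yc : {mfun Wt >-> R})
  (m : Wt -> (Xt -> R) -> R).

Lemma measurable_learner_xc n (f : n.-tuple Wt -> Xt -> R) :
  measurable_fun setT (fun p : n.-tuple Wt * Xt => f p.1 p.2) ->
  measurable_fun setT (fun p : n.-tuple Wt * Wt => f p.1 (xc p.2)).
Proof.
move=> mf; apply: (measurableT_comp (g := fun p : n.-tuple Wt * Wt =>
  (p.1, xc p.2)) mf).
apply: measurable_fun_pair => //.
by apply: measurableT_comp => //; exact: measurable_snd.
Qed.

Lemma measurable_learner_score n (g a : n.-tuple Wt -> Xt -> R) :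
  measurable_fun setT (fun p : n.-tuple Wt * Xt => g p.1 p.2) ->
  measurable_fun setT (fun p : n.-tuple Wt * Xt => a p.1 p.2) ->
  measurable_fun setT (fun p : n.-tuple Wt * Wt => m p.2 (g p.1)) ->
  measurable_fun setT (fun p : n.-tuple Wt * Wt =>
    debiased_score xc yc m (g p.1) (a p.1) p.2).
Proof.
move=> mg ma mm; apply: measurable_funD; first exact: mm.
apply: measurable_funM; first exact: measurable_learner_xc.
apply: measurable_funB; last exact: measurable_learner_xc.
by apply: measurableT_comp => //; exact: measurable_snd.
Qed.

Variables (L n : nat) (I : 'I_L -> {set 'I_n})
  (gh ah : 'I_L -> n.-tuple Wt -> Xt -> R).
Hypothesis mgh : forall l,
  measurable_fun setT (fun p : n.-tuple Wt * Xt => gh l p.1 p.2).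
Hypothesis mah : forall l,
  measurable_fun setT (fun p : n.-tuple Wt * Xt => ah l p.1 p.2).
Hypothesis m_gh : forall l,
  measurable_fun setT (fun p : n.-tuple Wt * Wt => m p.2 (gh l p.1)).

Let mscore l i : measurable_fun [set: n.-tuple Wt]
  (fun s => debiased_score xc yc m (gh l s) (ah l s) (tnth s i)).
Proof.
apply: (measurable_plug (r := fun s w => debiased_score xc yc m (gh l s) (ah l s) w)).
exact: measurable_learner_score.
Qed.

Lemma measurable_theta_hat :
  measurable_fun [set: n.-tuple Wt] (theta_hat xc yc m I gh ah).
Proof.
apply: measurable_funM => //; apply: measurable_sum => l.
by under eq_fun do rewrite -big_enum /=; exact: measurable_sum.
Qed.

Lemma measurable_V_hat :
  measurable_fun [set: n.-tuple Wt] (V_hat xc yc m I gh ah).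
Proof.
apply: measurable_funM => //; apply: measurable_sum => l.
under eq_fun do rewrite -big_enum /=.
apply: measurable_sum => i; apply: measurable_funX; apply: measurable_funB => //.
exact: measurable_theta_hat.
Qed.

End learner_score.

(** * Score errors of the learners on one fold *)

Section fold_error.
Context {dO dw dx : measure_display} {Omega : measurableType dO}
  {Wt : measurableType dw} {Xt : measurableType dx} {R : realType}
  (P : probability Omega R) (W : {RV P >-> Wt}) (Ws : nat -> {RV P >-> Wt})
  (xc : {mfun Wt >-> Xt}) (yc : {mfun Wt >-> R})
  (m : Wt -> (Xt -> R) -> R) (gamma0 sigma02 alpha0 : Xt -> R) (M S C : R).
Let X : Omega -> Xt := fun omega => xc (W omega).
Let Y : Omega -> R := fun omega => yc (W omega).
Let data n := sample (fun i => Ws i : Omega -> Wt) n.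

Hypothesis iid : iid_copies W Ws.
Hypothesis m_linear : linear_functional P W xc m.
Hypothesis gamma0_cond : cond_expectation P X Y gamma0.
Hypothesis gamma0_sq : sq_integrable P X gamma0.
Hypothesis alpha0_riesz : riesz_representer P W xc m alpha0.
Hypothesis sigma02_cond :
  cond_expectation P X (fun w => (Y w - gamma0 (X w)) ^+ 2) sigma02.
Hypothesis M_ge0 : 0 <= M.
Hypothesis m_bounded : forall alpha, sq_integrable P X alpha ->
  ('E_P[fun w => (m (W w) alpha ^+ 2)%R] <=
   M%:E * l2norm P W (fun w => alpha (xc w)) ^+ 2)%E.
Hypothesis sigma02_bounded : ae_bounded_by P X sigma02 S.

Variables (J : forall n, {set 'I_n})
  (gh ah : forall n, n.-tuple Wt -> Xt -> R).
Arguments gh {n}.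
Arguments ah {n}.

Let errg n (s : n.-tuple Wt) : \bar R :=
  l2norm P W (fun w => gh s (xc w) - gamma0 (xc w)).
Let erra n (s : n.-tuple Wt) : \bar R :=
  l2norm P W (fun w => ah s (xc w) - alpha0 (xc w)).

Hypothesis gh_off : forall n, learner_off (J n) (@gh n).
Hypothesis ah_off : forall n, learner_off (J n) (@ah n).
Hypothesis m_gh : forall n, measurable_fun setT
  (fun p : n.-tuple Wt * Wt => m p.2 (gh p.1)).
Hypothesis errg0 : cvg_in_prob P (fun n w => errg (data n w)) 0.
Hypothesis erra0 : cvg_in_prob P (fun n w => erra (data n w)) 0.
Hypothesis err_prod0 : cvg_in_prob P (fun n w =>
  ((Num.sqrt n%:R)%:E * errg (data n w) * erra (data n w))%E) 0.
Hypothesis ah_bounded : forall n,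
  {ae P, forall w, ae_bounded_by P X (ah (data n w)) C}.

Let mX : measurable_fun setT X.
Proof. by apply: measurableT_comp => //; exact: measurable_funPT. Qed.

Let measurable_tuple_X n (f : n.-tuple Wt -> Xt -> R) :
  measurable_fun setT (fun p : n.-tuple Wt * Xt => f p.1 p.2) ->
  measurable_fun setT (fun p : n.-tuple Wt * Omega => f p.1 (X p.2)).
Proof.
move=> mf; apply: (measurableT_comp (g := fun p : n.-tuple Wt * Omega =>
  (p.1, X p.2)) mf).
apply: measurable_fun_pair => //.
by apply: measurableT_comp => //; exact: measurable_snd.
Qed.

Let measurable_learner_section n (f : n.-tuple Wt -> Xt -> R) s :
  measurable_fun setT (fun p : n.-tuple Wt * Xt => f p.1 p.2) ->
  measurable_fun setT (f s).
Proof.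
move=> mf; apply: (measurableT_comp (g := fun x : Xt => (s, x)) mf).
exact: measurable_fun_pair.
Qed.

Let mgamma0 : measurable_fun setT gamma0. Proof. by have [] := gamma0_sq. Qed.
Let malpha0 : measurable_fun setT alpha0.
Proof. by have [[]] := alpha0_riesz. Qed.
Let mgh n := (gh_off n).1.
Let mah n := (ah_off n).1.

Let normg n (s : n.-tuple Wt) : \bar R :=
  (\int[P]_w ((gh s (X w) - gamma0 (X w)) ^+ 2)%:E)%E.
Let norma n (s : n.-tuple Wt) : \bar R :=
  (\int[P]_w ((ah s (X w) - alpha0 (X w)) ^+ 2)%:E)%E.
Let excess n (s : n.-tuple Wt) : \bar R :=
  (\int[P]_w (Num.max (`|ah s (X w)| - C) 0)%:E)%E.

Let measurable_norm n (f : n.-tuple Wt -> Xt -> R) (f0 : Xt -> R) :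
  measurable_fun setT (fun p : n.-tuple Wt * Xt => f p.1 p.2) ->
  measurable_fun setT f0 ->
  measurable_fun [set: n.-tuple Wt]
    (fun s => (\int[P]_w ((f s (X w) - f0 (X w)) ^+ 2)%:E)%E).
Proof.
move=> mf mf0; apply: (measurable_fun_fubini_tonelli_F (m2 := P)
  (fun p : n.-tuple Wt * Omega => ((f p.1 (X p.2) - f0 (X p.2)) ^+ 2)%:E));
  last by move=> p; rewrite lee_fin sqr_ge0.
apply/measurable_EFinP; apply: measurable_funX; apply: measurable_funB.
  exact: measurable_tuple_X.
apply: (measurableT_comp mf0).
by apply: measurableT_comp => //; exact: measurable_snd.
Qed.

Let measurable_excess n : measurable_fun [set: n.-tuple Wt] (@excess n).
Proof.
apply: (measurable_fun_fubini_tonelli_F (m2 := P)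
  (fun p : n.-tuple Wt * Omega => (Num.max (`|ah p.1 (X p.2)| - C) 0)%:E));
  last by move=> p; rewrite lee_fin le_max lexx orbT.
apply/measurable_EFinP; apply: measurable_maxr => //.
apply: measurable_funB => //; apply: measurableT_comp => //.
exact: measurable_tuple_X.
Qed.

Let excess0P n (s : n.-tuple Wt) :
  excess s = 0%E <-> ae_bounded_by P X (ah s) C.
Proof.
pose f w : R := Num.max (`|ah s (X w)| - C) 0.
have f0 w : 0 <= f w by rewrite le_max lexx orbT.
have mf : measurable_fun setT (EFin \o f).
  apply/measurable_EFinP; apply: measurable_maxr => //.
  apply: measurable_funB => //; apply: measurableT_comp => //.
  by apply: measurableT_comp => //; exact: measurable_learner_section.
have -> : excess s = (\int[P]_w `|(EFin \o f) w|)%E.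
  by apply: eq_integral => w _; rewrite gee0_abs // lee_fin.
have := @ae_eq_integral_abs _ _ _ P setT measurableT _ mf.
move=> -> ; split; apply: filterS => w /=.
  move=> /(_ I) [] /eqP; rewrite /f => /eqP h.
  by rewrite -subr_le0 -h le_max lexx.
by move=> h _; congr EFin; apply/max_idPr; rewrite subr_le0.
Qed.

(* [excess s = 0] says that [ah s] is bounded by [C], in a form measurable in
   [s]. *)
Let good n (eta : R) : set (n.-tuple Wt) :=
  [set s | [/\ (normg s <= eta%:E)%E, (norma s <= eta%:E)%E & excess s = 0%E]].

Let measurable_good n eta : measurable (@good n eta).
Proof.
have -> : @good n eta = (@normg n @^-1` `]-oo, eta%:E]%classic) `&`
    ((@norma n @^-1` `]-oo, eta%:E]%classic) `&` (@excess n @^-1` [set 0%E])).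
  apply/seteqP; split=> s; rewrite /good /= !in_itv /=.
    by move=> [? ? ?]; split.
  by move=> [? [? ?]]; split.
have mpre (f : n.-tuple Wt -> \bar R) (A : set (\bar R)) :
    measurable_fun setT f -> measurable A -> measurable (f @^-1` A).
  by move=> mf mA; rewrite -[X in measurable X]setTI; exact: mf.
apply: measurableI; last apply: measurableI.
- by apply: mpre; [exact: measurable_norm|exact: emeasurable_itv].
- by apply: mpre; [exact: measurable_norm|exact: emeasurable_itv].
- by apply: mpre => //; exact: emeasurable_set1.
Qed.

Let err_score n (s : n.-tuple Wt) (w : Wt) : R :=
  score_error xc yc m gamma0 alpha0 (gh s) (ah s) w.

Let measurable_err_score n : measurable_fun setT
  (fun p : n.-tuple Wt * Wt => err_score p.1 p.2).
Proof.
apply: measurable_funB; first exact: measurable_learner_score.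
apply: (measurableT_comp (f := debiased_score xc yc m gamma0 alpha0)).
  exact: (measurable_debiased_score yc m_linear gamma0_sq malpha0).
exact: measurable_snd.
Qed.
Let K := 3 * (M + C ^+ 2) + 3 * S.

Let K_ge0 : 0 <= K.
Proof.
have S0 := ae_bounded_ge0 sigma02_bounded.
by rewrite addr_ge0 // mulr_ge0 // addr_ge0 // sqr_ge0.
Qed.

Section good_sample.
Variables (n : nat) (eta : R) (s : n.-tuple Wt).
Hypothesis gs : good eta s.

Let mg : measurable_fun setT (gh s). Proof. exact: measurable_learner_section. Qed.
Let ma : measurable_fun setT (ah s). Proof. exact: measurable_learner_section. Qed.
Let aC : ae_bounded_by P X (ah s) C.
Proof. by case: gs => _ _ /excess0P. Qed.
Let dg2 : L2 P (fun w => gh s (X w) - gamma0 (X w)).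
Proof.
case: gs => h _ _; split; last exact: le_lt_trans h (ltry _).
by apply: measurable_funB; exact: measurableT_comp.
Qed.
Let da2 : L2 P (fun w => ah s (X w) - alpha0 (X w)).
Proof.
case: gs => _ h _; split; last exact: le_lt_trans h (ltry _).
by apply: measurable_funB; exact: measurableT_comp.
Qed.

Lemma good_err_L2 : L2 P (fun w => err_score s (W w)).
Proof.
exact: (score_error_L2 m_linear gamma0_sq alpha0_riesz sigma02_cond m_bounded
  sigma02_bounded mg ma aC dg2 da2).
Qed.

Lemma good_err_second_moment : \int[P]_w (err_score s (W w) ^+ 2) <= K * eta.
Proof.
have := score_error_second_moment m_linear gamma0_sq alpha0_riesz sigma02_cond
  m_bounded sigma02_bounded mg ma aC dg2 da2.
move=> /le_trans; apply.
have S0 := ae_bounded_ge0 sigma02_bounded.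
case: gs => hg ha _.
have {hg} hg : \int[P]_w ((gh s (X w) - gamma0 (X w)) ^+ 2) <= eta.
  by rewrite -lee_fin -L1_EFin //; exact: L2_L1_sqr dg2.
have {ha} ha : \int[P]_w ((ah s (X w) - alpha0 (X w)) ^+ 2) <= eta.
  by rewrite -lee_fin -L1_EFin //; exact: L2_L1_sqr da2.
rewrite [K * eta]mulrDl; apply: lerD.
  by apply: ler_wpM2l => //; rewrite mulr_ge0 // addr_ge0 // sqr_ge0.
by apply: ler_wpM2l => //; rewrite mulr_ge0.
Qed.

Lemma good_err_mean (z : R) : 0 <= z ->
  ((Num.sqrt n%:R)%:E * errg s * erra s <= z%:E)%E ->
  Num.sqrt n%:R * `|\int[P]_w err_score s (W w)| <= z.
Proof.
move=> z0.
have := score_error_mean_sqr m_linear gamma0_cond gamma0_sq alpha0_riesz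
  sigma02_cond m_bounded sigma02_bounded mg ma aC dg2 da2.
(* On a good sample both norms are finite, so the extended-real product in the rate condition can be
   read as a product of real numbers. *)
have -> : errg s = (Num.sqrt (\int[P]_w ((gh s (X w) - gamma0 (X w)) ^+ 2)))%:E.
  rewrite /errg /l2norm expectationE.
  by rewrite (L1_EFin (L2_L1_sqr dg2)).
have -> : erra s = (Num.sqrt (\int[P]_w ((ah s (X w) - alpha0 (X w)) ^+ 2)))%:E.
  rewrite /erra /l2norm expectationE.
  by rewrite (L1_EFin (L2_L1_sqr da2)).
rewrite -/(X _).
set b := \int[P]_w _; set G := \int[P]_w _; set A := \int[P]_w _ => bGA.
rewrite -!EFinM lee_fin -mulrA; apply: le_trans.
apply: ler_wpM2l; first exact: sqrtr_ge0.
have G0 : 0 <= G by apply: Rintegral_ge0 => w _; exact: sqr_ge0.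
by rewrite -sqrtrM // -sqrtr_sqr ler_wsqrtr.
Qed.

End good_sample.

Let gh_offE n (s t : n.-tuple Wt) :
  (forall i, i \notin J n -> tnth s i = tnth t i) -> gh s = gh t.
Proof. exact: (gh_off n).2. Qed.

Let ah_offE n (s t : n.-tuple Wt) :
  (forall i, i \notin J n -> tnth s i = tnth t i) -> ah s = ah t.
Proof. exact: (ah_off n).2. Qed.

Lemma off_err_score n : off_fold (J n) (@err_score n).
Proof.
move=> s t st; rewrite /err_score.
by rewrite (gh_offE st) (ah_offE st).
Qed.

Lemma off_good n eta (s t : n.-tuple Wt) :
  (forall i, i \notin J n -> tnth s i = tnth t i) -> good eta s = good eta t.
Proof.
move=> st; rewrite /good /= /normg /norma /excess.
by rewrite (gh_offE st) (ah_offE st).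
Qed.

Let measurable_data n : measurable_fun setT (data n).
Proof. exact: measurable_sample. Qed.

Let errg_sqr n (s : n.-tuple Wt) : (errg s ^+ 2 = normg s)%E.
Proof. exact: l2norm_sqr. Qed.

Let erra_sqr n (s : n.-tuple Wt) : (erra s ^+ 2 = norma s)%E.
Proof. exact: l2norm_sqr. Qed.

Let measurable_errg n : measurable_fun setT (fun w => errg (data n w) ^+ 2)%E.
Proof.
under eq_fun do rewrite errg_sqr.
have mn : measurable_fun [set: n.-tuple Wt] (@normg n) by exact: measurable_norm.
exact: (measurableT_comp (f := @normg n) (g := data n) mn (@measurable_data n)).
Qed.

Let measurable_erra n : measurable_fun setT (fun w => erra (data n w) ^+ 2)%E.
Proof.
under eq_fun do rewrite erra_sqr.
have mn : measurable_fun [set: n.-tuple Wt] (@norma n) by exact: measurable_norm.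
exact: (measurableT_comp (f := @norma n) (g := data n) mn (@measurable_data n)).
Qed.

Lemma good_near (e eta : R) : 0 < e -> 0 < eta ->
  \forall n \near \oo, exists A : set Omega,
    [/\ measurable A, (P A <= e%:E)%E & forall w, ~ A w -> good eta (data n w)].
Proof.
move=> e0 eta0; have e2 : 0 < e / 2 by rewrite divr_gt0.
(* The events come from norms, while [good] bounds squared norms by [eta]. The bound on [ah] adds
   only a null set. *)
have s0 : 0 < Num.sqrt eta by rewrite sqrtr_gt0.
have Eg := cvg_in_prob_event measurable_errg (fun n w => sqrte_ge0 _) errg0 s0 e2.
have Ea := cvg_in_prob_event measurable_erra (fun n w => sqrte_ge0 _) erra0 s0 e2.
apply: filterS2 Eg Ea => n [A [mA PA hA]] [B [mB PB hB]].
have [N [mN PN hN]] := @ah_bounded n.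
exists (A `|` B `|` N); split.
- by apply: measurableU => //; exact: measurableU.
- apply: le_trans (measureU2 _ (measurableU _ _ mA mB) mN) _.
  rewrite -[e%:E]adde0; apply: leeD; last first.
    by rewrite le_eqVlt; apply/orP; left; exact/eqP.
  apply: le_trans (measureU2 _ mA mB) _.
  by rewrite [X in X%:E]splitr EFinD; exact: leeD.
move=> w /not_orP[/not_orP[/hA gw /hB bw] nN].
have etaE : eta = Num.sqrt eta ^+ 2 by rewrite sqr_sqrtr // ltW.
split.
- by rewrite -errg_sqr etaE; apply: le_sqre => //; exact: sqrte_ge0.
- by rewrite -erra_sqr etaE; apply: le_sqre => //; exact: sqrte_ge0.
- by apply/excess0P; apply: contrapT => h; apply: nN; exact: hN.
Qed.

Lemma bias_vanishing : vanishing P (fun n w =>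
  Num.sqrt n%:R * \int[P]_w' err_score (data n w) (W w')).
Proof.
move=> e e0; have e2 : 0 < e / 2 by rewrite divr_gt0.
have mprod n : measurable_fun setT (fun w =>
    ((Num.sqrt n%:R)%:E * errg (data n w) * erra (data n w)) ^+ 2)%E.
  under eq_fun do rewrite sqreM3.
  apply: emeasurable_funM; last exact: measurable_erra.
  by apply: emeasurable_funM; [exact: measurable_cst|exact: measurable_errg].
have p0 n w : (0 <= (Num.sqrt n%:R)%:E * errg (data n w) * erra (data n w))%E.
  by rewrite !mule_ge0 ?sqrte_ge0 // lee_fin sqrtr_ge0.
have Ep := cvg_in_prob_event mprod p0 err_prod0 e0 e2.
(* Level 1 is enough: goodness supplies finite norms and the bound [C], and the smallness comes from
   the product of the norms. *)
apply: filterS2 Ep (good_near e2 (@ltr01 R)) => n [A [mA PA hA]] [B [mB PB hB]].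
exists (A `|` B); split; first exact: measurableU.
  apply: le_trans (measureU2 _ mA mB) _.
  by rewrite [X in X%:E]splitr EFinD; exact: leeD.
move=> w /not_orP[/hA pw /hB gw].
rewrite normrM (ger0_norm (sqrtr_ge0 _)).
exact: (good_err_mean gw (ltW e0) pw).
Qed.

Lemma fold_error_sqr : vanishing P (fun n w =>
  n%:R^-1 * \sum_(i in J n) err_score (data n w) (tnth (data n w) i) ^+ 2).
Proof.
apply: (fold_sqr_vanishing iid measurable_err_score off_err_score measurable_good
  off_good K_ge0 good_err_L2 good_err_second_moment good_near).
Qed.

Lemma fold_error_drift : vanishing P (fun n w => (Num.sqrt n%:R)^-1 *
  \sum_(i in J n) err_score (data n w) (tnth (data n w) i)).
Proof.
apply: (fold_drift_vanishing iid measurable_err_score off_err_score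
  measurable_good off_good K_ge0 good_err_L2 good_err_second_moment good_near
  bias_vanishing).
Qed.

End fold_error.

(** * Sample means and variances of perturbed summands *)

Lemma sum_sqr_lincomb {R : comRingType} {n : nat} (x y : 'I_n -> R) (b c : R) :
  \sum_i (b * x i - c * y i) ^+ 2 = b ^+ 2 * (\sum_i x i ^+ 2) -
  2 * b * c * (\sum_i x i * y i) + c ^+ 2 * (\sum_i y i ^+ 2).
Proof.
rewrite !mulr_sumr -sumrB -big_split /=.
by apply: eq_bigr => i _; ring.
Qed.

Lemma sum_sqr_Cauchy_Schwarz {R : realFieldType} {n : nat} (x y : 'I_n -> R) :
  (\sum_i x i * y i) ^+ 2 <= (\sum_i x i ^+ 2) * (\sum_i y i ^+ 2).
Proof.
set S := \sum_i x i * y i; set A := \sum_i x i ^+ 2; set B := \sum_i y i ^+ 2.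
have B0 : 0 <= B by apply: sumr_ge0 => i _; exact: sqr_ge0.
have [B1|B1] := eqVneq B 0.
  have y0 i : y i = 0.
    have /psumr_eq0P := B1 => /(_ (fun i _ => sqr_ge0 (y i)) i isT) /eqP.
    by rewrite sqrf_eq0 => /eqP.
  by rewrite B1 mulr0 /S big1 ?expr0n // => i _; rewrite y0 mulr0.
have : 0 <= \sum_i (B * x i - S * y i) ^+ 2.
  by apply: sumr_ge0 => i _; exact: sqr_ge0.
rewrite sum_sqr_lincomb -/S -/A -/B.
have -> : B ^+ 2 * A - 2 * B * S * S + S ^+ 2 * B = B * (A * B - S ^+ 2) by ring.
by rewrite pmulr_rge0 ?subr_ge0 // lt_def B1.
Qed.

Section plug_in_sums.
Context {R : realType} {n : nat} (x y : 'I_n -> R) (t : R).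
Let a := n%:R^-1 * \sum_i x i.
Let d := n%:R^-1 * \sum_i y i.
Let q := n%:R^-1 * \sum_i x i ^+ 2.
Let p := n%:R^-1 * \sum_i y i ^+ 2.
Let c := n%:R^-1 * \sum_i x i * y i.
Let th := n%:R^-1 * \sum_i (x i + y i + t).

Lemma mean_sqr_le : d ^+ 2 <= p.
Proof.
have := sum_sqr_Cauchy_Schwarz (fun=> 1) y.
under eq_bigr do rewrite mul1r.
under [X in _ <= X * _]eq_bigr do rewrite expr1n.
rewrite sumr_const card_ord /d /p exprMn => h.
case: (posnP n) => n0.
  have -> : n%:R = 0 :> R by rewrite n0.
  by rewrite invr0 expr0n /= !mul0r.
rewrite expr2 -mulrA; apply: ler_wpM2l; first by rewrite invr_ge0.
by rewrite ler_pdivrMl // ltr0n.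
Qed.

Lemma mean_cross_sqr_le : c ^+ 2 <= q * p.
Proof.
rewrite /c /q /p exprMn [X in _ <= X]mulrACA -expr2.
by apply: ler_wpM2l; [exact: sqr_ge0|exact: sum_sqr_Cauchy_Schwarz].
Qed.

(** In the application [x] is the influence function, [y] the score error and [t] the target; [x]
    and [t] cancel exactly, leaving the drift alone. *)
Lemma scaled_error_split : Num.sqrt n%:R * (th - t) -
  (\sum_i x i) / Num.sqrt n%:R = (Num.sqrt n%:R)^-1 * \sum_i y i.
Proof.
rewrite /th !big_split sumr_const card_ord -[t *+ n]mulr_natl /=.
(* At [n = 0] both sides are 0 because the inverse of 0 is 0; [vanishing_le] asks for the comparison
   at every [n]. *)
case: (posnP n) => n0.
  have -> : n%:R = 0 :> R by rewrite n0.
  by rewrite sqrtr0 invr0 !(mul0r, mulr0) subr0.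
have q0 : Num.sqrt n%:R != 0 :> R by rewrite sqrtr_eq0 -ltNge ltr0n.
have := sqr_sqrtr (ler0n R n); move: q0; move: (Num.sqrt _) => s s0 <-.
by field.
Qed.

(** Only [q] has a nonzero limit. The mean squared error [p] vanishes, [c] and [d] follow from it by
    Cauchy-Schwarz, and [a] vanishes by the weak law. *)
Lemma sample_variance_split : (0 < n)%N ->
  n%:R^-1 * \sum_i (x i + y i + t - th) ^+ 2 = q + 2 * c + p - (a + d) ^+ 2.
Proof.
move=> n0; have nn : n%:R != 0 :> R by rewrite pnatr_eq0 -lt0n.
have thE : th = a + d + t.
  rewrite /th !big_split sumr_const card_ord -[t *+ n]mulr_natl /=.
  by rewrite !mulrDr mulKf.
have aE : \sum_i x i = n%:R * a by rewrite /a mulVKf.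
have dE : \sum_i y i = n%:R * d by rewrite /d mulVKf.
have -> : \sum_i (x i + y i + t - th) ^+ 2 =
    \sum_i x i ^+ 2 + 2 * (\sum_i x i * y i) + \sum_i y i ^+ 2 -
    2 * (a + d) * (\sum_i x i + \sum_i y i) + \sum_(i < n) (a + d) ^+ 2.
  rewrite thE -big_split !mulr_sumr -!big_split -sumrB -big_split /=.
  by apply: eq_bigr => i _; ring.
rewrite aE dE sumr_const card_ord -[_ *+ n]mulr_natl /q /c /p.
by field.
Qed.

End plug_in_sums.

(** [l i] is the fold containing [i]. Sums over folds become one sum over the sample, so the score
    errors can be indexed by observations alone. *)
Lemma fold_partition_sum {R : realType} {L : nat}
  (I : forall n, 'I_L -> {set 'I_n}) : fold_partition (R := R) I ->
  forall n, exists l : 'I_n -> 'I_L, forall F : 'I_L -> 'I_n -> R,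
    \sum_l \sum_(i in I n l) F l i = \sum_i F (l i) i.
Proof.
move=> [part _] n.
have [l hl] : exists l : 'I_n -> 'I_L, forall i k, (i \in I n k) = (k == l i).
  have /choice[l hl] i : exists k, forall k', (i \in I n k') = (k' == k).
    have [k [ik uk]] := part n i; exists k => k'.
    by apply/idP/eqP => [/uk|->].
  by exists l.
exists l => F; under eq_bigr do rewrite big_mkcond.
rewrite exchange_big; apply: eq_bigr => i _ /=.
rewrite (bigD1 (l i)) //= hl eqxx big1 ?addr0 // => k ki.
by rewrite hl (negbTE ki).
Qed.

Theorem theorem2p3 (R : realType) (dO dw dx : measure_display)
    (Omega : measurableType dO) (Wt : measurableType dw)
    (Xt : measurableType dx) (P : probability Omega R)
    (W : {RV P >-> Wt}) (Ws : nat -> {RV P >-> Wt})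
    (xc : {mfun Wt >-> Xt}) (yc : {mfun Wt >-> R})
    (m : Wt -> (Xt -> R) -> R)
    (gamma0 sigma02 alpha0 : Xt -> R)
    (L : nat) (I : forall n, 'I_L -> {set 'I_n})
    (gammahat alphahat : forall n, 'I_L -> n.-tuple Wt -> Xt -> R) :
  let X : Omega -> Xt := fun omega => xc (W omega) in
  let Y : Omega -> R := fun omega => yc (W omega) in
  let data n omega := sample (fun i => Ws i : Omega -> Wt) n omega in
  let err_gamma n l omega :=
    l2norm P W (fun w => gammahat n l (data n omega) (xc w) - gamma0 (xc w)) in
  let err_alpha n l omega :=
    l2norm P W (fun w => alphahat n l (data n omega) (xc w) - alpha0 (xc w)) in
  let thetahat n omega :=
    theta_hat xc yc m (I n) (gammahat n) (alphahat n) (data n omega) in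
  let Vhat n omega :=
    V_hat xc yc m (I n) (gammahat n) (alphahat n) (data n omega) in
  let V := asymptotic_variance P W xc yc m gamma0 alpha0 in
  iid_copies W Ws ->
  linear_functional P W xc m ->
  mean_sq_continuous P W xc m ->
  cond_expectation P X Y gamma0 ->
  sq_integrable P X gamma0 ->
  riesz_representer P W xc m alpha0 ->
  cond_expectation P X (fun omega => (Y omega - gamma0 (X omega)) ^+ 2)
    sigma02 ->
  fold_partition (R := R) I ->
  (forall n l, learner_off (I n l) (gammahat n l)) ->
  (forall n l, learner_off (I n l) (alphahat n l)) ->
  (forall n l, measurable_fun setT
     (fun p : n.-tuple Wt * Wt => m p.2 (gammahat n l p.1))) ->
  (exists2 M : R, 0 < M & forall alpha, sq_integrable P X alpha ->
     ('E_P[fun omega => (m (W omega) alpha ^+ 2)%R] <=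
      M%:E * l2norm P W (fun w => alpha (xc w)) ^+ 2)%E) ->
  (exists C, ae_bounded_by P X alpha0 C) ->
  (exists C, ae_bounded_by P X sigma02 C) ->
  ('E_P[fun omega => (m (W omega) gamma0 ^+ 2)%R] < +oo)%E ->
  (forall l, cvg_in_prob P (fun n => err_gamma n l) 0) ->
  (forall l, cvg_in_prob P (fun n => err_alpha n l) 0) ->
  (forall l, cvg_in_prob P (fun n omega =>
     (Num.sqrt n%:R)%:E * err_gamma n l omega * err_alpha n l omega)%E 0) ->
  (forall l, exists C, forall n,
     {ae P, forall omega, ae_bounded_by P X (alphahat n l (data n omega)) C}) ->
  cvg_in_dist P (fun n omega =>
     Num.sqrt n%:R * (thetahat n omega - theta0 P W m gamma0)) (gaussian 0 V) /\
  cvg_in_prob P (fun n omega => (Vhat n omega)%:E) V.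
Proof.
move=> X Y data err_gamma err_alpha thetahat Vhat V iid m_linear _ gamma0_cond
  gamma0_sq alpha0_riesz sigma02_cond part gh_off ah_off m_gh [M M0 m_bounded] _
  [S sigma02_bounded] m_gamma0_sq errg0 erra0 err_prod0 ah_bounded.
pose psi := influence W xc yc m gamma0 alpha0.
have mpsi : measurable_fun setT psi by
  exact: (measurable_influence yc m_linear gamma0_sq alpha0_riesz).
have psi2 : L2 P (fun w => psi (W w)) by
  exact: (influence_L2 m_linear gamma0_sq alpha0_riesz sigma02_cond sigma02_bounded).
have psi0 : \int[P]_w psi (W w) = 0 by
  exact: (influence_mean m_linear gamma0_cond gamma0_sq alpha0_riesz
    sigma02_cond sigma02_bounded).
have VE : V = \int[P]_w (psi (W w) ^+ 2) by
  exact: (influence_variance W xc yc m gamma0 alpha0).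
pose delta n l (s : n.-tuple Wt) :=
  score_error xc yc m gamma0 alpha0 (gammahat n l s) (alphahat n l s).
(* The number of folds is fixed, so vanishing on each fold gives vanishing of the total; the bound
   on [alphahat] may differ from fold to fold. *)
have drift : vanishing P (fun n w => \sum_l (Num.sqrt n%:R)^-1 *
    \sum_(i in I n l) delta n l (data n w) (tnth (data n w) i)).
  apply: vanishing_sum => l; have [C aC] := ah_bounded l.
  exact: (fold_error_drift iid m_linear gamma0_cond gamma0_sq alpha0_riesz
    sigma02_cond (ltW M0) m_bounded sigma02_bounded (fun n => gh_off n l)
    (fun n => ah_off n l) (fun n => m_gh n l) (errg0 l) (erra0 l) (err_prod0 l) aC).
have sqr : vanishing P (fun n w => \sum_l n%:R^-1 *
    \sum_(i in I n l) delta n l (data n w) (tnth (data n w) i) ^+ 2).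
  apply: vanishing_sum => l; have [C aC] := ah_bounded l.
  exact: (fold_error_sqr iid m_linear gamma0_sq alpha0_riesz
    sigma02_cond (ltW M0) m_bounded sigma02_bounded (fun n => gh_off n l)
    (fun n => ah_off n l) (fun n => m_gh n l) (errg0 l) (erra0 l) aC).
have mdata n : measurable_fun setT (data n) by exact: measurable_sample.
have mtheta n : measurable_fun setT (thetahat n).
  apply: (measurableT_comp (f := theta_hat xc yc m (I n) (gammahat n) (alphahat n))).
    by apply: measurable_theta_hat => l; [exact: (gh_off n l).1|exact: (ah_off n l).1|].
  exact: mdata.
have mV n : measurable_fun setT (Vhat n).
  apply: (measurableT_comp (f := V_hat xc yc m (I n) (gammahat n) (alphahat n))).
    by apply: measurable_V_hat => l; [exact: (gh_off n l).1|exact: (ah_off n l).1|].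
  exact: mdata.
have scoreE n l (s : n.-tuple Wt) i :
    debiased_score xc yc m (gammahat n l s) (alphahat n l s) (tnth s i) =
    psi (tnth s i) + delta n l s (tnth s i) + theta0 P W m gamma0.
  by rewrite /psi /influence /delta /score_error; ring.
pose fold n := projT1 (cid (fold_partition_sum part n)).
have foldE n F : \sum_l \sum_(i in I n l) F l i = \sum_i F (fold n i) i :> R.
  exact: (projT2 (cid (fold_partition_sum part n))).
pose x n w i := psi (tnth (data n w) i).
pose y n w i := delta n (fold n i) (data n w) (tnth (data n w) i).
have thetaE n w : thetahat n w =
    n%:R^-1 * \sum_i (x n w i + y n w i + theta0 P W m gamma0).
  rewrite /thetahat /theta_hat foldE; congr (_ * _).
  by apply: eq_bigr => i _; exact: scoreE.
split.
  rewrite VE; apply: (clt_slutsky iid mpsi psi2 psi0).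
    by move=> n; apply: measurable_funM => //; exact: measurable_funB.
  apply: vanishing_le drift _ => n w.
  rewrite -mulr_sumr foldE thetaE.
  by rewrite (scaled_error_split (x n w) (y n w)).
apply: vanishing_cvg_in_prob => //.
pose q n w := n%:R^-1 * \sum_i x n w i ^+ 2.
pose p n w := n%:R^-1 * \sum_i y n w i ^+ 2.
pose c n w := n%:R^-1 * \sum_i x n w i * y n w i.
pose a n w := n%:R^-1 * \sum_i x n w i.
pose d n w := n%:R^-1 * \sum_i y n w i.
have vp : vanishing P p.
  apply: vanishing_le sqr _ => n w.
  by rewrite -mulr_sumr foldE.
have va : vanishing P a by exact: (weak_law_L2 iid mpsi psi2 psi0).
have vd : vanishing P d.
  apply: vanishing_sqr; apply: vanishing_le vp _ => n w.
  rewrite !ger0_norm ?sqr_ge0 //; first exact: mean_sqr_le.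
  exact: le_trans (sqr_ge0 _) (mean_sqr_le _).
have vq : vanishing P (fun n w => q n w - V).
  rewrite VE; apply: (weak_law_L1 iid (f := fun w => psi w ^+ 2)) => //.
  - exact: measurable_funX.
  - by move=> w; exact: sqr_ge0.
  - exact: L2_L1_sqr.
have vc : vanishing P c.
  apply: vanishing_sqr.
  (* Cauchy-Schwarz gives [c ^ 2 <= q p], and [q p = (q - V) p + V p] is a product of vanishing
     terms plus a constant multiple of one. *)
  apply: vanishing_le (vanishingD (vanishingM vq vp) (vanishingZ V vp)) _ => n w.
  rewrite -mulrDl subrK ger0_norm ?sqr_ge0 //.
  exact: le_trans (mean_cross_sqr_le _ _) (ler_norm _).
have vad := vanishingD va vd.
have vall := vanishingD (vanishingD (vanishingD vq (vanishingZ 2 vc)) vp)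
  (vanishingZ (-1) (vanishingM vad vad)).
move=> e e0.
have n1 : \forall n \near \oo, (0 < n)%N by exact: nbhs_infty_gt.
apply: filterS2 n1 (vall e e0) => n n0 [A [mA PA hA]]; exists A; split => //.
move=> w /hA; congr (`|_| <= _).
have -> : Vhat n w = n%:R^-1 * \sum_i (x n w i + y n w i + theta0 P W m gamma0 -
    n%:R^-1 * \sum_i (x n w i + y n w i + theta0 P W m gamma0)) ^+ 2.
  rewrite /Vhat /V_hat foldE -thetaE; congr (_ * _).
  by apply: eq_bigr => i _; rewrite scoreE.
rewrite (sample_variance_split (x n w) (y n w) _ n0).
by rewrite -/(q n w) -/(p n w) -/(c n w) -/(a n w) -/(d n w); ring.
Qed.
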